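(* Let $\mathbb{K}$ be a field of characteristic $0$ and let $(U,m)$ be a topologically free $\mathbb{K}[[\hbar]]$-algebra equipped with algebra morphisms $\Delta:U\to U\widehat{\otimes}U$ and $\epsilon:U\to\mathbb{K}[[\hbar]]$ with $(\epsilon\otimes \mathrm{id})\circ\Delta=(\mathrm{id}\otimes\epsilon)\circ\Delta=\mathrm{id}$, such that the reduction of $(U,m,\Delta)$ modulo $\hbar$ is a universal enveloping algebra. Set $$U'=\{x\in U\mid \text{for any tree }P,\ \delta^{(P)}(x)\in\hbar^{|P|}U^{\widehat\otimes |P|}\}.$$ Then: (i) $U'$ is a topologically free $\mathbb{K}[[\hbar]]$-algebra; in particular it is stable under the multiplication $m$. It is equipped with a complete decreasing algebra filtration $(U')^{(n)}=U'\cap\hbar^nU$, $n\ge 0$. (ii) The map $\Delta:U\to U^{\widehat\otimes 2}$ induces a continuous algebra morphism $$\Delta_{U'}:U'\to U'^{\bar\otimes 2}=\varprojlim_n\Big(U'^{\widehat\otimes 2}\Big/\sum_{p+q=n}U'^{(p)}\otimes U'^{(q)}\Big).$$ (iii) Set $\mathcal{O}:=U'/\hbar U'$. Then $\mathcal{O}$ is a complete commutative local ring, and the reduction modulo $\hbar$ of $\Delta_{U'}$ is a continuous ring morphism $$\Delta_{\mathcal O}:\mathcal{O}\to\mathcal{O}^{\bar\otimes 2}=\varprojlim_n\Big(\mathcal{O}^{\otimes 2}\Big/\sum_{p+q=n}\mathcal{O}^{(p)}\otimes\mathcal{O}^{(q)}\Big),$$ where $\mathcal{O}^{(p)}=U'^{(p)}/(\hbar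 U'\cap U'^{(p)})$.
   Context: $\widehat\otimes$ is the $\hbar$-adically completed tensor product over $\mathbb{K}[[\hbar]]$. ''The reduction modulo $\hbar$ is a universal enveloping algebra'' means $(U,m,\Delta)/\hbar\cong(U(\mathfrak g),m_0,\Delta_0)$ for some Lie algebra $\mathfrak g$ over $\mathbb{K}$, with its usual product and coproduct (elements of $\mathfrak g$ primitive). Trees: an $n$-tree is a binary complete planar rooted tree with $n$ leaves, and $|P|=n$. There is exactly one $0$-tree and one $1$-tree; for $n\ge2$ an $n$-tree $P$ is the same as an ordered pair $(P',P'')$ of trees (its left and right descendants) with $|P'|,|P''|\ge1$ and $|P'|+|P''|=n$. Maps $\delta^{(P)}:U\to U^{\widehat\otimes|P|}$: for the $0$-tree $\delta^{(0)}(x)=\epsilon(x)$; for the $1$-tree $\delta^{(1)}(x)=x-\epsilon(x)1$; for the $2$-tree $\delta(x)=\delta^{(2)}(x)=\Delta(x)-x\otimes1-1\otimes x+\epsilon(x)1\otimes1$; for $P$ with descendants $P',P''$, $\delta^{(P)}=(\delta^{(P')}\otimes\delta^{(P'')})\circ\delta$. ''Complete filtration'' means that $U'$ is complete and separated for the topology defined by the filtration; ''algebra filtration'' means $U'^{(i)}U'^{(j)}\subset U'^{(i+j)}$. $\mathcal O$ is complete for the filtration by the $\mathcal O^{(p)}$. Since $U'^{(p)}\subset\hbar^pU$, there is a natural map $U'^{\bar\otimes2}\to U^{\widehat\otimes2}$; ''$\Delta$ induces $\Delta_{U'}$'' means that the composition of $\Delta_{U'}$ with this map is the restriction of $\Delta$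 to $U'$. Continuity is with respect to the topologies defined by the filtrations. *)

(* Defs.v *)
From HB Require Import structures.
From mathcomp Require Import all_boot all_algebra.
From mathcomp Require Import generic_quotient boolp classical_sets.

Set Implicit Arguments.
Unset Strict Implicit.
Unset Printing Implicit Defensive.

Import GRing.Theory.
Local Open Scope quotient_scope.
Local Open Scope ring_scope.

(* [fps V] is V[[hbar]]: a ring if V is a field, and a module over K[[hbar]]
   if V is a K-vector space. *)
Definition fps (V : Type) := nat -> V.

HB.instance Definition _ (V : Type) := gen_eqMixin (fps V).
HB.instance Definition _ (V : Type) := gen_choiceMixin (fps V).

Section FpsZmod.
Variable V : zmodType.
Implicit Types f g h : fps V.

Let add f g : fps V := fun n => f n + g n.
Let opp f : fps V := fun n => - f n.
Let zero : fps V := fun=> 0.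

Fact fps_addA : associative add.
Proof. by move=> f g h; apply/funext => n; rewrite /add addrA. Qed.
Fact fps_addC : commutative add.
Proof. by move=> f g; apply/funext => n; rewrite /add addrC. Qed.
Fact fps_add0 : left_id zero add.
Proof. by move=> f; apply/funext => n; rewrite /add add0r. Qed.
Fact fps_addN : left_inverse zero opp add.
Proof. by move=> f; apply/funext => n; rewrite /add addNr. Qed.

HB.instance Definition _ :=
  GRing.isZmodule.Build (fps V) fps_addA fps_addC fps_add0 fps_addN.

Lemma fpsDE f g n : (f + g) n = f n + g n. Proof. by []. Qed.
Lemma fpsNE f n : (- f) n = - f n. Proof. by []. Qed.

Lemma triangle_sum (F : nat -> nat -> nat -> V) n :
  \sum_(i < n.+1) \sum_(j < (n - i).+1) F i j (n - i - j)%N =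
  \sum_(k < n.+1) \sum_(i < k.+1) F i (k - i)%N (n - k)%N.
Proof.
elim: n F => [|n IHn] F; first by rewrite !big_ord_recl !big_ord0.
rewrite big_ord_recl [RHS](eq_bigr (fun k : 'I_n.+2 => F 0 k (n.+1 - k)%N +
  \sum_(i < k) F i.+1 (k - i.+1)%N (n.+1 - k)%N)); last first.
  by move=> k _; rewrite big_ord_recl /= subn0.
rewrite big_split /= subn0; congr (_ + _).
rewrite [RHS]big_ord_recl big_ord0 add0r.
exact: (IHn (fun i => F i.+1)).
Qed.

End FpsZmod.

Section FpsRing.
Variable K : fieldType.
Implicit Types f g h : fps K.

Let one : fps K := fun n => (n == 0)%:R.
Let mul f g : fps K := fun n => \sum_(i < n.+1) f i * g (n - i)%N.

Fact fps_mulA : associative mul.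
Proof.
move=> f g h; apply/funext => n; rewrite /mul.
under eq_bigr do rewrite big_distrr /=.
rewrite (triangle_sum (fun i j k => f i * (g j * h k))).
apply: eq_bigr => k _; rewrite big_distrl /=.
by apply: eq_bigr => i _; rewrite mulrA.
Qed.

Fact fps_mulC : commutative mul.
Proof.
move=> f g; apply/funext => n; rewrite /mul (reindex_inj rev_ord_inj) /=.
apply: eq_bigr => i _; rewrite subSS mulrC; congr (g _ * f _).
by rewrite subKn // -ltnS.
Qed.

Fact fps_mul1 : left_id one mul.
Proof.
move=> f; apply/funext => n; rewrite /mul big_ord_recl /= /one eqxx mul1r subn0.
by rewrite big1 ?addr0 // => i _; rewrite mul0r.
Qed.

Fact fps_mulDl : left_distributive mul +%R.
Proof.
move=> f g h; apply/funext => n; rewrite /mul fpsDE -big_split /=.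
by apply: eq_bigr => i _; rewrite fpsDE mulrDl.
Qed.

Fact fps_oner_neq0 : one != 0.
Proof.
by apply/eqP => /(congr1 (fun f => f 0)) /eqP; rewrite /one eqxx oner_eq0.
Qed.

HB.instance Definition _ := GRing.Zmodule_isComNzRing.Build (fps K)
  fps_mulA fps_mulC fps_mul1 fps_mulDl fps_oner_neq0.

Lemma fps1E n : (1 : fps K) n = (n == 0)%:R. Proof. by []. Qed.
Lemma fpsME f g n : (f * g) n = \sum_(i < n.+1) f i * g (n - i)%N.
Proof. by []. Qed.

Definition hbar : fps K := fun n => (n == 1)%:R.

Definition fpsC (a : K) : fps K := fun n => if n is 0 then a else 0.

Fact fpsC_is_zmod_morphism : zmod_morphism fpsC.
Proof.
by move=> a b; apply/funext => -[|n]; rewrite ?fpsDE ?fpsNE //= subr0.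
Qed.
HB.instance Definition _ :=
  GRing.isZmodMorphism.Build K (fps K) fpsC fpsC_is_zmod_morphism.

Fact fpsC_is_monoid_morphism : monoid_morphism fpsC.
Proof.
split=> [|a b]; apply/funext => -[|n] //.
  by rewrite fpsME big_ord1.
by rewrite fpsME big_ord_recl /= mulr0 add0r big1 // => i _; rewrite mul0r.
Qed.
HB.instance Definition _ :=
  GRing.isMonoidMorphism.Build K (fps K) fpsC fpsC_is_monoid_morphism.

Lemma fps_split f : exists g, f = fpsC (f 0) + hbar * g.
Proof.
exists (fun n => f n.+1); apply/funext => -[|n]; rewrite fpsDE fpsME.
  by rewrite big_ord1 /hbar mul0r addr0.
rewrite big_ord_recl /hbar mul0r add0r big_ord_recl mul1r big1 /= ?addr0.
  by rewrite add0r subSS subn0.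
by move=> i _; rewrite mul0r.
Qed.

End FpsRing.

Arguments hbar {K}.

Section FpsLmod.
Variables (K : fieldType) (V : lmodType K).
Implicit Types (c d : fps K) (v w : fps V).

Let scale c v : fps V := fun n => \sum_(i < n.+1) c i *: v (n - i)%N.

Fact fps_scaleA c d v : scale c (scale d v) = scale (c * d) v.
Proof.
apply/funext => n; rewrite /scale.
under eq_bigr do rewrite scaler_sumr.
rewrite (triangle_sum (fun i j k => c i *: (d j *: v k))).
apply: eq_bigr => k _; rewrite fpsME scaler_suml.
by apply: eq_bigr => i _; rewrite scalerA.
Qed.

Fact fps_scale1 : left_id 1 scale.
Proof.
move=> v; apply/funext => n; rewrite /scale big_ord_recl /= fps1E scale1r subn0.
by rewrite big1 ?addr0 // => i _; rewrite fps1E scale0r.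
Qed.

Fact fps_scaleDr : right_distributive scale +%R.
Proof.
move=> c v w; apply/funext => n; rewrite /scale fpsDE -big_split /=.
by apply: eq_bigr => i _; rewrite fpsDE scalerDr.
Qed.

Fact fps_scaleDl v : {morph scale^~ v : c d / c + d}.
Proof.
move=> c d; apply/funext => n; rewrite /scale fpsDE -big_split /=.
by apply: eq_bigr => i _; rewrite fpsDE scalerDl.
Qed.

HB.instance Definition _ := GRing.Zmodule_isLmodule.Build (fps K) (fps V)
  fps_scaleA fps_scale1 fps_scaleDr fps_scaleDl.

End FpsLmod.

Definition topologically_free (K : fieldType) (M : lmodType (fps K)) : Prop :=
  exists (V : lmodType K) (f : {linear M -> fps V}), bijective f.


Section Quotient.
Variable M : zmodType.

Record subgroup := Subgroup {
  subgroup_set :> M -> Prop;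
  subgroup_subproof : subgroup_set 0 /\
    forall x y, subgroup_set x -> subgroup_set y -> subgroup_set (x - y) }.

Variable N : subgroup.

Lemma sub0 : N 0. Proof. by case: (subgroup_subproof N). Qed.
Lemma subB x y : N x -> N y -> N (x - y).
Proof. by case: (subgroup_subproof N) => _; apply. Qed.
Lemma subN x : N x -> N (- x).
Proof. by move=> Nx; rewrite -sub0r; apply: subB => //; apply: sub0. Qed.
Lemma subD x y : N x -> N y -> N (x + y).
Proof. by move=> Nx Ny; rewrite -(opprK y); apply: subB => //; apply: subN. Qed.
Lemma subC x y : N (x - y) -> N (y - x).
Proof. by move=> /subN; rewrite opprB. Qed.

Let eqv (x y : M) : bool := `[< N (x - y) >].

Fact quot_equiv : equiv_class_of eqv.
Proof.
split=> [x|x y|y x z]; rewrite /eqv.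
- by apply/asboolP; rewrite subrr; apply: sub0.
- by apply/idP/idP => /asboolP /subC /asboolP.
- move=> /asboolP Nxy /asboolP Nyz; apply/asboolP.
  by rewrite -(subrKA y); apply: subD.
Qed.

Canonical quot_equivRel := EquivRelPack quot_equiv.

Definition quot : Type := {eq_quot quot_equivRel}.
HB.instance Definition _ := Choice.on quot.

Definition cls (x : M) : quot := \pi_({eq_quot quot_equivRel}) x.
Definition rep (q : quot) : M := repr (q : {eq_quot quot_equivRel}).

Lemma repK q : cls (rep q) = q. Proof. exact: reprK. Qed.

Lemma cls_eq x y : cls x = cls y <-> N (x - y).
Proof.
by split=> [/eqmodP/asboolP //|Nxy]; apply/eqmodP/asboolP.
Qed.

Lemma rep_cls x : N (rep (cls x) - x). Proof. by apply/cls_eq; rewrite repK. Qed.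

Let add q r := cls (rep q + rep r).
Let opp q := cls (- rep q).

Let addE x y : add (cls x) (cls y) = cls (x + y).
Proof. by apply/cls_eq; rewrite opprD addrACA; apply: subD; exact: rep_cls. Qed.
Let oppE x : opp (cls x) = cls (- x).
Proof. by apply/cls_eq; rewrite -opprD; apply: subN; exact: rep_cls. Qed.

Fact quot_addA : associative add.
Proof.
by move=> q r s; rewrite -(repK q) -(repK r) -(repK s) !addE addrA.
Qed.
Fact quot_addC : commutative add.
Proof. by move=> q r; rewrite -(repK q) -(repK r) !addE addrC. Qed.
Fact quot_add0 : left_id (cls 0) add.
Proof. by move=> q; rewrite -(repK q) addE add0r. Qed.
Fact quot_addN : left_inverse (cls 0) opp add.
Proof. by move=> q; rewrite -(repK q) oppE addE addNr. Qed.

HB.instance Definition _ :=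
  GRing.isZmodule.Build quot quot_addA quot_addC quot_add0 quot_addN.

Fact cls_is_zmod_morphism : zmod_morphism cls.
Proof. by move=> x y; rewrite -addE -oppE. Qed.
HB.instance Definition _ :=
  GRing.isZmodMorphism.Build M quot cls cls_is_zmod_morphism.

Lemma cls0P x : cls x = 0 <-> N x.
Proof. by rewrite -[0](raddf0 cls) cls_eq subr0. Qed.

End Quotient.

Arguments cls {M} N x.
Arguments rep {M N} q.

Section QuotientModule.
Variables (R : pzRingType) (M : lmodType R).

Record submodule := Submodule {
  submodule_subgroup :> subgroup M;
  submodule_subproof :
    forall (c : R) x, submodule_subgroup x -> submodule_subgroup (c *: x) }.

Variable N : submodule.

Let scale (c : R) (q : quot N) : quot N := cls N (c *: rep q).

Let scaleE c x : scale c (cls N x) = cls N (c *: x).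
Proof.
apply/cls_eq; rewrite -scalerBr; apply: submodule_subproof; exact: rep_cls.
Qed.

Fact quot_scaleA c d q : scale c (scale d q) = scale (c * d) q.
Proof. by rewrite -(repK q) !scaleE scalerA. Qed.
Fact quot_scale1 : left_id 1 scale.
Proof. by move=> q; rewrite -(repK q) scaleE scale1r. Qed.
Fact quot_scaleDr : right_distributive scale +%R.
Proof.
move=> c q r; rewrite -(repK q) -(repK r) -raddfD !scaleE.
by rewrite scalerDr raddfD.
Qed.
Fact quot_scaleDl q : {morph scale^~ q : c d / c + d}.
Proof. by move=> c d; rewrite -(repK q) !scaleE scalerDl raddfD. Qed.

HB.instance Definition _ := GRing.Zmodule_isLmodule.Build R (quot N)
  quot_scaleA quot_scale1 quot_scaleDr quot_scaleDl.

Lemma clsZ (c : R) x : cls N (c *: x) = c *: cls N x.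
Proof. by rewrite -scaleE. Qed.

End QuotientModule.

Section QuotientRing.
Variable A : pzRingType.

(* two-sided ideals *)
Record ideal := Ideal {
  ideal_subgroup :> subgroup A;
  ideal_subproof :
    forall a x b, ideal_subgroup x -> ideal_subgroup (a * x * b) }.

Variable I : ideal.

Lemma idealMl a x : I x -> I (a * x).
Proof. by move=> /(ideal_subproof a 1); rewrite mulr1. Qed.
Lemma idealMr x b : I x -> I (x * b).
Proof. by move=> /(ideal_subproof 1 b); rewrite mul1r. Qed.

Let mul (q r : quot I) : quot I := cls I (rep q * rep r).

Let mulE x y : mul (cls I x) (cls I y) = cls I (x * y).
Proof.
apply/cls_eq; set x' := rep _; set y' := rep _.
have -> : x' * y' - x * y = (x' - x) * y' + x * (y' - y).
  by rewrite mulrBl mulrBr addrA subrK.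
by apply: subD; [apply: idealMr|apply: idealMl]; apply: rep_cls.
Qed.

Fact quot_mulA : associative mul.
Proof.
by move=> q r s; rewrite -(repK q) -(repK r) -(repK s) !mulE mulrA.
Qed.
Fact quot_mul1r : left_id (cls I 1) mul.
Proof. by move=> q; rewrite -(repK q) mulE mul1r. Qed.
Fact quot_mulr1 : right_id (cls I 1) mul.
Proof. by move=> q; rewrite -(repK q) mulE mulr1. Qed.
Fact quot_mulDl : left_distributive mul +%R.
Proof.
move=> q r s; rewrite -(repK q) -(repK r) -(repK s) -raddfD !mulE.
by rewrite mulrDl raddfD.
Qed.
Fact quot_mulDr : right_distributive mul +%R.
Proof.
move=> q r s; rewrite -(repK q) -(repK r) -(repK s) -raddfD !mulE.
by rewrite mulrDr raddfD.
Qed.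

HB.instance Definition _ := GRing.Zmodule_isPzRing.Build (quot I)
  quot_mulA quot_mul1r quot_mulr1 quot_mulDl quot_mulDr.

Fact cls_is_monoid_morphism : monoid_morphism (cls I).
Proof. by split=> // x y; rewrite -mulE. Qed.
HB.instance Definition _ :=
  GRing.isMonoidMorphism.Build A (quot I) (cls I) cls_is_monoid_morphism.

End QuotientRing.

Section InverseLimit.
Variable M : zmodType.

Record filtration := Filtration {
  filtration_fun :> nat -> subgroup M;
  filtration_subproof : forall n x, filtration_fun n.+1 x -> filtration_fun n x }.

Variable F : filtration.

(* the inverse limit of the M / F n *)
Record invlim : Type := InvLim {
  proj :> forall n, quot (F n);
  proj_compat : forall n, cls (F n) (rep (proj n.+1)) = proj n }.

HB.instance Definition _ := gen_eqMixin invlim.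
HB.instance Definition _ := gen_choiceMixin invlim.

Lemma invlim_eq (z w : invlim) : (forall n, z n = w n) -> z = w.
Proof.
case: z w => [z hz] [w hw] /= zw.
have {}zw : z = w by apply/functional_extensionality_dep.
by case: _ / zw hw => hw; congr InvLim; apply: Prop_irrelevance.
Qed.

Lemma compat_cls n (q : quot (F n.+1)) (r : quot (F n)) x :
  q = cls _ x -> r = cls _ x -> cls (F n) (rep q) = r.
Proof.
move=> -> ->; apply/cls_eq; apply: filtration_subproof; exact: rep_cls.
Qed.

Lemma invlim_rep (z : invlim) n :
  z n.+1 = cls _ (rep (z n.+1)) /\ z n = cls _ (rep (z n.+1)).
Proof. by rewrite repK proj_compat. Qed.

Fact invlim_zero_compat n : cls (F n) (rep (0 : quot (F n.+1))) = 0.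
Proof. by apply: (@compat_cls _ _ _ 0); rewrite raddf0. Qed.
Fact invlim_add_compat (z w : invlim) n :
  cls (F n) (rep (z n.+1 + w n.+1)) = z n + w n.
Proof.
apply: (@compat_cls _ _ _ (rep (z n.+1) + rep (w n.+1))); rewrite raddfD /=.
  by rewrite !repK.
by rewrite !proj_compat.
Qed.
Fact invlim_opp_compat (z : invlim) n : cls (F n) (rep (- z n.+1)) = - z n.
Proof.
apply: (@compat_cls _ _ _ (- rep (z n.+1))); rewrite raddfN /=.
  by rewrite !repK.
by rewrite !proj_compat.
Qed.

Let zero := InvLim invlim_zero_compat.
Let add z w := InvLim (invlim_add_compat z w).
Let opp z := InvLim (invlim_opp_compat z).

Fact invlim_addA : associative add.
Proof. by move=> x y z; apply: invlim_eq => n /=; rewrite addrA. Qed.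
Fact invlim_addC : commutative add.
Proof. by move=> x y; apply: invlim_eq => n /=; rewrite addrC. Qed.
Fact invlim_add0 : left_id zero add.
Proof. by move=> x; apply: invlim_eq => n /=; rewrite add0r. Qed.
Fact invlim_addN : left_inverse zero opp add.
Proof. by move=> x; apply: invlim_eq => n /=; rewrite addNr. Qed.

HB.instance Definition _ := GRing.isZmodule.Build invlim
  invlim_addA invlim_addC invlim_add0 invlim_addN.

Lemma projB (z w : invlim) n : (z - w) n = z n - w n. Proof. by []. Qed.
Lemma projN (z : invlim) n : (- z) n = - z n. Proof. by []. Qed.
Lemma projD (z w : invlim) n : (z + w) n = z n + w n. Proof. by []. Qed.

Fact to_invlim_compat x n : cls (F n) (rep (cls (F n.+1) x)) = cls (F n) x.
Proof. exact: compat_cls. Qed.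

Definition to_invlim (x : M) : invlim := InvLim (to_invlim_compat x).

Fact to_invlim_is_zmod_morphism : zmod_morphism to_invlim.
Proof. by move=> x y; apply: invlim_eq => n; rewrite projB /= raddfB. Qed.
HB.instance Definition _ :=
  GRing.isZmodMorphism.Build M invlim to_invlim to_invlim_is_zmod_morphism.

(* the kernels of the projections; they define the inverse limit topology *)
Fact proj_ker_subgroup n :
  (0 : invlim) n = 0 /\ forall z w : invlim, z n = 0 -> w n = 0 -> (z - w) n = 0.
Proof. by split=> // z w z0 w0; rewrite projB z0 w0 subrr. Qed.
Definition proj_ker (n : nat) : subgroup invlim :=
  Subgroup (proj_ker_subgroup n).

End InverseLimit.

Section InverseLimitModule.
Variables (R : pzRingType) (M : lmodType R).

Record filtration_mod := FiltrationMod {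
  filtration_mod_fun :> nat -> submodule M;
  filtration_mod_subproof :
    forall n x, filtration_mod_fun n.+1 x -> filtration_mod_fun n x }.

Coercion filtration_of_mod (F : filtration_mod) : filtration M :=
  Filtration (filtration_mod_subproof (f := F)).

Variable F : filtration_mod.

Fact invlim_scale_compat (c : R) (z : invlim F) n :
  cls (F n) (rep (c *: z n.+1)) = c *: z n.
Proof.
apply: (@compat_cls _ F _ _ _ (c *: rep (z n.+1))) => /=.
  by rewrite clsZ repK.
by rewrite clsZ (proj_compat z).
Qed.

Let scale (c : R) (z : invlim F) : invlim F :=
  @InvLim _ F (fun n => c *: (z n : quot (F n))) (invlim_scale_compat c z).

Fact invlim_scaleA c d z : scale c (scale d z) = scale (c * d) z.
Proof. by apply: invlim_eq => n /=; rewrite scalerA. Qed.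
Fact invlim_scale1 : left_id 1 scale.
Proof. by move=> z; apply: invlim_eq => n /=; rewrite scale1r. Qed.
Fact invlim_scaleDr : right_distributive scale +%R.
Proof. by move=> c z w; apply: invlim_eq => n /=; rewrite scalerDr. Qed.
Fact invlim_scaleDl z : {morph scale^~ z : c d / c + d}.
Proof. by move=> c d; apply: invlim_eq => n /=; rewrite scalerDl. Qed.

HB.instance Definition _ := GRing.Zmodule_isLmodule.Build R (invlim F)
  invlim_scaleA invlim_scale1 invlim_scaleDr invlim_scaleDl.

Lemma projZ (c : R) (z : invlim F) n : (c *: z) n = c *: (z n : quot (F n)).
Proof. by []. Qed.

End InverseLimitModule.

Section InverseLimitRing.
Variable A : pzRingType.

Record filtration_ring := FiltrationRing {
  filtration_ring_fun :> nat -> ideal A;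
  filtration_ring_subproof :
    forall n x, filtration_ring_fun n.+1 x -> filtration_ring_fun n x }.

Coercion filtration_of_ring (F : filtration_ring) : filtration A :=
  Filtration (filtration_ring_subproof (f := F)).

Variable F : filtration_ring.

Fact invlim_one_compat n : cls (F n) (rep (1 : quot (F n.+1))) = 1.
Proof. by apply: (@compat_cls _ F _ _ _ 1); rewrite rmorph1. Qed.
Fact invlim_mul_compat (z w : invlim F) n :
  cls (F n) (rep ((z n.+1 : quot (F n.+1)) * w n.+1)) = (z n : quot (F n)) * w n.
Proof.
apply: (@compat_cls _ F _ _ _ (rep (z n.+1) * rep (w n.+1))); rewrite rmorphM /=.
  by rewrite !repK.
by rewrite (proj_compat z) (proj_compat w).
Qed.

Let one : invlim F :=
  @InvLim _ F (fun n => 1 : quot (F n)) invlim_one_compat.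
Let mul (z w : invlim F) : invlim F :=
  @InvLim _ F (fun n => (z n : quot (F n)) * w n) (invlim_mul_compat z w).

Fact invlim_mulA : associative mul.
Proof. by move=> x y z; apply: invlim_eq => n /=; rewrite mulrA. Qed.
Fact invlim_mul1r : left_id one mul.
Proof. by move=> x; apply: invlim_eq => n /=; rewrite mul1r. Qed.
Fact invlim_mulr1 : right_id one mul.
Proof. by move=> x; apply: invlim_eq => n /=; rewrite mulr1. Qed.
Fact invlim_mulDl : left_distributive mul +%R.
Proof. by move=> x y z; apply: invlim_eq => n /=; rewrite mulrDl. Qed.
Fact invlim_mulDr : right_distributive mul +%R.
Proof. by move=> x y z; apply: invlim_eq => n /=; rewrite mulrDr. Qed.

HB.instance Definition _ := GRing.Zmodule_isPzRing.Build (invlim F)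
  invlim_mulA invlim_mul1r invlim_mulr1 invlim_mulDl invlim_mulDr.

Lemma proj1E n : (1 : invlim F) n = (1 : quot (F n)). Proof. by []. Qed.
Lemma projM (z w : invlim F) n : (z * w) n = (z n : quot (F n)) * w n.
Proof. by []. Qed.

End InverseLimitRing.

Section Tensor.
Variables (R : comNzRingType) (M N : lmodType R).

(* A list [:: (x1, y1); ...; (xn, yn)] stands for the sum of the xi (x) yi;
   [tensor_eq] is the congruence generated by the bilinearity relations. *)
Inductive tensor_eq : seq (M * N) -> seq (M * N) -> Prop :=
| tensor_refl s : tensor_eq s s
| tensor_sym s t : tensor_eq s t -> tensor_eq t s
| tensor_trans t s u : tensor_eq s t -> tensor_eq t u -> tensor_eq s u
| tensor_cat s s' t t' :
    tensor_eq s s' -> tensor_eq t t' -> tensor_eq (s ++ t) (s' ++ t')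
| tensor_catC s t : tensor_eq (s ++ t) (t ++ s)
| tensor_0l y : tensor_eq [:: (0, y)] [::]
| tensor_Dl x x' y : tensor_eq [:: (x + x', y)] [:: (x, y); (x', y)]
| tensor_Dr x y y' : tensor_eq [:: (x, y + y')] [:: (x, y); (x, y')]
| tensor_Z (c : R) x y : tensor_eq [:: (c *: x, y)] [:: (x, c *: y)].

Let teq s t : bool := `[< tensor_eq s t >].

Fact tensor_equiv : equiv_class_of teq.
Proof.
split=> [s|s t|t s u]; rewrite /teq.
- by apply/asboolP/tensor_refl.
- by apply/idP/idP => /asboolP /tensor_sym /asboolP.
- by move=> /asboolP st /asboolP tu; apply/asboolP/(tensor_trans st tu).
Qed.

Canonical tensor_equivRel := EquivRelPack tensor_equiv.

Definition tensor : Type := {eq_quot tensor_equivRel}.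
HB.instance Definition _ := Choice.on tensor.

Definition tcls (s : seq (M * N)) : tensor := \pi_({eq_quot tensor_equivRel}) s.
Definition trep (t : tensor) : seq (M * N) :=
  repr (t : {eq_quot tensor_equivRel}).
Definition pure x y : tensor := tcls [:: (x, y)].

Lemma trepK t : tcls (trep t) = t. Proof. exact: reprK. Qed.
Lemma tcls_eq s t : tcls s = tcls t <-> tensor_eq s t.
Proof. by split=> [/eqmodP/asboolP //|st]; apply/eqmodP/asboolP. Qed.
Lemma trep_tcls s : tensor_eq (trep (tcls s)) s.
Proof. by apply/tcls_eq; rewrite trepK. Qed.

Lemma tensor_eq_map (g : M -> M) s t :
  {morph g : x y / x + y} -> (forall c : R, {morph g : x / c *: x}) ->
  tensor_eq s t ->
  tensor_eq [seq (g p.1, p.2) | p <- s] [seq (g p.1, p.2) | p <- t].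
Proof.
move=> gD gZ; elim=> {s t} /=.
- by move=> s; apply: tensor_refl.
- by move=> s t _; apply: tensor_sym.
- by move=> t s u _ + _; apply: tensor_trans.
- by move=> s s' t t' _ hs _ ht; rewrite !map_cat; apply: tensor_cat.
- by move=> s t; rewrite !map_cat; apply: tensor_catC.
- by move=> y; rewrite -(scale0r 0) gZ scale0r; apply: tensor_0l.
- by move=> x x' y; rewrite gD; apply: tensor_Dl.
- by move=> x y y'; apply: tensor_Dr.
- by move=> c x y; rewrite gZ; apply: tensor_Z.
Qed.

Let add t u := tcls (trep t ++ trep u).
Let map g t := tcls [seq (g p.1, p.2) | p <- trep t].

Let addE s t : add (tcls s) (tcls t) = tcls (s ++ t).
Proof. by apply/tcls_eq; apply: tensor_cat; apply: trep_tcls. Qed.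
Let mapE g s : {morph g : x y / x + y} -> (forall c : R, {morph g : x / c *: x}) ->
  map g (tcls s) = tcls [seq (g p.1, p.2) | p <- s].
Proof.
by move=> gD gZ; apply/tcls_eq; apply: tensor_eq_map => //; apply: trep_tcls.
Qed.

Let optD : {morph -%R : x y / x + y : M}. Proof. by move=> x y; rewrite opprD. Qed.
Let optZ (c : R) : {morph -%R : x / c *: x : M}.
Proof. by move=> x; rewrite scalerN. Qed.
Let scaD (c : R) : {morph ( *:%R c) : x y / x + y : M}.
Proof. by move=> x y; rewrite scalerDr. Qed.
Let scaZ (c d : R) : {morph ( *:%R c) : x / d *: x : M}.
Proof. by move=> x; rewrite !scalerA mulrC. Qed.

Fact tensor_addA : associative add.
Proof.
by move=> t u v; rewrite -(trepK t) -(trepK u) -(trepK v) !addE catA.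
Qed.
Fact tensor_addC : commutative add.
Proof.
move=> t u; rewrite -(trepK t) -(trepK u) !addE.
by apply/tcls_eq/tensor_catC.
Qed.
Fact tensor_add0 : left_id (tcls [::]) add.
Proof. by move=> t; rewrite -(trepK t) addE. Qed.
Fact tensor_addN : left_inverse (tcls [::]) (map -%R) add.
Proof.
move=> t; rewrite -(trepK t) mapE // addE; apply/tcls_eq.
elim: (trep t) => [|[x y] s IHs]; first exact: tensor_refl.
set m := [seq (- p.1, p.2) | p <- s] in IHs *.
apply: (@tensor_trans ([:: (- x, y); (x, y)] ++ (m ++ s))).
  change (tensor_eq ([:: (- x, y)] ++ (m ++ ([:: (x, y)] ++ s)))
    ([:: (- x, y)] ++ ([:: (x, y)] ++ (m ++ s)))).
  apply: tensor_cat; first exact: tensor_refl.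
  by rewrite !catA; apply: tensor_cat; [exact: tensor_catC|exact: tensor_refl].
rewrite -[[::]]/([::] ++ [::]); apply: tensor_cat => //.
apply: tensor_trans (tensor_0l y); apply: tensor_sym.
by rewrite -[X in (X, y)](addNr x); apply: tensor_Dl.
Qed.

HB.instance Definition _ := GRing.isZmodule.Build tensor
  tensor_addA tensor_addC tensor_add0 tensor_addN.

Lemma tcls_cat s t : tcls (s ++ t) = tcls s + tcls t.
Proof. by rewrite -addE. Qed.

Lemma tclsE s : tcls s = \sum_(p <- s) pure p.1 p.2.
Proof.
elim: s => [|[x y] s IHs]; first by rewrite big_nil.
by rewrite big_cons -IHs -cat1s tcls_cat.
Qed.

Let scale (c : R) t := map ( *:%R c) t.

Fact tensor_scaleA c d t : scale c (scale d t) = scale (c * d) t.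
Proof.
rewrite -(trepK t) /scale !mapE //; congr tcls; rewrite -map_comp.
by apply: eq_map => p /=; rewrite scalerA.
Qed.
Fact tensor_scale1 : left_id 1 scale.
Proof.
move=> t; rewrite -[in RHS](trepK t); congr tcls.
by rewrite -[RHS]map_id; apply: eq_map => -[x y] /=; rewrite scale1r.
Qed.
Fact tensor_scaleDr : right_distributive scale +%R.
Proof.
move=> c t u; rewrite -(trepK t) -(trepK u) -tcls_cat /scale !mapE //.
by rewrite map_cat tcls_cat.
Qed.
Fact tensor_scaleDl t : {morph scale^~ t : c d / c + d}.
Proof.
move=> c d; rewrite -(trepK t) /scale !mapE // !tclsE !big_map -big_split /=.
apply: eq_bigr => -[x y] _; rewrite /= scalerDl -tcls_cat.
by apply/tcls_eq/tensor_Dl.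
Qed.

HB.instance Definition _ := GRing.Zmodule_isLmodule.Build R tensor
  tensor_scaleA tensor_scale1 tensor_scaleDr tensor_scaleDl.

Lemma pureDl x x' y : pure (x + x') y = pure x y + pure x' y.
Proof. by rewrite -tcls_cat; apply/tcls_eq/tensor_Dl. Qed.
Lemma pureDr x y y' : pure x (y + y') = pure x y + pure x y'.
Proof. by rewrite -tcls_cat; apply/tcls_eq/tensor_Dr. Qed.
Lemma pureZl (c : R) x y : pure (c *: x) y = c *: pure x y.
Proof. by rewrite [RHS]mapE. Qed.
Lemma pureZr (c : R) x y : pure x (c *: y) = c *: pure x y.
Proof. by rewrite -pureZl; apply/tcls_eq/tensor_sym/tensor_Z. Qed.

Lemma tensorE t : t = \sum_(p <- trep t) pure p.1 p.2.
Proof. by rewrite -tclsE trepK. Qed.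

Lemma tensor_ind (P : tensor -> Prop) :
  (forall x y, P (pure x y)) -> P 0 -> (forall t u, P t -> P u -> P (t + u)) ->
  forall t, P t.
Proof.
move=> Pp P0 PD t; rewrite [t]tensorE.
by apply: (big_ind P) => // p _; apply: Pp.
Qed.

(* the additive map induced by a balanced biadditive map *)
Definition balanced (P : zmodType) (f : M -> N -> P) : Prop :=
  [/\ forall y, {morph f^~ y : x x' / x + x'},
      forall x, {morph f x : y y' / y + y'} &
      forall (c : R) x y, f (c *: x) y = f x (c *: y)].

Definition tlift (P : zmodType) (f : M -> N -> P) (t : tensor) : P :=
  \sum_(p <- trep t) f p.1 p.2.

Section Lift.
Variables (P : zmodType) (f : M -> N -> P).
Hypothesis bf : balanced f.

Lemma tlift_tcls s : tlift f (tcls s) = \sum_(p <- s) f p.1 p.2.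
Proof.
case: bf => fDl fDr fZ; rewrite /tlift.
move: (trep _) (trep_tcls s) => s' ss'.
elim: ss' => {s s'} //= [t s u _ IH1 _ IH2|s s' t t' _ IHs _ IHt|s t|y|x x' y|x y y'|c x y].
- by rewrite IH1.
- by rewrite !big_cat /= IHs IHt.
- by rewrite !big_cat /= addrC.
- rewrite big_seq1 big_nil /=; apply: (addIr (f 0 y)).
  by rewrite -fDl add0r add0r.
- by rewrite !big_cons big_nil /= !addr0 fDl.
- by rewrite !big_cons big_nil /= !addr0 fDr.
- by rewrite !big_seq1 /= fZ.
Qed.

Lemma tlift_pure x y : tlift f (pure x y) = f x y.
Proof. by rewrite tlift_tcls big_seq1. Qed.

Lemma tlift0 : tlift f 0 = 0.
Proof. by rewrite tlift_tcls big_nil. Qed.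

Lemma tliftD t u : tlift f (t + u) = tlift f t + tlift f u.
Proof.
by rewrite -(trepK t) -(trepK u) -tcls_cat !tlift_tcls big_cat.
Qed.

Lemma tlift_zmod_morphism : zmod_morphism (tlift f).
Proof.
by move=> t u; apply: (addIr (tlift f u)); rewrite -tliftD !subrK.
Qed.

End Lift.

End Tensor.

Lemma tensor_lift_ext (R : comNzRingType) (M N : lmodType R) (P : zmodType)
    (f g : tensor M N -> P) :
  zmod_morphism f -> zmod_morphism g ->
  (forall x y, f (pure x y) = g (pure x y)) -> f =1 g.
Proof.
move=> fB gB fg.
have f0 : f 0 = 0 by have := fB 0 0; rewrite !subrr.
have g0 : g 0 = 0 by have := gB 0 0; rewrite !subrr.
apply: tensor_ind => // [|t u ft gu]; first by rewrite f0 g0.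
rewrite -(opprK u) fB gB ft; congr (_ - _).
by rewrite -[- u]sub0r fB gB f0 g0 gu.
Qed.

Section TensorMap.
Variables (R S : comNzRingType) (M N : lmodType R) (M' N' : lmodType S).

Definition tensor_map (f : M -> M') (g : N -> N') (t : tensor M N) :
  tensor M' N' := tlift (fun x y => pure (f x) (g y)) t.

(* [f] and [g] are allowed to be semilinear over [nu]. *)
Lemma tensor_map_balanced (nu : R -> S) (f : M -> M') (g : N -> N') :
  {morph f : x y / x + y} -> {morph g : x y / x + y} ->
  (forall c x, f (c *: x) = nu c *: f x) ->
  (forall c y, g (c *: y) = nu c *: g y) ->
  balanced (fun x y => pure (f x) (g y)).
Proof.
move=> fD gD fZ gZ; split=> [y x x'|x y y'|c x y].
- by rewrite fD pureDl.
- by rewrite gD pureDr.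
- by rewrite fZ gZ pureZl pureZr.
Qed.

End TensorMap.

Section TensorMapLinear.
Variables (R : comNzRingType) (M N M' N' : lmodType R).
Variables (f : {linear M -> M'}) (g : {linear N -> N'}).

Fact tensor_map_linear_balanced : balanced (fun x y => pure (f x) (g y)).
Proof.
apply: (@tensor_map_balanced R R M N M' N' id);
  by move=> *; rewrite ?raddfD ?linearZ.
Qed.

Fact tensor_map_is_linear : linear (tensor_map f g).
Proof.
have bfg := tensor_map_linear_balanced.
move=> c t u; rewrite /tensor_map tliftD //; congr (_ + _).
elim/tensor_ind: t => [x y||t t' IH IH'].
- by rewrite -pureZl !tlift_pure //= linearZ pureZl.
- by rewrite scaler0 tlift0 // scaler0.
- by rewrite scalerDr !tliftD // scalerDr IH IH'.
Qed.
HB.instance Definition _ := GRing.isLinear.Build R (tensor M N) (tensor M' N')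
  *:%R (tensor_map f g) tensor_map_is_linear.

Lemma tensor_map_pure x y : tensor_map f g (pure x y) = pure (f x) (g y).
Proof. by rewrite /tensor_map tlift_pure //; apply: tensor_map_linear_balanced. Qed.

End TensorMapLinear.

Section TensorMul.
Variable R : comNzRingType.

Record is_alg_mul (M : lmodType R) (mul : M -> M -> M) (one : M) : Prop := {
  alg_mulA : associative mul;
  alg_mul1 : left_id one mul;
  alg_1mul : right_id one mul;
  alg_mulDl : left_distributive mul +%R;
  alg_mulDr : right_distributive mul +%R;
  alg_mulZl : forall (c : R) x y, mul (c *: x) y = c *: mul x y;
  alg_mulZr : forall (c : R) x y, mul x (c *: y) = c *: mul x y }.

Variables (M N : lmodType R).
Variables (mulM : M -> M -> M) (oneM : M) (mulN : N -> N -> N) (oneN : N).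
Hypotheses (HM : is_alg_mul mulM oneM) (HN : is_alg_mul mulN oneN).

Definition tensor_mul (t u : tensor M N) : tensor M N :=
  tlift (fun x y => tlift (fun x' y' => pure (mulM x x') (mulN y y')) u) t.

Let inner x y : balanced (fun x' y' => pure (mulM x x') (mulN y y')).
Proof.
split=> [y' x' x''|x' y' y''|c x' y'].
- by rewrite (alg_mulDr HM) pureDl.
- by rewrite (alg_mulDr HN) pureDr.
- by rewrite (alg_mulZr HM) (alg_mulZr HN) pureZl pureZr.
Qed.

Let outer u :
  balanced (fun x y => tlift (fun x' y' => pure (mulM x x') (mulN y y')) u).
Proof.
split=> [y x x'|x y y'|c x y]; rewrite /tlift -?big_split; apply: eq_bigr => p _ /=.
- by rewrite (alg_mulDl HM) pureDl.
- by rewrite (alg_mulDl HN) pureDr.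
- by rewrite (alg_mulZl HM) (alg_mulZl HN) pureZl pureZr.
Qed.

Lemma tensor_mul_pure x y x' y' :
  tensor_mul (pure x y) (pure x' y') = pure (mulM x x') (mulN y y').
Proof. by rewrite /tensor_mul tlift_pure // tlift_pure. Qed.

Fact tensor_mulDl : left_distributive tensor_mul +%R.
Proof. by move=> t u v; rewrite /tensor_mul tliftD. Qed.
Fact tensor_mulDr : right_distributive tensor_mul +%R.
Proof.
move=> t u v; rewrite /tensor_mul /tlift -big_split; apply: eq_bigr => p _.
exact: (tliftD (inner _ _)).
Qed.
Lemma tensor_mul0t t : tensor_mul 0 t = 0.
Proof. by rewrite /tensor_mul tlift0. Qed.
Lemma tensor_mult0 t : tensor_mul t 0 = 0.
Proof. by apply: (addIr (tensor_mul t 0)); rewrite -tensor_mulDr !add0r. Qed.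

Fact tensor_mulA : associative tensor_mul.
Proof.
elim/tensor_ind => [x y||t t' IH IH'] u v; last 2 first.
- by rewrite !tensor_mul0t.
- by rewrite !tensor_mulDl IH IH'.
elim/tensor_ind: u => [x' y'||t t' IH IH']; last 2 first.
- by rewrite tensor_mul0t tensor_mult0 tensor_mul0t.
- by rewrite tensor_mulDl !tensor_mulDr tensor_mulDl IH IH'.
elim/tensor_ind: v => [x'' y''||t t' IH IH']; last 2 first.
- by rewrite !tensor_mult0.
- by rewrite !tensor_mulDr IH IH'.
by rewrite !tensor_mul_pure (alg_mulA HM) (alg_mulA HN).
Qed.
Fact tensor_mul1 : left_id (pure oneM oneN) tensor_mul.
Proof.
elim/tensor_ind => [x y||t t' IH IH']; first by rewrite tensor_mul_pure (alg_mul1 HM) (alg_mul1 HN).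
  exact: tensor_mult0.
by rewrite tensor_mulDr IH IH'.
Qed.
Fact tensor_1mul : right_id (pure oneM oneN) tensor_mul.
Proof.
elim/tensor_ind => [x y||t t' IH IH']; first by rewrite tensor_mul_pure (alg_1mul HM) (alg_1mul HN).
  exact: tensor_mul0t.
by rewrite tensor_mulDl IH IH'.
Qed.
Fact tensor_mulZl c t u : tensor_mul (c *: t) u = c *: tensor_mul t u.
Proof.
elim/tensor_ind: t => [x y||t t' IH IH']; last 2 first.
- by rewrite scaler0 !tensor_mul0t scaler0.
- by rewrite scalerDr !tensor_mulDl scalerDr IH IH'.
elim/tensor_ind: u => [x' y'||t t' IH IH']; last 2 first.
- by rewrite !tensor_mult0 scaler0.
- by rewrite !tensor_mulDr scalerDr IH IH'.
by rewrite -pureZl !tensor_mul_pure (alg_mulZl HM) pureZl.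
Qed.
Fact tensor_mulZr c t u : tensor_mul t (c *: u) = c *: tensor_mul t u.
Proof.
elim/tensor_ind: t => [x y||t t' IH IH']; last 2 first.
- by rewrite !tensor_mul0t scaler0.
- by rewrite !tensor_mulDl scalerDr IH IH'.
elim/tensor_ind: u => [x' y'||t t' IH IH']; last 2 first.
- by rewrite scaler0 !tensor_mult0 scaler0.
- by rewrite scalerDr !tensor_mulDr scalerDr IH IH'.
by rewrite -pureZl !tensor_mul_pure (alg_mulZr HM) pureZl.
Qed.

End TensorMul.

Section TensorAlgebra.
Variable R : comNzRingType.

Lemma algType_is_alg_mul (A : algType R) : is_alg_mul ( *%R : A -> A -> A) 1.
Proof.
split; [exact: mulrA|exact: mul1r|exact: mulr1|exact: mulrDl|exact: mulrDr| |].
- by move=> c x y; rewrite scalerAl.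
- by move=> c x y; rewrite scalerAr.
Qed.

Variables A B : algType R.
Let HA := algType_is_alg_mul A.
Let HB := algType_is_alg_mul B.

HB.instance Definition _ := GRing.Zmodule_isPzRing.Build (tensor A B)
  (tensor_mulA HA HB) (tensor_mul1 HA HB) (tensor_1mul HA HB)
  (tensor_mulDl HA HB) (tensor_mulDr HA HB).

Lemma pureM (x x' : A) (y y' : B) :
  pure x y * pure x' y' = pure (x * x') (y * y').
Proof. exact: (tensor_mul_pure HA HB). Qed.

Lemma tensor_scalerAl (c : R) (t u : tensor A B) : c *: (t * u) = (c *: t) * u.
Proof. by rewrite [RHS](tensor_mulZl HA HB). Qed.
Lemma tensor_scalerAr (c : R) (t u : tensor A B) : c *: (t * u) = t * (c *: u).
Proof. by rewrite [RHS](tensor_mulZr HA HB). Qed.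

End TensorAlgebra.

Section LinearLimit.
Variables (M M' : zmodType) (F : filtration M) (F' : filtration M').
Variable f : {additive M -> M'}.
Hypothesis fF : forall n x, F n x -> F' n (f x).

Lemma cls_rep_morph n x : cls (F' n) (f (rep (cls (F n) x))) = cls (F' n) (f x).
Proof. by apply/cls_eq; rewrite -raddfB; apply: fF; apply: rep_cls. Qed.

Fact invlim_map_compat (z : invlim F) n :
  cls (F' n) (rep (cls (F' n.+1) (f (rep (z n.+1))))) = cls (F' n) (f (rep (z n))).
Proof.
rewrite to_invlim_compat -[in RHS](proj_compat z n).
by rewrite cls_rep_morph.
Qed.

Definition invlim_map (z : invlim F) : invlim F' :=
  InvLim (invlim_map_compat z).

Lemma invlim_mapE (z : invlim F) n x : z n = cls (F n) x -> invlim_map z n = cls (F' n) (f x).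
Proof. by move=> zx; rewrite /= zx cls_rep_morph. Qed.

Fact invlim_map_is_zmod_morphism : zmod_morphism invlim_map.
Proof.
move=> z w; apply: invlim_eq => n; rewrite projB.
have E : (z - w) n = cls (F n) (rep (z n) - rep (w n)).
  by rewrite projB raddfB /= !repK.
by rewrite (invlim_mapE E) !raddfB.
Qed.

End LinearLimit.

Section HAdic.
Variable K : fieldType.
Local Notation R := (fps K).

Section Module.
Variable M : lmodType R.

(* hbar^n M *)
Definition hpow (n : nat) (x : M) : Prop := exists y, x = hbar ^+ n *: y.

Fact hpow_subgroup n :
  hpow n 0 /\ forall x y, hpow n x -> hpow n y -> hpow n (x - y).
Proof.
split=> [|_ _ [x ->] [y ->]]; first by exists 0; rewrite scaler0.
by exists (x - y); rewrite scalerBr.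
Qed.

Fact hpow_submodule n (c : R) x : hpow n x -> hpow n (c *: x).
Proof. by move=> [y ->]; exists (c *: y); rewrite !scalerA mulrC. Qed.

Definition hpow_mod (n : nat) : submodule M :=
  @Submodule R M (Subgroup (hpow_subgroup n)) (@hpow_submodule n).

Fact hpow_decr n x : hpow n.+1 x -> hpow n x.
Proof. by move=> [y ->]; exists (hbar *: y); rewrite scalerA exprSr. Qed.

Definition hadic : filtration_mod M := @FiltrationMod R M hpow_mod hpow_decr.

End Module.

Lemma hpow_linear (M M' : lmodType R) (f : {linear M -> M'}) n x :
  hpow n x -> hpow n (f x).
Proof. by move=> [y ->]; exists (f y); rewrite linearZ. Qed.

Fact hpow_ideal_alg (A : algType R) n (a x b : A) :
  hpow n x -> hpow n (a * x * b).
Proof.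
by move=> [y ->]; exists (a * y * b); rewrite -scalerAr -scalerAl.
Qed.

Definition hideal (A : algType R) (n : nat) : ideal A :=
  @Ideal A (hpow_mod A n) (@hpow_ideal_alg A n).

Fact hpow_ideal_tensor (A B : algType R) n (a x b : tensor A B) :
  hpow n x -> hpow n (a * x * b).
Proof.
move=> [y ->]; exists (a * y * b).
by rewrite -tensor_scalerAr -tensor_scalerAl.
Qed.

Definition hideal_tensor (A B : algType R) (n : nat) : ideal (tensor A B) :=
  @Ideal _ (hpow_mod (tensor A B) n) (@hpow_ideal_tensor A B n).

Definition hadic_tensor (A B : algType R) : filtration_ring (tensor A B) :=
  @FiltrationRing _ (hideal_tensor A B) (@hpow_decr (tensor A B)).

(* the hbar-adically completed tensor product *)
Definition ctensor (M N : lmodType R) : Type := invlim (hadic (tensor M N)).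

HB.instance Definition _ (M N : lmodType R) := GRing.Lmodule.copy
  (ctensor M N) (invlim (hadic (tensor M N))).
HB.instance Definition _ (A B : algType R) := GRing.PzRing.copy
  (ctensor A B) (invlim (hadic_tensor A B)).

Definition cpure (M N : lmodType R) (x : M) (y : N) : ctensor M N :=
  to_invlim (hadic (tensor M N)) (pure x y).

Lemma ctensor_projM (A B : algType R) (z w : ctensor A B) n t u :
  z n = cls (hpow_mod (tensor A B) n) t ->
  w n = cls (hpow_mod (tensor A B) n) u ->
  (z * w) n = cls (hpow_mod (tensor A B) n) (t * u).
Proof.
have H (z' w' : invlim (hadic_tensor A B)) :
    z' n = cls (hideal_tensor A B n) t -> w' n = cls (hideal_tensor A B n) u ->
    (z' * w') n = cls (hideal_tensor A B n) (t * u).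
  by move=> zt wu; rewrite rmorphM projM zt wu.
exact: H.
Qed.

Section CompletedMap.
Variables (M N M' N' : lmodType R).
Variables (f : {linear M -> M'}) (g : {linear N -> N'}).

Definition ctensor_map : ctensor M N -> ctensor M' N' :=
  invlim_map (F := hadic (tensor M N)) (F' := hadic (tensor M' N'))
    (f := tensor_map f g) (hpow_linear (tensor_map f g)).

Fact ctensor_map_is_linear : linear ctensor_map.
Proof.
move=> c z w; apply: invlim_eq => n.
set F := hadic (tensor M N).
have E : (c *: z + w) n = cls (F n) (c *: rep (z n) + rep (w n)).
  by rewrite raddfD /= (clsZ (hpow_mod (tensor M N) n)) !repK.
rewrite [LHS](invlim_mapE _ E) [X in cls _ X]tensor_map_is_linear raddfD /=.
by rewrite (clsZ (hpow_mod (tensor M' N') n)).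
Qed.
HB.instance Definition _ := GRing.isLinear.Build R (ctensor M N)
  (ctensor M' N') *:%R ctensor_map ctensor_map_is_linear.

Lemma ctensor_map_cpure x y : ctensor_map (cpure x y) = cpure (f x) (g y).
Proof.
apply: invlim_eq => n.
have E : cpure x y n = cls (hadic (tensor M N) n) (pure x y) by [].
by rewrite [LHS](invlim_mapE _ E) [X in cls _ X]tensor_map_pure.
Qed.

End CompletedMap.

End HAdic.

(* [Node P Q] is the tree with left descendant P and right descendant Q;
   trees with at least one leaf *)
Inductive ptree := Leaf | Node of ptree & ptree.

Fixpoint leaves (P : ptree) : nat :=
  if P is Node P' P'' then (leaves P' + leaves P'')%N else 1%N.

Section QuantumDual.
Variables (K : fieldType) (U : algType (fps K)).
Variable Delta : {lrmorphism U -> ctensor U U}.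
Variable eps : {lrmorphism U -> (fps K)^o}.

(* U^{(x) |P|}, bracketed according to P *)
Fixpoint tensor_power (P : ptree) : lmodType (fps K) :=
  if P is Node P' P'' then ctensor (tensor_power P') (tensor_power P'') else U.

Definition delta1 (x : U) : U := x - (eps x : fps K) *: 1.

Definition delta2 (x : U) : ctensor U U :=
  Delta x - cpure x 1 - cpure 1 x + (eps x : fps K) *: cpure 1 1.

Fact delta1_is_linear : linear delta1.
Proof.
move=> c x y; rewrite /delta1 linearP /= scalerDl opprD addrACA scalerBr.
by rewrite scalerA.
Qed.
HB.instance Definition _ :=
  GRing.isLinear.Build (fps K) U U *:%R delta1 delta1_is_linear.

Fact cpure_linearl (M N : lmodType (fps K)) (y : N) :
  linear (fun x : M => cpure x y).
Proof.
move=> c x x'; apply: invlim_eq => n /=.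
by rewrite pureDl pureZl raddfD /= (clsZ (hpow_mod (tensor M N) n)).
Qed.

Fact cpure_linearr (M N : lmodType (fps K)) (x : M) :
  linear (fun y : N => cpure x y).
Proof.
move=> c y y'; apply: invlim_eq => n /=.
by rewrite pureDr pureZr raddfD /= (clsZ (hpow_mod (tensor M N) n)).
Qed.

Fact delta2_is_linear : linear delta2.
Proof.
have shuffle (V : zmodType) (a a' b b' c c' d d' : V) :
    (a + a') - (b + b') - (c + c') + (d + d') =
    (a - b - c + d) + (a' - b' - c' + d').
  by rewrite !opprD (addrACA a) (addrACA (a - b)) (addrACA (a - b - c)).
move=> c x y; rewrite /delta2 !linearP /= cpure_linearl cpure_linearr.
rewrite scalerDl -scalerA shuffle; congr (_ + _).
by rewrite !(scalerDr, scalerN).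
Qed.
HB.instance Definition _ := GRing.isLinear.Build (fps K) U (ctensor U U)
  *:%R delta2 delta2_is_linear.

Fixpoint delta (P : ptree) : {linear U -> tensor_power P} :=
  match P return {linear U -> tensor_power P} with
  | Leaf => delta1
  | Node P' P'' => ctensor_map (delta P') (delta P'') \o delta2
  end.

(* The first conjunct (void) is the condition for the tree without leaves. *)
Definition quantum_dual : {pred U} := fun x =>
  `[< hpow 0 (eps x) /\ forall P : ptree, hpow (leaves P) (delta P x) >].

End QuantumDual.

Section Filtrations.

(* decreasing algebra filtrations *)
Record alg_filtration (A : pzRingType) := AlgFiltration {
  alg_filtration_fun :> nat -> subgroup A;
  alg_filtration0 : forall x, alg_filtration_fun 0%N x;
  alg_filtrationS : forall n x, alg_filtration_fun n.+1 x ->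
    alg_filtration_fun n x;
  alg_filtrationM : forall i j x y, alg_filtration_fun i x ->
    alg_filtration_fun j y -> alg_filtration_fun (i + j)%N (x * y) }.

Definition complete_filtration (A : zmodType) (F : nat -> subgroup A) : Prop :=
  (forall x, (forall n, F n x) -> x = 0) /\
  forall u : nat -> A,
    (forall n, exists N, forall p q, (N <= p)%N -> (N <= q)%N ->
       F n (u p - u q)) ->
    exists l, forall n, exists N, forall p, (N <= p)%N -> F n (u p - l).

(* continuity for the topologies defined by the filtrations *)
Definition filtered_continuous (A B : zmodType) (F : nat -> subgroup A)
    (G : nat -> subgroup B) (f : A -> B) : Prop :=
  forall x n, exists m, forall y, F m (y - x) -> G n (f y - f x).

Lemma alg_filtration_idealMl (A : pzRingType) (F : alg_filtration A) n a x :
  F n x -> F n (a * x).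
Proof. exact: (alg_filtrationM (alg_filtration0 F a)). Qed.
Lemma alg_filtration_idealMr (A : pzRingType) (F : alg_filtration A) n a x :
  F n x -> F n (x * a).
Proof.
by move=> Fx; rewrite -(addn0 n); apply: (alg_filtrationM Fx); apply: alg_filtration0.
Qed.

End Filtrations.

Section TensorFiltration.
Variables (R : comNzRingType) (M : lmodType R).

(* the sum over i + j = n of the images of F i (x) F j *)
Definition tensor_filt (F : nat -> subgroup M) (n : nat) (t : tensor M M) :
    Prop :=
  exists2 s, t = tcls s & forall x y, (x, y) \in s ->
    exists i j, [/\ (i + j)%N = n, F i x & F j y].

Variable F : nat -> subgroup M.

Lemma tensor_filt0 n : tensor_filt F n 0.
Proof. by exists [::]. Qed.
Lemma tensor_filtD n t u :
  tensor_filt F n t -> tensor_filt F n u -> tensor_filt F n (t + u).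
Proof.
move=> [s -> Fs] [s' -> Fs']; exists (s ++ s'); first by rewrite tcls_cat.
by move=> x y; rewrite mem_cat => /orP[/Fs|/Fs'].
Qed.
Lemma tensor_filt_pure i j x y :
  F i x -> F j y -> tensor_filt F (i + j) (pure x y).
Proof.
move=> Fx Fy; exists [:: (x, y)] => // x' y'; rewrite inE => /eqP[-> ->].
by exists i, j.
Qed.
Lemma tensor_filt_ind (P : tensor M M -> Prop) n :
  P 0 -> (forall t u, P t -> P u -> P (t + u)) ->
  (forall i j x y, (i + j)%N = n -> F i x -> F j y -> P (pure x y)) ->
  forall t, tensor_filt F n t -> P t.
Proof.
move=> P0 PD Pp _ [s -> Fs]; rewrite tclsE big_seq.
apply: (big_ind P) => // -[x y] /Fs [i [j [ij Fx Fy]]]; exact: Pp ij Fx Fy.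
Qed.
Lemma tensor_filtN n t : tensor_filt F n t -> tensor_filt F n (- t).
Proof.
move: t; apply: (@tensor_filt_ind (fun t => tensor_filt F n (- t))) => [|t' u|i j x y <- Fx Fy].
- by rewrite oppr0; apply: tensor_filt0.
- by rewrite opprD; apply: tensor_filtD.
- by rewrite -scaleN1r -pureZl scaleN1r; apply: tensor_filt_pure => //; apply: subN.
Qed.

Fact tensor_filt_subgroup n : tensor_filt F n 0 /\
  forall t u, tensor_filt F n t -> tensor_filt F n u -> tensor_filt F n (t - u).
Proof.
split; first exact: tensor_filt0.
by move=> t u Ft /tensor_filtN; apply: tensor_filtD.
Qed.

Lemma tensor_filtZ n (c : R) t :
  (forall i x, F i x -> F i (c *: x)) ->
  tensor_filt F n t -> tensor_filt F n (c *: t).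
Proof.
move=> FZ; move: t.
apply: (@tensor_filt_ind (fun t => tensor_filt F n (c *: t))) => [|t' u|i j x y <- Fx Fy].
- by rewrite scaler0; apply: tensor_filt0.
- by rewrite scalerDr; apply: tensor_filtD.
- by rewrite -pureZl; apply: tensor_filt_pure => //; apply: FZ.
Qed.

Lemma tensor_filt_decr n t :
  (forall i x, F i.+1 x -> F i x) ->
  tensor_filt F n.+1 t -> tensor_filt F n t.
Proof.
move=> FS; move: t; apply: (@tensor_filt_ind (tensor_filt F n)) => [||[|i] [|j] x y //].
- exact: tensor_filt0.
- exact: tensor_filtD.
- by case=> <- Fx Fy; rewrite -(add0n j); apply: tensor_filt_pure => //; apply: FS.
- by case=> <- Fx Fy; rewrite addn0 -(addn0 i); apply: tensor_filt_pure => //; apply: FS.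
- by case=> <- Fx Fy; apply: tensor_filt_pure => //; apply: FS.
Qed.

Variables (mul : M -> M -> M) (one : M).
Hypothesis Hmul : is_alg_mul mul one.

Lemma tensor_filt_mull n t u :
  (forall i a x, F i x -> F i (mul a x)) ->
  tensor_filt F n u -> tensor_filt F n (tensor_mul mul mul t u).
Proof.
move=> FM; move: u.
apply: (@tensor_filt_ind (fun u => tensor_filt F n (tensor_mul mul mul t u))) => [|u' v Fu Fv|i j x y <- Fx Fy].
- by rewrite (tensor_mult0 Hmul Hmul); apply: tensor_filt0.
- by rewrite (tensor_mulDr Hmul Hmul); apply: tensor_filtD.
- elim/tensor_ind: t => [a b||t t' IH IH'].
  + by rewrite (tensor_mul_pure Hmul Hmul); apply: tensor_filt_pure; apply: FM.
  + by rewrite (tensor_mul0t Hmul Hmul); apply: tensor_filt0.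
  + by rewrite (tensor_mulDl Hmul Hmul); apply: tensor_filtD.
Qed.

Lemma tensor_filt_mulr n t u :
  (forall i a x, F i x -> F i (mul x a)) ->
  tensor_filt F n t -> tensor_filt F n (tensor_mul mul mul t u).
Proof.
move=> FM; move: t.
apply: (@tensor_filt_ind (fun t => tensor_filt F n (tensor_mul mul mul t u))) => [|u' v Fu Fv|i j x y <- Fx Fy].
- by rewrite (tensor_mul0t Hmul Hmul); apply: tensor_filt0.
- by rewrite (tensor_mulDl Hmul Hmul); apply: tensor_filtD.
- elim/tensor_ind: u => [a b||t' u' IH IH'].
  + by rewrite (tensor_mul_pure Hmul Hmul); apply: tensor_filt_pure; apply: FM.
  + by rewrite (tensor_mult0 Hmul Hmul); apply: tensor_filt0.
  + by rewrite (tensor_mulDr Hmul Hmul); apply: tensor_filtD.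
Qed.

End TensorFiltration.

Section CompletedBarTensor.
Variables (K : fieldType) (A : algType (fps K)) (F : alg_filtration A).

(* The sum over i + j = n of the images of F i (x) F j in A (x)^ A, where
   (x) is hbar-adically completed as well: this is the hbar-adic closure of
   the image of the algebraic sum [tensor_filt]. *)
Definition ctensor_filt (n : nat) (z : ctensor A A) : Prop :=
  forall k, exists2 t, tensor_filt F n t & z k = cls _ t.

Fact ctensor_filt_subgroup n : ctensor_filt n 0 /\
  forall z w, ctensor_filt n z -> ctensor_filt n w -> ctensor_filt n (z - w).
Proof.
split=> [k|z w Fz Fw k].
  by exists 0; [exact: tensor_filt0|rewrite raddf0].
have [t Ft zt] := Fz k; have [u Fu wu] := Fw k; exists (t - u).
  by apply: (tensor_filt_subgroup F n).2.
by rewrite projB zt wu raddfB.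
Qed.

Lemma alg_filtrationZ i (c : fps K) x : F i x -> F i (c *: x).
Proof.
by move=> Fx; rewrite -[x]mul1r scalerAl; apply: alg_filtration_idealMl.
Qed.

Fact ctensor_filt_submodule n (c : fps K) z :
  ctensor_filt n z -> ctensor_filt n (c *: z).
Proof.
move=> Fz k; have [t Ft zt] := Fz k; exists (c *: t).
  by apply: tensor_filtZ Ft => i x; apply: alg_filtrationZ.
by rewrite projZ zt (clsZ (hpow_mod (tensor A A) k)).
Qed.

Fact ctensor_filt_ideal n a z b :
  ctensor_filt n z -> ctensor_filt n (a * z * b).
Proof.
move=> Fz k; have [t Ft zt] := Fz k; exists (rep (a k) * t * rep (b k)).
  apply: (tensor_filt_mulr (algType_is_alg_mul A)) => [i c x|].
    exact: alg_filtration_idealMr.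
  apply: (tensor_filt_mull (algType_is_alg_mul A)) => // i c x.
  exact: alg_filtration_idealMl.
have ra := esym (repK (a k)); have rb := esym (repK (b k)).
exact: ctensor_projM (ctensor_projM ra zt) rb.
Qed.

Fact ctensor_filt_decr n z : ctensor_filt n.+1 z -> ctensor_filt n z.
Proof.
move=> Fz k; have [t Ft zt] := Fz k; exists t => //.
by apply: tensor_filt_decr Ft => i x; apply: alg_filtrationS.
Qed.

Definition ctensor_filt_sub n := Subgroup (ctensor_filt_subgroup n).

Definition ctensor_filt_mod : filtration_mod (ctensor A A) :=
  @FiltrationMod _ (ctensor A A)
    (fun n => @Submodule _ _ (ctensor_filt_sub n) (@ctensor_filt_submodule n))
    ctensor_filt_decr.

Definition ctensor_filt_ring : filtration_ring (ctensor A A) :=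
  @FiltrationRing (ctensor A A)
    (fun n => @Ideal _ (ctensor_filt_sub n) (@ctensor_filt_ideal n))
    ctensor_filt_decr.

Definition bar_ctensor : Type := invlim ctensor_filt_mod.

HB.instance Definition _ := GRing.Lmodule.copy bar_ctensor
  (invlim ctensor_filt_mod).
HB.instance Definition _ := GRing.PzRing.copy bar_ctensor
  (invlim ctensor_filt_ring).

End CompletedBarTensor.

Section Reduction.
Variables (K : fieldType) (A : algType (fps K)).

(* A / hbar A, as a ring and as a K-vector space *)
Definition red : Type := quot (hideal A 1).
HB.instance Definition _ := GRing.PzRing.copy red (quot (hideal A 1)).

Definition red_cls : A -> red := cls (hideal A 1).
HB.instance Definition _ := GRing.RMorphism.copy red_cls (cls (hideal A 1)).

Let scale (a : K) (q : red) : red := red_cls (fpsC a *: rep q).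

Lemma red_clsZ (c : fps K) x : red_cls (c *: x) = scale (c 0%N) (red_cls x).
Proof.
apply/cls_eq; have [d ->] := fps_split c; set e := fpsC _.
have -> : fpsC ((e + hbar * d) 0%N) = e.
  by rewrite fpsDE fpsME big_ord1 mul0r addr0.
have [y Ey] := rep_cls (hideal A 1) x.
exists (d *: x - e *: y); rewrite expr1 in Ey *.
rewrite -/(red_cls x) in Ey *.
have -> : rep (red_cls x) = x + hbar *: y by rewrite -Ey addrC subrK.
by rewrite scalerDl scalerDr opprD addrACA subrr add0r scalerBr !scalerA mulrC [e * _]mulrC.
Qed.

Lemma red_repK (q : red) : red_cls (rep q) = q.
Proof. exact: repK. Qed.

Let scaleE a x : scale a (red_cls x) = red_cls (fpsC a *: x).
Proof. by rewrite red_clsZ. Qed.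

Fact red_scaleA a b q : scale a (scale b q) = scale (a * b) q.
Proof. by rewrite -(red_repK q) !scaleE scalerA rmorphM. Qed.
Fact red_scale1 : left_id 1 scale.
Proof. by move=> q; rewrite -(red_repK q) scaleE rmorph1 scale1r. Qed.
Fact red_scaleDr : right_distributive scale +%R.
Proof.
move=> a q r; rewrite -(red_repK q) -(red_repK r) -raddfD !scaleE.
by rewrite scalerDr raddfD.
Qed.
Fact red_scaleDl q : {morph scale^~ q : a b / a + b}.
Proof.
move=> a b; rewrite -(red_repK q) !scaleE.
by rewrite raddfD scalerDl raddfD.
Qed.

HB.instance Definition _ := GRing.Zmodule_isLmodule.Build K red
  red_scaleA red_scale1 red_scaleDr red_scaleDl.

Fact red_cls_scalable (c : fps K) x : red_cls (c *: x) = c 0%N *: red_cls x.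
Proof. exact: red_clsZ. Qed.

Lemma red_fpsCZ (a : K) x : a *: red_cls x = red_cls (fpsC a *: x).
Proof. by rewrite red_cls_scalable. Qed.

Fact red_is_alg_mul : is_alg_mul ( *%R : red -> red -> red) 1.
Proof.
have ZM a (x y : A) :
    ((a : K) *: red_cls x) * red_cls y = a *: (red_cls x * red_cls y) /\
    red_cls x * (a *: red_cls y) = a *: (red_cls x * red_cls y).
  split; rewrite -[X in _ = _ *: X]rmorphM !red_fpsCZ -rmorphM.
    by rewrite -scalerAl.
  by rewrite -scalerAr.
split; [exact: mulrA|exact: mul1r|exact: mulr1|exact: mulrDl|exact: mulrDr| |].
- by move=> a q r; have [] := ZM a (rep q) (rep r); rewrite !red_repK.
- by move=> a q r; have [] := ZM a (rep q) (rep r); rewrite !red_repK.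
Qed.

(* (A / hbar A) (x)_K (A / hbar A) *)
Definition red_tensor : Type := tensor red red.
HB.instance Definition _ := GRing.Lmodule.copy red_tensor (tensor red red).
HB.instance Definition _ := GRing.Zmodule_isPzRing.Build red_tensor
  (tensor_mulA red_is_alg_mul red_is_alg_mul)
  (tensor_mul1 red_is_alg_mul red_is_alg_mul)
  (tensor_1mul red_is_alg_mul red_is_alg_mul)
  (tensor_mulDl red_is_alg_mul red_is_alg_mul)
  (tensor_mulDr red_is_alg_mul red_is_alg_mul).

Fact red_tensor_balanced : balanced (fun x y => pure (red_cls x) (red_cls y)).
Proof.
apply: (@tensor_map_balanced _ K A A red red (fun c => c 0%N)).
- by move=> x y; rewrite raddfD.
- by move=> x y; rewrite raddfD.
- by move=> c x; rewrite red_cls_scalable.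
- by move=> c x; rewrite red_cls_scalable.
Qed.

Definition tensor_red : tensor A A -> red_tensor := tensor_map red_cls red_cls.

Fact tensor_red_is_zmod_morphism : zmod_morphism tensor_red.
Proof. exact: tlift_zmod_morphism red_tensor_balanced. Qed.
HB.instance Definition _ := GRing.isZmodMorphism.Build (tensor A A) red_tensor
  tensor_red tensor_red_is_zmod_morphism.

Lemma tensor_red_pure x y : tensor_red (pure x y) = pure (red_cls x) (red_cls y).
Proof. exact: (tlift_pure red_tensor_balanced). Qed.

Lemma tensor_red_hbar t : hpow 1 t -> tensor_red t = 0.
Proof.
move=> [u ->]; rewrite expr1; elim/tensor_ind: u => [x y||u v IH IH'].
- rewrite -pureZl tensor_red_pure red_cls_scalable scale0r.
  by rewrite -(scale0r 0) pureZl scale0r.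
- by rewrite scaler0 raddf0.
- by rewrite scalerDr raddfD /= IH IH' addr0.
Qed.

(* the reduction modulo hbar A (x)^ A -> (A / hbar A) (x)_K (A / hbar A),
   through (A (x) A) / hbar *)
Definition ctensor_red (z : ctensor A A) : red_tensor := tensor_red (rep (z 1%N)).

Lemma ctensor_redE (z : ctensor A A) t :
  z 1%N = cls _ t -> ctensor_red z = tensor_red t.
Proof.
move=> zt; apply/eqP; rewrite -subr_eq0 -raddfB; apply/eqP/tensor_red_hbar.
by rewrite zt; exact: (rep_cls (hpow_mod (tensor A A) 1) t).
Qed.

Fact ctensor_red_is_zmod_morphism : zmod_morphism ctensor_red.
Proof.
move=> z w.
have E : (z - w) 1%N = cls (hadic (tensor A A) 1) (rep (z 1%N) - rep (w 1%N)).
  by rewrite projB raddfB /= !repK.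
by rewrite (ctensor_redE E) raddfB.
Qed.
HB.instance Definition _ := GRing.isZmodMorphism.Build (ctensor A A) red_tensor
  ctensor_red ctensor_red_is_zmod_morphism.

Section BarTensor.
Variable F : alg_filtration red.

Lemma red_alg_filtrationZ i (a : K) x : F i x -> F i (a *: x).
Proof.
move=> Fx; rewrite -[x]mul1r -(alg_mulZl red_is_alg_mul).
exact: alg_filtration_idealMl.
Qed.

Fact red_tensor_filt_ideal n (a t b : red_tensor) :
  tensor_filt F n t -> tensor_filt F n (a * t * b).
Proof.
move=> Ft; apply: (tensor_filt_mulr red_is_alg_mul) => [i c x|].
  exact: alg_filtration_idealMr.
apply: (tensor_filt_mull red_is_alg_mul) => // i c x.
exact: alg_filtration_idealMl.
Qed.

Fact red_tensor_filt_decr n (t : red_tensor) :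
  tensor_filt F n.+1 t -> tensor_filt F n t.
Proof. by apply: tensor_filt_decr => i x; apply: alg_filtrationS. Qed.

Definition red_tensor_filt : filtration_ring red_tensor :=
  @FiltrationRing red_tensor
    (fun n => @Ideal red_tensor (Subgroup (tensor_filt_subgroup F n))
                     (@red_tensor_filt_ideal n)) red_tensor_filt_decr.

Definition bar_red_tensor : Type := invlim red_tensor_filt.
HB.instance Definition _ := GRing.PzRing.copy bar_red_tensor
  (invlim red_tensor_filt).

End BarTensor.

Section ImageFiltration.
Variable F : alg_filtration A.

(* F n / (hbar A \cap F n), embedded in A / hbar A *)
Definition red_filt_set (n : nat) (q : red) : Prop :=
  exists2 x, F n x & q = red_cls x.

Fact red_filt_subgroup n : red_filt_set n 0 /\
  forall q r, red_filt_set n q -> red_filt_set n r -> red_filt_set n (q - r).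
Proof.
split; first by exists 0; [apply: sub0|rewrite raddf0].
move=> _ _ [x Fx ->] [y Fy ->]; exists (x - y); last by rewrite raddfB.
exact: subB.
Qed.

Fact red_filt0 q : red_filt_set 0%N q.
Proof. by exists (rep q); [apply: alg_filtration0|rewrite /red_cls repK]. Qed.
Fact red_filtS n q : red_filt_set n.+1 q -> red_filt_set n q.
Proof. by move=> [x Fx ->]; exists x => //; apply: alg_filtrationS. Qed.
Fact red_filtM i j q r :
  red_filt_set i q -> red_filt_set j r -> red_filt_set (i + j)%N (q * r).
Proof.
move=> [x Fx ->] [y Fy ->]; exists (x * y); last by rewrite rmorphM.
exact: alg_filtrationM.
Qed.

Definition red_filt : alg_filtration red :=
  @AlgFiltration red (fun n => Subgroup (red_filt_subgroup n))
    red_filt0 red_filtS red_filtM.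

Lemma ctensor_red_filt n z :
  ctensor_filt F n z -> tensor_filt red_filt n (ctensor_red z).
Proof.
move=> /(_ 1%N) [t Ft /ctensor_redE ->]; move: t Ft.
apply: (@tensor_filt_ind _ _ _
  (fun t => tensor_filt red_filt n (tensor_red t))) => [|t u Ft Fu|i j x y <- Fx Fy].
- by rewrite raddf0; apply: tensor_filt0.
- by rewrite raddfD; apply: tensor_filtD.
- by rewrite tensor_red_pure; apply: tensor_filt_pure; [exists x|exists y].
Qed.

(* the reduction modulo hbar of the bar-completed tensor square *)
Definition bar_ctensor_red : bar_ctensor F -> bar_red_tensor red_filt :=
  invlim_map (F := ctensor_filt_mod F) (F' := red_tensor_filt red_filt)
    (f := ctensor_red) ctensor_red_filt.

End ImageFiltration.

End Reduction.

Section Subalgebra.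
Variables (K : fieldType) (U : algType (fps K)) (S : {pred U}).
Hypothesis hS : GRing.subalg_closed S.

Definition subalg_pred of GRing.subalg_closed S : {pred U} := S.
HB.instance Definition _ :=
  GRing.isSubalgClosed.Build (fps K) U (subalg_pred hS) hS.

Definition subalg : Type := {x : U | x \in subalg_pred hS}.
HB.instance Definition _ := SubChoice.on subalg.
HB.instance Definition _ := [SubChoice_isSubAlgebra of subalg by <:].

(* the filtration by the S \cap hbar^n U *)
Definition subalg_filt_set (n : nat) (x : subalg) : Prop := hpow n (val x).

Fact subalg_filt_subgroup n : subalg_filt_set n 0 /\
  forall x y, subalg_filt_set n x -> subalg_filt_set n y ->
    subalg_filt_set n (x - y).
Proof.
split=> [|x y]; rewrite /subalg_filt_set ?raddf0 ?raddfB.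
  exact: (hpow_subgroup U n).1.
exact: (hpow_subgroup U n).2.
Qed.
Fact subalg_filt0 x : subalg_filt_set 0 x.
Proof. by exists (val x); rewrite expr0 scale1r. Qed.
Fact subalg_filtS n x : subalg_filt_set n.+1 x -> subalg_filt_set n x.
Proof. exact: hpow_decr. Qed.
Fact subalg_filtM i j x y : subalg_filt_set i x -> subalg_filt_set j y ->
  subalg_filt_set (i + j) (x * y).
Proof.
rewrite /subalg_filt_set rmorphM /= => -[x' ->] [y' ->]; exists (x' * y').
by rewrite -scalerAl -scalerAr scalerA exprD.
Qed.

Definition subalg_filt : alg_filtration subalg :=
  @AlgFiltration subalg (fun n => Subgroup (subalg_filt_subgroup n))
    subalg_filt0 subalg_filtS subalg_filtM.

Let iota : {linear subalg -> U} := \val.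

Lemma ctensor_val_filt n z :
  ctensor_filt subalg_filt n z -> (ctensor_map iota iota z) n = 0.
Proof.
move=> /(_ n) [t Ft zt].
rewrite [LHS](invlim_mapE _ zt); apply/cls0P; move: t Ft {zt}.
apply: (@tensor_filt_ind _ _ _ (fun t => hpow n (tensor_map iota iota t))) => [|t u Ft Fu|i j x y <- [x' Ex] [y' Ey]].
- by rewrite raddf0; apply: (hpow_subgroup (tensor U U) n).1.
- by rewrite raddfD; exact: (@subD _ (hpow_mod (tensor U U) n)).
- exists (pure x' y'); rewrite [LHS]tensor_map_pure /= Ex Ey pureZl pureZr.
  by rewrite scalerA exprD.
Qed.

Fact bar_ctensor_val_compat (z : bar_ctensor subalg_filt) n :
  cls (hadic (tensor U U) n)
    (rep ((ctensor_map iota iota (rep (z n.+1))) n.+1)) =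
  (ctensor_map iota iota (rep (z n))) n.
Proof.
transitivity ((ctensor_map iota iota (rep (z n.+1))) n).
  exact: (@proj_compat _ (hadic (tensor U U))).
have ker : (ctensor_map iota iota (rep (z n.+1) - rep (z n))) n = 0.
  apply: ctensor_val_filt.
  apply/(@cls_eq _ (ctensor_filt_mod subalg_filt n)); rewrite repK.
  exact: (@proj_compat _ (ctensor_filt_mod subalg_filt)).
apply: subr0_eq; rewrite -[RHS]ker.
by rewrite (zmod_morphism_linear (@ctensor_map_is_linear _ _ _ _ _ iota iota)).
Qed.

(* The natural map from the bar-completed tensor square of S to U (x)^ U: it
   exists since the n-th term of the filtration of S (x)^ S has its image in
   hbar^n (U (x)^ U). *)
Definition bar_ctensor_val (z : bar_ctensor subalg_filt) : ctensor U U :=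
  @InvLim _ (hadic (tensor U U))
    (fun n => (ctensor_map iota iota (rep (z n))) n)
    (bar_ctensor_val_compat z).

End Subalgebra.

Section LocalRing.
Variable A : pzRingType.

Definition maximal_ideal (I : ideal A) : Prop :=
  ~ I 1 /\
  forall J : ideal A, (forall x, I x -> J x) -> ~ J 1 -> forall x, J x -> I x.

Definition commutative_local_ring : Prop :=
  commutative ( *%R : A -> A -> A) /\
  exists I : ideal A, maximal_ideal I /\
    forall J : ideal A, maximal_ideal J -> forall x, J x <-> I x.

End LocalRing.

HB.mixin Record hasLieBracket (K : fieldType) g of GRing.Lmodule K g := {
  lie : g -> g -> g;
  lie_linearl : forall y, linear (lie^~ y);
  lie_linearr : forall x, linear (lie x);
  lie_xx : forall x, lie x x = 0;
  lie_jacobi : forall x y z,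
    lie x (lie y z) + lie y (lie z x) + lie z (lie x y) = 0 }.

#[short(type="lieAlgType")]
HB.structure Definition LieAlgebra (K : fieldType) :=
  {g of hasLieBracket K g & GRing.Lmodule K g}.

Definition lie_to_alg (K : fieldType) (g : lieAlgType K) (A : algType K)
    (f : g -> A) : Prop :=
  forall x y, f (lie x y) = f x * f y - f y * f x.

(* E, with i : g -> E, is the universal enveloping algebra of g. *)
Definition universal_enveloping (K : fieldType) (g : lieAlgType K)
    (E : algType K) (i : {linear g -> E}) : Prop :=
  lie_to_alg i /\
  forall (A : algType K) (f : {linear g -> A}), lie_to_alg f ->
    exists! h : E -> A,
      [/\ linear h, monoid_morphism h & forall x, h (i x) = f x].

(* (U, m, Delta) / hbar is isomorphic to (U(g), m0, Delta0). *)
Definition reduces_to_enveloping (K : fieldType) (U : algType (fps K))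
    (Delta : U -> ctensor U U) : Prop :=
  exists (g : lieAlgType K) (E : algType K) (i : {linear g -> E})
      (Delta0 : {lrmorphism E -> tensor E E}) (phi : {linear E -> red U}),
    [/\ universal_enveloping i,
        forall x, Delta0 (i x) = pure (i x) 1 + pure 1 (i x),
        monoid_morphism phi, bijective phi &
        forall (e : E) (x : U), phi e = red_cls x ->
          tensor_map phi phi (Delta0 e) = ctensor_red (Delta x)].

(* [eps] is a counit: K[[hbar]] (x)^ U and U (x)^ K[[hbar]] are identified
   with U by 1 (x) x <-> x and x (x) 1 <-> x. *)
Definition counital (K : fieldType) (U : algType (fps K))
    (Delta : U -> ctensor U U) (eps : {lrmorphism U -> (fps K)^o}) : Prop :=
  forall x, ctensor_map eps idfun (Delta x) = cpure (1 : (fps K)^o) x /\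
            ctensor_map idfun eps (Delta x) = cpure x (1 : (fps K)^o).

(* Main.v *)
(** Choose a basis of U/hbar adapted to the flag of the spaces (hbar^-k U' mod hbar); lifting it
    gives a topological basis sigma_a of U such that U' is the set of the
    convergent sums of c_a sigma_a with hbar^(d_a) dividing c_a, where
    hbar^(d_a) sigma_a lies in U'. In these coordinates U' (x) U' meets
    hbar^n (U (x) U) in the n-th term of the product filtration, and an element
    z of U (x)^ U such that (delta^P (x) delta^Q)(z) is divisible by
    hbar^(|P|+|Q|) for all P and Q lies, modulo each hbar^n, in the image of
    U' (x) U': slicing z by functionals gives elements of U' from which the
    divisibility of its coordinates is read off. This applies to Delta(x) for
    x in U'. Hence the stability of U' under products, and the inclusion
    [U', U'] in hbar U', follow by induction on P from
    delta^(P,Q)(xy) = (delta^P (x) delta^Q)(Delta(x) Delta(y)), and the lift of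
    Delta to U' exists and is unique. *)
Require Import Defs.
From HB Require Import structures.
From mathcomp Require Import all_boot all_algebra.
From mathcomp Require Import boolp classical_sets.

Set Implicit Arguments.
Unset Strict Implicit.
Unset Printing Implicit Defensive.

Import GRing.Theory.
Local Open Scope ring_scope.

(** * Bases adapted to a flag *)

(** Every [delta P] kills 1, so the correction terms of [delta2] disappear from [delta (Node P Q)];
    only then can the multiplicativity of [Delta] drive an induction on trees. The induction needs
    [Delta x] as a sum of tensors with both factors in U', while what is known is a divisibility
    under pairs of linear maps. Passing from such conditions to the tensor product of their solution
    sets is not formal: in general U' is not a direct summand of U, and U has infinite rank. In a
    basis where membership in U' is tested on each coordinate separately, the question becomes one
    about valuations. Finite sums exist only modulo hbar^m, which is enough because each condition
    defining U' is itself modulo a power of hbar. The counit acts as one more member of the family,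
    of weight 0: the maps [delta P] do not see scalars, so divisibility inside U' has to be tested
    on it too. The extra factor hbar of commutators originates at the leaf: elements of U' are
    scalars plus multiples of hbar, so their commutator is divisible by hbar^2. *)

Section LinearOf.
Variables (R : pzRingType) (M N : lmodType R) (f : M -> N).

(** The proof of linearity is an argument of the alias, so that a linear structure can be attached
    to a function built inside a proof. *)
Definition linear_of of linear f : M -> N := f.
HB.instance Definition _ (Hf : linear f) :=
  GRing.isLinear.Build R M N *:%R (linear_of Hf) Hf.

End LinearOf.

(* Sums over an infinite basis are taken along large enough duplicate-free
   lists: only finitely many terms matter modulo a power of hbar. *)
Definition for_large (I : eqType) (Q : seq I -> Prop) : Prop :=
  exists s0 : seq I, forall s, uniq s -> {subset s0 <= s} -> Q s.

Lemma for_large_and {I : eqType} {Q Q' : seq I -> Prop} :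
  for_large Q -> for_large Q' -> for_large (fun s => Q s /\ Q' s).
Proof.
move=> [s0 Qs] [s1 Qs']; exists (s0 ++ s1) => s us sub.
by split; [apply: Qs|apply: Qs'] => // a as0; apply: sub; rewrite mem_cat as0 ?orbT.
Qed.

Lemma for_large_imp {I : eqType} {Q Q' : seq I -> Prop} :
  (forall s, Q s -> Q' s) -> for_large Q -> for_large Q'.
Proof. by move=> QQ' [s0 Qs]; exists s0 => s us sub; apply/QQ'/Qs. Qed.

Lemma for_large_ex {I : eqType} {Q : seq I -> Prop} :
  for_large Q -> exists2 s, uniq s & Q s.
Proof.
move=> [s0 Qs]; exists (undup s0); first exact: undup_uniq.
by apply: Qs; [exact: undup_uniq|move=> a; rewrite mem_undup].
Qed.

Lemma big_uniq_sub (I : eqType) (V : nmodType) (s t : seq I) (F : I -> V) :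
  uniq s -> uniq t -> {subset s <= t} ->
  \sum_(a <- s) F a = \sum_(a <- t) (if a \in s then F a else 0).
Proof.
move=> us ut st; rewrite -big_mkcond -big_filter; apply: perm_big.
apply: uniq_perm; rewrite ?filter_uniq // => a; rewrite mem_filter.
by case as0: (a \in s) => //=; rewrite st.
Qed.

Section AdaptedBasis.
Variables (K : fieldType) (W : lmodType K) (G : nat -> W -> Prop).
Hypothesis G_lin : forall k (c : K) x y, G k x -> G k y -> G k (c *: x + y).
Hypothesis G_le : forall k l x, (k <= l)%N -> G k x -> G l x.
Hypothesis G_0 : forall x, G 0%N x <-> x = 0.

Let G0 k : G k 0. Proof. by apply: (@G_le 0) => //; apply/G_0. Qed.
Let GZ k c x : G k x -> G k (c *: x).
Proof. by move=> Gx; rewrite -[_ *: _]addr0; apply: G_lin. Qed.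
Let GB k x y : G k x -> G k y -> G k (x - y).
Proof. by move=> Gx Gy; rewrite addrC -scaleN1r; apply: G_lin. Qed.

(** At k = 0 this is linear independence, since [G 0] is the zero space. At higher k it says that
    the basis expansion of a vector of [G k] uses only basis vectors of [G k]. The vector 0 is
    excluded by hand, because it lies in every level. *)
Definition adapted_free (B : set W) : Prop :=
  ~ B 0 /\ forall (s : seq W) (c : W -> K), uniq s -> (forall a, a \in s -> B a) ->
    forall k, G k (\sum_(a <- s) c a *: a) ->
    forall a, a \in s -> c a != 0 -> G k a.

Definition in_span (B : set W) (w : W) : Prop :=
  exists (s : seq W) (c : W -> K),
    [/\ uniq s, forall a, a \in s -> B a & w = \sum_(a <- s) c a *: a].

(** Adapted freeness has finite character, so this is what Zorn's lemma requires. The empty list is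
    set apart because the chain may be empty. *)
Lemma chain_finite (F : set (set W)) (s : seq W) : total_on F subset ->
  (forall a, a \in s -> (\bigcup_(X in F) X)%classic a) ->
  s = [::] \/ exists2 X, F X & forall a, a \in s -> X a.
Proof.
move=> totF; elim: s => [|x s IHs] Fs; [by left|right].
have [X FX Xx] := Fs x (mem_head _ _).
case: IHs => [a as0|->|[Y FY sY]]; first by apply: Fs; rewrite inE as0 orbT.
  by exists X => // a; rewrite inE => /eqP->.
case: (totF _ _ FX FY) => XY; [exists Y|exists X] => // a; rewrite inE => /predU1P[->|] //.
- exact: XY.
- exact: sY.
- by move=> /sY; apply: XY.
Qed.

Lemma maximal_adapted_free :
  exists B, adapted_free B /\ forall B', (B `<` B')%classic -> ~ adapted_free B'.
Proof.
apply: Zorn_bigcup => F FP totF; split=> [[X FX X0]|s c us Fs k Gs a as0 ca].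
  by case: (FP _ FX).
have [s0|[X FX sX]] := chain_finite totF Fs; first by rewrite s0 in as0.
by case: (FP _ FX) => _ /(_ s c us sX k Gs a as0 ca).
Qed.

Lemma in_spanD (B : set W) (k : K) v w :
  in_span B v -> in_span B w -> in_span B (k *: v + w).
Proof.
move=> [s [c [us sB ->]]] [t [d [ut tB ->]]].
set r := undup (s ++ t); have ur : uniq r by apply: undup_uniq.
exists r, (fun a => k * (if a \in s then c a else 0) + (if a \in t then d a else 0)).
split=> //.
  by move=> a; rewrite mem_undup mem_cat => /orP[/sB|/tB].
rewrite (@big_uniq_sub _ _ s r) //; last by move=> a; rewrite mem_undup mem_cat => ->.
rewrite (@big_uniq_sub _ _ t r) //; last by move=> a; rewrite mem_undup mem_cat orbC => ->.
rewrite scaler_sumr -big_split /=; apply: eq_bigr => a _.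
rewrite scalerDl -scalerA; congr (_ *: _ + _); by case: ifP => // _; rewrite scale0r.
Qed.

Lemma in_span0 (B : set W) : in_span B 0.
Proof. by exists [::], (fun=> 0); rewrite big_nil. Qed.

Lemma in_span_mem (B : set W) w : B w -> in_span B w.
Proof.
move=> Bw; exists [:: w], (fun=> 1); split=> //.
  by move=> a; rewrite inE => /eqP->.
by rewrite big_seq1 scale1r.
Qed.

(* A vector of least level in [w + span B] can be added to [B]. *)
Lemma adapted_extension (B : set W) w : ~ in_span B w ->
  exists2 w', ~ in_span B w' & forall j u, in_span B u -> G j (w' + u) -> G j w'.
Proof.
move=> Bw; pose Q k : bool := `[< exists2 u, in_span B u & G k (w + u) >].
(* If the coset of w meets no level at all, w itself satisfies the requirement vacuously. *)
have [exQ|noQ] := pselect (exists k, Q k); last first.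
  by exists w => // j u Bu Gu; case: noQ; exists j; apply/asboolP; exists u.
have [k /asboolP[u Bu Gu] kmin] := ex_minnP exQ.
exists (w + u) => [Bwu|j v Bv Gv]; first last.
  apply: (G_le _ Gu); apply: kmin; apply/asboolP; exists (u + v); last by rewrite addrA.
  by rewrite -[u]scale1r; apply: in_spanD.
by apply: Bw; rewrite -(addrK u w) addrC -scaleN1r; apply: in_spanD.
Qed.

(** If w occurs in a combination of level k, dividing by its coefficient puts w plus an element of
    the span in level k; by minimality w is in level k, and the rest of the combination follows by
    subtraction. *)
Lemma adapted_free_setU1 (B : set W) w : adapted_free B -> ~ in_span B w ->
  (forall j u, in_span B u -> G j (w + u) -> G j w) ->
  adapted_free (fun a => B a \/ a = w).
Proof.
move=> [B0 Bfree] Bw wmin; split.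
  by case=> // w0; apply: Bw; rewrite -w0; apply: in_span0.
move=> s c us sB k Gs a as0 ca.
have [ws|ws] := boolP (w \in s); last first.
  apply: (Bfree s c us _ k Gs a as0 ca) => b bs.
  by case: (sB b bs) => // bw; rewrite -bw bs in ws.
have perm_s := perm_to_rem ws.
have srem b : b \in rem w s -> B b.
  rewrite mem_rem_uniq // !inE => /andP[bw /sB[//|/eqP]].
  by rewrite (negPf bw).
have urem : uniq (rem w s) by rewrite rem_uniq.
rewrite (perm_big _ perm_s) big_cons /= in Gs.
have Ga : G k (\sum_(b <- rem w s) c b *: b) -> a != w -> G k a.
  move=> Gr aw; apply: (Bfree (rem w s) c) => //.
  by rewrite mem_rem_uniq // !inE aw.
have [cw0|cw0] := eqVneq (c w) 0.
  have aw : a != w by apply: contraNneq ca => ->; rewrite cw0.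
  by apply: Ga => //; rewrite cw0 scale0r add0r in Gs.
have Gw : G k w.
  apply: (wmin k ((c w)^-1 *: \sum_(b <- rem w s) c b *: b)).
    rewrite -[_ *: _]addr0; apply: in_spanD; last exact: in_span0.
    by exists (rem w s), c.
  by move: (@GZ _ (c w)^-1 _ Gs); rewrite scalerDr scalerA mulVf // scale1r.
have [->//|] := eqVneq a w; apply: Ga.
by rewrite -[X in G _ X](addKr (c w *: w)) addrC; apply: GB => //; apply: GZ.
Qed.

Lemma adapted_basis : exists B, adapted_free B /\ forall w, in_span B w.
Proof.
have [B [Bfree Bmax]] := maximal_adapted_free; exists B; split=> // w.
apply: contrapT => Bw; have [w' Bw' wmin] := adapted_extension Bw.
apply: (Bmax _ _ (adapted_free_setU1 Bfree Bw' wmin)).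
split=> [|sub]; first by move=> a; left.
by apply/Bw'/in_span_mem/sub; right.
Qed.

(** The functionals are indexed by all vectors of W, those outside the chosen basis giving the zero
    functional; no subtype for the basis is then needed. *)
Lemma adapted_coordinates : exists beta : W -> {linear W -> K^o},
  (forall w, for_large (fun s => w = \sum_(a <- s) beta a w *: a /\
     forall a, a \notin s -> beta a w = 0)) /\
  (forall k w a, G k w -> beta a w != 0 -> G k a).
Proof.
have [B [[B0 Bfree] Bspan]] := adapted_basis.
have /choice[S HS] w : exists sc : seq W * (W -> K), [/\ uniq sc.1,
    forall a, a \in sc.1 -> B a & w = \sum_(a <- sc.1) sc.2 a *: a].
  by have [s [c H]] := Bspan w; exists (s, c).
pose b a w : K^o := if a \in (S w).1 then (S w).2 a else 0.
(* Uniqueness of coefficients is adapted freeness at level 0, applied to the difference d of two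
   expansions. It makes the chosen coefficients linear. *)
have bE w s (c : W -> K) a : uniq s -> (forall a, a \in s -> B a) ->
    w = \sum_(a <- s) c a *: a -> b a w = if a \in s then c a else 0.
  move=> us sB ws; apply: contrapT => /eqP ne.
  have [us' sB' ws'] := HS w; set s' := (S w).1 in us' sB' ws'.
  set r := undup (s' ++ s); have ur : uniq r by apply: undup_uniq.
  pose d a := b a w - (if a \in s then c a else 0).
  have Gd : G 0%N (\sum_(a <- r) d a *: a).
    apply/G_0/eqP; rewrite (eq_bigr (fun a =>
      (if a \in s' then (S w).2 a *: a else 0) - (if a \in s then c a *: a else 0))).
      rewrite sumrB -!big_uniq_sub // -?ws -?ws' ?subrr // => e.
        by rewrite mem_undup mem_cat => ->; rewrite orbT.
      by rewrite mem_undup mem_cat => ->.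
    move=> e _; rewrite /d /b -/s' scalerBl.
    by congr (_ - _); case: ifP => // _; rewrite scale0r.
  have rB e : e \in r -> B e by rewrite mem_undup mem_cat => /orP[/sB'|/sB].
  have ar : a \in r.
    rewrite mem_undup mem_cat; apply: contraNT ne; rewrite negb_or.
    by rewrite /b => /andP[/negPf -> /negPf ->].
  have da : d a != 0 by rewrite subr_eq0.
  have /G_0 a0 := Bfree r d ur rB 0%N Gd a ar da.
  by apply: B0; rewrite -a0; apply: rB.
have blin a : linear (b a).
  move=> k v w; have [us sB vs] := HS v; have [ut tB wt] := HS w.
  set s := (S v).1 in us sB vs *; set t := (S w).1 in ut tB wt *.
  set r := undup (s ++ t); have ur : uniq r by apply: undup_uniq.
  rewrite (bE _ r (fun a => k * b a v + b a w)) //.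
  - case: ifPn => //; rewrite mem_undup mem_cat negb_or /b -/s -/t => /andP[].
    by move=> /negPf -> /negPf ->; rewrite scaler0 addr0.
  - by move=> e; rewrite mem_undup mem_cat => /orP[/sB|/tB].
  rewrite {1}vs {1}wt (@big_uniq_sub _ _ s r) //; last first.
    by move=> e; rewrite mem_undup mem_cat => ->.
  rewrite (@big_uniq_sub _ _ t r) //; last first.
    by move=> e; rewrite mem_undup mem_cat => ->; rewrite orbT.
  rewrite scaler_sumr -big_split /=; apply: eq_bigr => e _.
  rewrite scalerDl -scalerA /b -/s -/t.
  by congr (_ *: _ + _); case: ifP => // _; rewrite scale0r.
exists (fun a => linear_of (blin a)); split=> /=.
  move=> w; have [us sB ws] := HS w; exists (S w).1 => s ust sub; split; last first.
    by move=> a /(contra (sub a)); rewrite /= /linear_of /b => /negPf ->.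
  rewrite {1}ws (@big_uniq_sub _ _ _ s) //; apply: eq_bigr => e _.
  by rewrite /= /linear_of /b; case: ifP => // _; rewrite [RHS]scale0r.
move=> k w a Gw; rewrite /= /linear_of /b; case: ifPn => [as0 ca|]; last by rewrite eqxx.
by have [us sB ws] := HS w; apply: (Bfree _ _ us sB) as0 ca; rewrite -ws.
Qed.

End AdaptedBasis.

(** * Torsion-free complete modules *)

Section FpsCoefficients.
Variables (K : fieldType) (V : lmodType K).
Implicit Types f g : fps V.

Lemma fps_sumE (I : Type) (r : seq I) (P : pred I) (F : I -> fps V) n :
  (\sum_(i <- r | P i) F i) n = \sum_(i <- r | P i) F i n.
Proof. exact: (big_morph (fun f : fps V => f n)). Qed.

Lemma fps_scaleE (c : fps K) f n : (c *: f) n = \sum_(i < n.+1) c i *: f (n - i)%N.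
Proof. by []. Qed.

Lemma hbar_scaleE f n : (hbar *: f) n = if n is m.+1 then f m else 0.
Proof.
rewrite fps_scaleE big_ord_recl /hbar scale0r add0r.
case: n => [|n]; first by rewrite big_ord0.
by rewrite big_ord_recl /= scale1r subSS subn0 big1 ?addr0 // => i _; rewrite scale0r.
Qed.

Lemma hbarX_scaleE m f n :
  (hbar ^+ m *: f) n = if (n < m)%N then 0 else f (n - m)%N.
Proof.
elim: m n => [|m IHm] n; first by rewrite expr0 scale1r subn0.
rewrite exprS -scalerA hbar_scaleE; by case: n => [|n].
Qed.

Lemma hpow_fpsP n f : hpow n f <-> forall k, (k < n)%N -> f k = 0.
Proof.
split=> [[g ->] k kn|f0]; first by rewrite hbarX_scaleE kn.
exists (fun k => f (k + n)%N); apply/funext => k; rewrite hbarX_scaleE.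
by case: ltnP => [/f0//|nk]; rewrite subnK.
Qed.

End FpsCoefficients.

Lemma hbar_mulE (K : fieldType) (f : fps K) n :
  (hbar * f) n = if n is m.+1 then f m else 0.
Proof. exact: (@hbar_scaleE K K^o). Qed.

Section HPow.
Variables (K : fieldType) (M : lmodType (fps K)).
Implicit Types x y : M.

Lemma hpow_0 n : hpow n (0 : M). Proof. exact: (hpow_subgroup M n).1. Qed.
Lemma hpowB n x y : hpow n x -> hpow n y -> hpow n (x - y).
Proof. exact: (hpow_subgroup M n).2. Qed.
Lemma hpowN n x : hpow n x -> hpow n (- x).
Proof. by rewrite -sub0r; apply: hpowB; apply: hpow_0. Qed.
Lemma hpowD n x y : hpow n x -> hpow n y -> hpow n (x + y).
Proof. by move=> hx /hpowN hy; rewrite -[y]opprK; apply: hpowB. Qed.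
Lemma hpowZ n (c : fps K) x : hpow n x -> hpow n (c *: x).
Proof. exact: hpow_submodule. Qed.
Lemma hpow_all x : hpow 0 x.
Proof. by exists x; rewrite expr0 scale1r. Qed.
Lemma hpow_sum n (I : Type) (r : seq I) (P : pred I) (F : I -> M) :
  (forall i, P i -> hpow n (F i)) -> hpow n (\sum_(i <- r | P i) F i).
Proof. by move=> HF; apply: (big_ind (@hpow K M n)) => //; [exact: hpow_0|exact: hpowD]. Qed.
Lemma hpow_le m n x : (m <= n)%N -> hpow n x -> hpow m x.
Proof.
move=> mn [y ->]; exists (hbar ^+ (n - m) *: y).
by rewrite scalerA -exprD subnKC.
Qed.
Lemma hpow_hbarX n x : hpow n (hbar ^+ n *: x).
Proof. by exists x. Qed.
Lemma hpow_mul m n x : hpow n x -> hpow (m + n) (hbar ^+ m *: x).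
Proof. by move=> [y ->]; exists y; rewrite scalerA exprD. Qed.
Lemma hpow_scale n (c : fps K) x : hpow n (c : (fps K)^o) -> hpow n (c *: x).
Proof. by move=> [d ->]; exists (d *: x); rewrite scalerA. Qed.
Lemma hpow_trans n y x z : hpow n (x - y) -> hpow n (y - z) -> hpow n (x - z).
Proof. by move=> xy yz; rewrite -(subrKA y); apply: hpowD. Qed.
Lemma hpow_sym n x y : hpow n (x - y) -> hpow n (y - x).
Proof. by move=> /hpowN; rewrite opprB. Qed.

(** An intrinsic form of topological freeness, easier to check for U' and for completed tensor
    products; [hregular_topologically_free] leads back. Completeness is stated for series in hbar,
    the form in which [hbar_cauchy] uses it after telescoping. *)
Record hregular : Prop := HRegular {
  hbar_tf : forall x, hbar *: x = 0 -> x = 0;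
  hbar_separated : forall x, (forall n, hpow n x) -> x = 0;
  hbar_complete : forall u : nat -> M,
    exists l, forall n, hpow n (l - \sum_(k < n) hbar ^+ k *: u k) }.

Hypothesis regM : hregular.

Lemma hbarX_tf n x : hbar ^+ n *: x = 0 -> x = 0.
Proof.
elim: n x => [|n IHn] x; first by rewrite expr0 scale1r.
by rewrite exprS -scalerA => /(hbar_tf regM)/IHn.
Qed.

Lemma hbarX_inj n x y : hbar ^+ n *: x = hbar ^+ n *: y -> x = y.
Proof.
by move=> /eqP; rewrite -subr_eq0 -scalerBr => /eqP/hbarX_tf/eqP; rewrite subr_eq0 => /eqP.
Qed.

Lemma hpow_div m n x : hpow (m + n) (hbar ^+ m *: x) -> hpow n x.
Proof. by move=> [y]; rewrite exprD -scalerA => /hbarX_inj ->; exists y. Qed.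

Lemma hbar_cauchy (u : nat -> M) : (forall n, hpow n (u n.+1 - u n)) ->
  exists l, forall n, hpow n (l - u n).
Proof.
move=> /choice[v Hv]; have [l Hl] := hbar_complete regM v.
exists (l + u 0%N) => n; have -> : u n = u 0%N + \sum_(k < n) hbar ^+ k *: v k.
  elim: n => [|n IHn]; first by rewrite big_ord0 addr0.
  by rewrite big_ord_recr /= addrA -IHn -Hv addrC subrK.
by rewrite opprD addrA addrK.
Qed.

End HPow.

Section HRegularFps.
Variables (K : fieldType).

Lemma hregular_fps (V : lmodType K) : hregular (fps V).
Proof.
split=> [f f0|f f0|u].
- apply/funext => n; move/(congr1 (fun g => g n.+1)): f0.
  by rewrite hbar_scaleE.
- by apply/funext => n; move/hpow_fpsP: (f0 n.+1); apply.
- exists (fun n => \sum_(k < n.+1) u k (n - k)%N) => n.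
  apply/hpow_fpsP => j jn; rewrite fpsDE fpsNE fps_sumE; apply/eqP; rewrite subr_eq0.
  rewrite (big_ord_widen_cond n xpredT (fun k => u k (j - k)%N)) // big_mkcond /=.
  by apply/eqP/eq_bigr => k _; rewrite hbarX_scaleE ltnS leqNgt; case: ltnP.
Qed.

Lemma hregular_iso (M N : lmodType (fps K)) (f : {linear M -> N}) :
  bijective f -> hregular N -> hregular M.
Proof.
move=> [g fK gK] [tf sep compl].
have fI : injective f by apply: can_inj fK.
have hf n x : hpow n (f x) -> hpow n x.
  by move=> [y fxy]; exists (g y); apply: fI; rewrite linearZ gK.
split=> [x x0|x x0|u].
- by apply: fI; rewrite linear0; apply: tf; rewrite -linearZ x0 linear0.
- by apply: fI; rewrite linear0; apply: sep => n; apply: hpow_linear.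
- have [l Hl] := compl (fun n => f (u n)); exists (g l) => n; apply: hf.
  rewrite linearB gK linear_sum; move: (Hl n).
  by under eq_bigr do rewrite -linearZ.
Qed.

Lemma topologically_free_hregular (M : lmodType (fps K)) :
  topologically_free M -> hregular M.
Proof. by move=> [V [f f_bij]]; apply: hregular_iso f_bij (hregular_fps V). Qed.

End HRegularFps.

(** * Expansion in powers of hbar *)

Section Expansion.
Variables (K : fieldType) (M : lmodType (fps K)) (W : lmodType K).
Variables (red : M -> W) (s : W -> M).
Hypothesis regM : hregular M.
Hypothesis redD : {morph red : x y / x + y}.
Hypothesis redZ : forall c x, red (c *: x) = c 0%N *: red x.
Hypothesis red_ker : forall x, red x = 0 -> hpow 1 x.
Hypothesis sD : {morph s : x y / x + y}.
Hypothesis sZ : forall a w, s (a *: w) = fpsC a *: s w.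
Hypothesis sK : cancel s red.

Let red_hbar x : red (hbar *: x) = 0.
Proof. by rewrite redZ scale0r. Qed.

Lemma hbar_expansion : exists (Phi : {linear M -> fps W}) (rem : M -> M),
  [/\ forall x, x = s (red x) + hbar *: rem x,
      forall x, Phi x 0%N = red x & forall x n, Phi x n.+1 = Phi (rem x) n].
Proof.
have /choice[rem remE] x : exists y, x = s (red x) + hbar *: y.
  have red0 : red (x - s (red x)) = 0.
    by apply: (addIr (red (s (red x)))); rewrite -redD subrK sK add0r.
  by have [y Ey] := red_ker red0; exists y; rewrite -[hbar]expr1 -Ey addrC subrK.
have rem_uniq x w y : x = s w + hbar *: y -> rem x = y.
  move=> Ex; have wx : red x = w by rewrite Ex redD red_hbar addr0 sK.
  move: (remE x); rewrite wx {1}Ex => /addrI/esym; rewrite -[hbar]expr1.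
  exact: hbarX_inj.
have remD x y : rem (x + y) = rem x + rem y.
  apply: (@rem_uniq _ (red x + red y)).
  by rewrite {1}(remE x) {1}(remE y) sD scalerDr addrACA.
pose phi x : fps W := fun n => red (iter n rem x).
have phiS x n : phi x n.+1 = phi (rem x) n by rewrite /phi iterSr.
have phiD x y : phi (x + y) = phi x + phi y.
  apply/funext => n; rewrite fpsDE; elim: n x y => [|n IHn] x y; first exact: redD.
  by rewrite !phiS remD IHn.
(* The section [s] commutes with constants only; the part hbar * g of the scalar goes entirely into
   the remainder. *)
have remZ (c g : fps K) x : c = fpsC (c 0%N) + hbar * g ->
    rem (c *: x) = fpsC (c 0%N) *: rem x + g *: x.
  move=> cE; apply: (@rem_uniq _ (c 0%N *: red x)).
  rewrite {1}cE scalerDl {1}(remE x) scalerDr sZ scalerDr -!addrA !scalerA.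
  by rewrite [hbar * fpsC _]mulrC.
have phiZ (c : fps K) x : phi (c *: x) = c *: phi x.
  apply/funext => n; rewrite fps_scaleE; elim: n c x => [|n IHn] c x.
    by rewrite big_ord1 subn0 [LHS]redZ.
  have [g cE] := fps_split c; rewrite phiS (remZ _ _ _ cE) phiD fpsDE !IHn.
  rewrite [RHS]big_ord_recl subn0 phiS; congr (_ + _).
    by rewrite big_ord_recl subn0 /= big1 ?addr0 // => i _; rewrite scale0r.
  have gE i : g i = c i.+1.
    by rewrite cE fpsDE add0r hbar_mulE.
  by apply: eq_bigr => i _; rewrite /= subSS gE.
have phi_lin : linear phi by move=> c x y; rewrite phiD phiZ.
by exists (linear_of phi_lin), rem; split.
Qed.

End Expansion.

Section ExpansionTheory.
Variables (K : fieldType) (M : lmodType (fps K)) (W : lmodType K).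
Variables (red : M -> W) (s : W -> M) (Phi : {linear M -> fps W}) (rem : M -> M).
Hypothesis remE : forall x, x = s (red x) + hbar *: rem x.
Hypothesis Phi0 : forall x, Phi x 0%N = red x.
Hypothesis PhiS : forall x n, Phi x n.+1 = Phi (rem x) n.

Lemma expansion_approx n x : hpow n (x - \sum_(k < n) hbar ^+ k *: s (Phi x k)).
Proof.
elim: n x => [|n IHn] x; first by apply: hpow_all.
rewrite big_ord_recl expr0 scale1r Phi0 {1}(remE x) opprD addrACA subrr add0r.
have -> : \sum_(i < n) hbar ^+ (lift ord0 i) *: s (Phi x (lift ord0 i)) =
    hbar *: (\sum_(i < n) hbar ^+ i *: s (Phi (rem x) i)).
  rewrite scaler_sumr; apply: eq_bigr => i _.
  by rewrite scalerA -exprS PhiS.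
by rewrite -scalerBr -[hbar]expr1; apply: (@hpow_mul _ _ 1).
Qed.

Lemma expansion_inj : hregular M -> injective Phi.
Proof.
move=> regM x y xy; apply/eqP; rewrite -subr_eq0; apply/eqP.
apply: (hbar_separated regM) => n.
have := hpowB (expansion_approx n x) (expansion_approx n y).
by rewrite xy opprB addrA subrK.
Qed.

End ExpansionTheory.

Lemma hregular_regular (K : fieldType) : hregular ((fps K)^o : lmodType (fps K)).
Proof.
have id_lin : linear (id : (fps K)^o -> fps K^o) by [].
apply: (hregular_iso (f := linear_of id_lin)); last exact: hregular_fps.
by exists id.
Qed.

(** * Topological bases adapted to a submodule *)

Section LinearExtension.
Variables (K : fieldType) (W : lmodType K) (beta : W -> {linear W -> K^o}).
Hypothesis betaP : forall w, for_large (fun s => w = \sum_(a <- s) beta a w *: a /\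
  forall a, a \notin s -> beta a w = 0).
Variables (M : lmodType (fps K)) (sigma : W -> M).

(** Linear extension of arbitrary values on a basis. Since M is a module over power series, scalars
    of K act through [fpsC]. *)
Lemma coordinates_extend : exists s : W -> M,
  [/\ {morph s : x y / x + y}, forall a w, s (a *: w) = fpsC a *: s w &
      forall w, for_large (fun t => s w = \sum_(a <- t) fpsC (beta a w : K) *: sigma a)].
Proof.
have /choice[S HS] w : exists t, uniq t /\ forall a, a \notin t -> beta a w = 0.
  by have [t ut [_ Ht]] := for_large_ex (betaP w); exists t.
pose s w := \sum_(a <- S w) fpsC (beta a w : K) *: sigma a.
have sE w t : uniq t -> {subset S w <= t} ->
    s w = \sum_(a <- t) fpsC (beta a w : K) *: sigma a.
  move=> ut sub; rewrite /s (big_uniq_sub _ (HS w).1 ut sub).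
  apply: eq_bigr => a _; case: ifPn => // /(HS w).2 ->.
  by rewrite raddf0 scale0r.
exists s; split=> [v w|k w|w]; last by exists (S w) => t; apply: sE.
  set t := undup (S v ++ S w ++ S (v + w)).
  have ut : uniq t by apply: undup_uniq.
  rewrite !(sE _ t) // -?big_split /=.
  - by apply: eq_bigr => a _; rewrite raddfD raddfD scalerDl.
  - by move=> a aS; rewrite mem_undup !mem_cat aS !orbT.
  - by move=> a aS; rewrite mem_undup !mem_cat aS.
  - by move=> a aS; rewrite mem_undup !mem_cat aS !orbT.
set t := undup (S w ++ S (k *: w)).
have ut : uniq t by apply: undup_uniq.
rewrite !(sE _ t) // ?scaler_sumr.
- by apply: eq_bigr => a _; rewrite linearZ scalerA -rmorphM.
- by move=> a aS; rewrite mem_undup !mem_cat aS.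
- by move=> a aS; rewrite mem_undup !mem_cat aS !orbT.
Qed.

End LinearExtension.

(** An ordinary basis is one adapted to the flag whose levels are all zero. *)
Lemma vector_coordinates (K : fieldType) (W : lmodType K) :
  exists beta : W -> {linear W -> K^o},
  forall w, for_large (fun s => w = \sum_(a <- s) beta a w *: a /\
     forall a, a \notin s -> beta a w = 0).
Proof.
have [|||beta [Hb _]] := @adapted_coordinates K W (fun _ w => w = 0).
- by move=> _ c x y -> ->; rewrite scaler0 addr0.
- by [].
- by [].
- by exists beta.
Qed.

(** * Regular modules are topologically free *)

Section Residue.
Variables (K : fieldType) (M : lmodType (fps K)).

Definition residue : Type := quot (hpow_mod M 1).
HB.instance Definition _ := GRing.Zmodule.copy residue (quot (hpow_mod M 1)).

Definition residue_cls (x : M) : residue := cls (hpow_mod M 1) x.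
HB.instance Definition _ := GRing.Additive.copy residue_cls (cls (hpow_mod M 1)).

Let scale (a : K) (q : residue) : residue :=
  (fpsC a *: (q : quot (hpow_mod M 1)) : quot _).

Fact residue_scaleA a b q : scale a (scale b q) = scale (a * b) q.
Proof. by rewrite /scale scalerA rmorphM. Qed.
Fact residue_scale1 : left_id 1 scale.
Proof. by move=> q; rewrite /scale rmorph1 scale1r. Qed.
Fact residue_scaleDr : right_distributive scale +%R.
Proof. by move=> a q r; rewrite /scale scalerDr. Qed.
Fact residue_scaleDl q : {morph scale^~ q : a b / a + b}.
Proof. by move=> a b; rewrite /scale raddfD scalerDl. Qed.

HB.instance Definition _ := GRing.Zmodule_isLmodule.Build K residue
  residue_scaleA residue_scale1 residue_scaleDr residue_scaleDl.

Lemma residue_cls0P x : residue_cls x = 0 <-> hpow 1 x.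
Proof. exact: cls0P. Qed.

Lemma residue_clsZ (c : fps K) x : residue_cls (c *: x) = c 0%N *: residue_cls x.
Proof.
have [d cE] := fps_split c.
have -> : c 0%N *: residue_cls x = residue_cls (fpsC (c 0%N) *: x).
  by rewrite /residue_cls clsZ.
have /residue_cls0P x0 : hpow 1 (hbar *: (d *: x)) by exists (d *: x).
by rewrite {1}cE scalerDl raddfD /= -scalerA x0 addr0.
Qed.

End Residue.

(** A K-linear section of the reduction yields the expansion [Phi]; it is injective because M is
    separated, and surjective because the series of the lifted coefficients converges in M. *)
Lemma hregular_topologically_free (K : fieldType) (M : lmodType (fps K)) :
  hregular M -> topologically_free M.
Proof.
move=> regM; have [beta betaP] := vector_coordinates (residue M).
have [s [sD sZ sP]] := coordinates_extend betaP (fun q : residue M => rep q).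
have sK : cancel s (@residue_cls K M).
  move=> q; have [t ut [-> [qE _]]] := for_large_ex (for_large_and (sP q) (betaP q)).
  rewrite raddf_sum [RHS]qE; apply: eq_bigr => a _.
  by rewrite /= residue_clsZ [residue_cls _]repK.
have [|||Phi [rem [remE Phi0 PhiS]]] := hbar_expansion regM _ _ _ sD sZ sK.
- exact: raddfD.
- exact: residue_clsZ.
- by move=> x /residue_cls0P.
have PhiE n x (f : fps (residue M)) :
    hpow n.+1 (x - \sum_(k < n.+1) hbar ^+ k *: s (f k)) -> Phi x n = f n.
  elim: n x f => [|n IHn] x f.
    rewrite big_ord1 expr0 scale1r => /residue_cls0P/eqP.
    by rewrite raddfB subr_eq0 /= sK => /eqP <-; rewrite Phi0.
  move=> Hx; rewrite PhiS; apply: (IHn _ (fun k => f k.+1)).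
  have xf0 : residue_cls x = f 0%N.
    have /residue_cls0P/eqP := hpow_le (isT : 1 <= n.+2)%N Hx.
    rewrite raddfB subr_eq0 big_ord_recl raddfD /= expr0 scale1r sK => /eqP ->.
    rewrite raddf_sum big1 ?addr0 // => i _.
    by rewrite /= residue_clsZ /bump /= exprS fpsME big_ord1 /hbar mul0r scale0r.
  move: Hx; rewrite big_ord_recl expr0 scale1r {1}(remE x) xf0 opprD addrACA subrr add0r.
  under eq_bigr do rewrite /bump /= exprS -scalerA.
  rewrite -scaler_sumr -scalerBr -[hbar in X in X -> _]expr1.
  exact: (@hpow_div _ _ regM 1).
exists (residue M), Phi.
have /choice[g gK] f : exists x, Phi x = f.
  have [l Hl] := hbar_complete regM (fun n => s (f n)).
  by exists l; apply/funext => n; apply: PhiE.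
exists g => // x; apply: (expansion_inj remE Phi0 PhiS regM); exact: gK.
Qed.

Lemma hpow_regP (K : fieldType) n (f : (fps K)^o) :
  hpow n f <-> forall k, (k < n)%N -> (f : fps K) k = 0.
Proof. exact: (@hpow_fpsP K K^o). Qed.

(* [None] stands for divisibility by all the powers of hbar. *)
Definition odvd (K : fieldType) (d : option nat) (c : (fps K)^o) : Prop :=
  if d is Some k then hpow k c else c = 0.

Section Coordinates.
Variables (K : fieldType) (M : lmodType (fps K)).

Definition is_coordinates (I : eqType) (sigma : I -> M)
    (co : I -> {linear M -> (fps K)^o}) : Prop :=
  forall x n, for_large (fun s => hpow n (x - \sum_(a <- s) (co a x : fps K) *: sigma a)).

Lemma coordinates_hpow (I : eqType) (sigma : I -> M) co n x :
  is_coordinates sigma co -> (forall a, hpow n (co a x)) -> hpow n x.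
Proof.
move=> Hco Hx; have [s _ Hs] := for_large_ex (Hco x n).
rewrite -[x](subrK (\sum_(a <- s) (co a x : fps K) *: sigma a)).
by apply: hpowD => //; apply: hpow_sum => a _; apply: hpow_scale.
Qed.

(** The k-th coefficient of an element of S lies in level k + 1 of the flag, hence involves only
    basis vectors of depth at most k. Read for a fixed basis vector, this says that its coordinate
    starts no earlier than its depth. *)
Lemma adapted_hbar_coordinates (S : M -> Prop) : topologically_free M ->
  S 0 -> (forall c x y, S x -> S y -> S (c *: x + y)) ->
  exists (I : eqType) (sigma : I -> M) (co : I -> {linear M -> (fps K)^o})
      (d : I -> option nat),
    [/\ is_coordinates sigma co, forall x a, S x -> odvd (d a) (co a x) &
        forall a k, d a = Some k -> S (hbar ^+ k *: sigma a)].
Proof.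
move=> freeM S0 S_lin; have regM := topologically_free_hregular freeM.
have SZ c x : S x -> S (c *: x) by move=> Sx; rewrite -[_ *: _]addr0; apply: S_lin.
have SD x y : S x -> S y -> S (x + y) by move=> Sx; rewrite -[x]scale1r; apply: S_lin.
have SB x y : S x -> S y -> S (x - y) by move=> Sx Sy; rewrite addrC -scaleN1r; apply: S_lin.
case: freeM => W [Psi [Psi' PsiK Psi'K]].
pose red x := Psi x 0%N.
have redD : {morph red : x y / x + y} by move=> x y; rewrite /red linearD.
have redZ c x : red (c *: x) = c 0%N *: red x.
  by rewrite /red linearZ_LR fps_scaleE big_ord1.
have red_ker x : red x = 0 -> hpow 1 x.
  move=> x0; have /hpow_fpsP[f Ef] : forall k, (k < 1)%N -> Psi x k = 0 by case.
  exists (Psi' f); apply: (can_inj PsiK).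
  by rewrite linearZ Psi'K.
have red_surj w : exists x, red x = w.
  by exists (Psi' (fun=> w)); rewrite /red Psi'K.
(* The index is shifted by one: level 0 has to be the zero space, so level k + 1 holds the
   reductions of hbar^-k S. *)
pose G k w := if k is k'.+1 then exists2 y, S (hbar ^+ k' *: y) & red y = w else w = 0.
have red0 : red 0 = 0 by rewrite /red linear0.
have GS k w : G k w -> G k.+1 w.
  case: k => [->|k [y Sy <-]] /=; first by exists 0; rewrite ?scaler0.
  by exists y => //; rewrite exprS -scalerA; apply: SZ.
have [|||beta [betaP Gbeta]] := @adapted_coordinates K W G.
- case=> [|k] c v w /=; first by move=> -> ->; rewrite scaler0 addr0.
  move=> [x Sx <-] [y Sy <-]; exists (fpsC c *: x + y); last by rewrite redD redZ.
  by rewrite scalerDr scalerA mulrC -scalerA; apply: S_lin.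
- by move=> k l w /subnKC <-; elim: (l - k)%N => [|m IHm]; rewrite ?addn0 ?addnS // => /IHm/GS.
- by [].
(* The lift of a is chosen at the least depth k for which some lift y has hbar^k y in S; a vector
   lying in no level gets an arbitrary lift and depth [None]. *)
have /choice[ds Hds] a : exists ds : option nat * M,
    [/\ red ds.2 = a, forall k, ds.1 = Some k -> S (hbar ^+ k *: ds.2) &
        forall j, G j.+1 a -> exists2 k, ds.1 = Some k & (k <= j)%N].
  have [exk|nok] := pselect (exists k, `[< G k.+1 a >]).
    have [k /asboolP[y Sy ya] kmin] := ex_minnP exk.
    exists (Some k, y); split=> //= [_ [<-] //|j Gj].
    by exists k => //; apply: kmin; apply/asboolP.
  have [x xa] := red_surj a; exists (None, x); split=> //= j Gj.
  by case: nok; exists j; apply/asboolP.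
pose sigma a := (ds a).2; pose d a := (ds a).1.
have [s [sD sZ sP]] := coordinates_extend betaP sigma.
have sK : cancel s red.
  move=> w; have [t ut [-> [wE _]]] := for_large_ex (for_large_and (sP w) (betaP w)).
  rewrite (big_morph red redD red0) [RHS]wE; apply: eq_bigr => a _.
  by rewrite redZ; have [-> _ _] := Hds a.
have [Phi [rem [remE Phi0 PhiS]]] := hbar_expansion regM redD redZ red_ker sD sZ sK.
have co_lin a : linear (fun x => (fun n => beta a (Phi x n)) : (fps K)^o).
  move=> c x y; apply/funext => n; rewrite linearP fpsDE fps_scaleE linearD linear_sum.
  by congr (_ + _); apply: eq_bigr => i _; rewrite linearZ.
pose co a : {linear M -> (fps K)^o} := linear_of (co_lin a).
have coE a x : co a x = fpsC (beta a (red x) : K) + hbar * (co a (rem x) : fps K) :> fps K.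
  apply/funext => n; rewrite fpsDE hbar_mulE; case: n => [|n]; first by rewrite addr0 -Phi0.
  by rewrite add0r /= /linear_of PhiS.
have s_in k w : G k.+1 w -> S (hbar ^+ k *: s w).
  move=> Gw; have [t ut ->] := for_large_ex (sP w).
  rewrite scaler_sumr; apply: (big_ind S) => // a _.
  have [->|ba] := eqVneq (beta a w) 0; first by rewrite raddf0 scale0r scaler0.
  have [_ Hd /(_ k (Gbeta _ _ _ Gw ba))[j dj jk]] := Hds a.
  rewrite scalerA mulrC -scalerA; apply: (SZ); rewrite -(subnK jk) exprD -scalerA.
  by apply: SZ; apply: Hd.
(* By induction hbar^k times the k-th remainder stays in S: by [s_in], what is subtracted from it at
   each stage is also in S. *)
have G_Phi x k : S x -> G k.+1 (Phi x k).
  move=> Sx; have : S (hbar ^+ k *: iter k rem x) /\ Phi x k = red (iter k rem x).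
    elim: k => [|k [IHk IHk']].
      by rewrite expr0 scale1r Phi0.
    split; last first.
      by elim: (k.+1) (x) => [|n IHn] y; rewrite ?Phi0 // PhiS IHn -iterSr.
    rewrite iterS exprSr -scalerA; set y := iter k rem x in IHk *.
    have -> : hbar *: rem y = y - s (red y) by rewrite {2}(remE y) addrC addKr.
    rewrite scalerBr; apply: SB => //; apply: s_in.
    by exists y.
  by move=> [Sk ->]; exists (iter k rem x).
exists W, sigma, co, d; split.
- move=> x n; elim: n x => [|n IHn] x; first by exists [::] => t _ _; apply: hpow_all.
  apply: for_large_imp (for_large_and (IHn (rem x)) (sP (red x))) => t [Ht st].
  under eq_bigr do rewrite coE scalerDl -scalerA.
  rewrite big_split -st -scaler_sumr /= {1}(remE x) opprD addrACA subrr add0r -scalerBr.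
  by rewrite -[X in X *: _]expr1; apply: (@hpow_mul _ _ 1).
- move=> x a Sx; have [_ _ Hj] := Hds a.
  rewrite /odvd; case da: (d a) => [k|].
    apply/hpow_regP => j jk; apply/eqP; apply: contraT => b0.
    have [k' dk kj] := Hj j (Gbeta _ _ _ (G_Phi x j Sx) b0).
    by move: da kj; rewrite /d dk => -[->]; rewrite leqNgt jk.
  apply/funext => j; apply/eqP; apply: contraT => b0.
  have [k' dk kj] := Hj j (Gbeta _ _ _ (G_Phi x j Sx) b0).
  by move: da; rewrite /d dk.
- by move=> a k dk; have [_ Hk _] := Hds a; apply: Hk.
Qed.

Lemma hbar_coordinates : topologically_free M ->
  exists (I : eqType) (sigma : I -> M) (co : I -> {linear M -> (fps K)^o}),
    is_coordinates sigma co.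
Proof.
move=> freeM.
by have [//|//|I [sigma [co [d [H _ _]]]]] := @adapted_hbar_coordinates (fun=> True) freeM;
  exists I, sigma, co.
Qed.

End Coordinates.

(** * Completed tensor products *)

Section TensorLinear.
Variables (R : comNzRingType) (M N X : lmodType R).

Lemma pure0l y : pure (0 : M) (y : N) = 0.
Proof. by rewrite -(scale0r 0) pureZl scale0r. Qed.
Lemma pure0r x : pure (x : M) (0 : N) = 0.
Proof. by rewrite -(scale0r 0) pureZr scale0r. Qed.
Lemma pureBl x x' y : pure (x - x' : M) (y : N) = pure x y - pure x' y.
Proof. by rewrite -scaleN1r pureDl pureZl scaleN1r. Qed.
Lemma pureBr x y y' : pure (x : M) (y - y' : N) = pure x y - pure x y'.
Proof. by rewrite -scaleN1r pureDr pureZr scaleN1r. Qed.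
Lemma pure_suml (I : Type) (s : seq I) (F : I -> M) (y : N) :
  pure (\sum_(i <- s) F i) y = \sum_(i <- s) pure (F i) y.
Proof. by apply: (big_morph (fun x => pure x y)) => [x x'|]; rewrite ?pureDl ?pure0l. Qed.
Lemma pure_sumr (I : Type) (s : seq I) (x : M) (F : I -> N) :
  pure x (\sum_(i <- s) F i) = \sum_(i <- s) pure x (F i).
Proof. by apply: (big_morph (fun y => pure x y)) => [y y'|]; rewrite ?pureDr ?pure0r. Qed.

Variable f : M -> N -> X.
Hypotheses (fl : forall y, linear (f^~ y)) (fr : forall x, linear (f x)).

Lemma bilinear_balanced : balanced f.
Proof.
have f0l y : f 0 y = 0 by have := linear0 (linear_of (fl y)).
have f0r x : f x 0 = 0 by have := linear0 (linear_of (fr x)).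
split=> [y x x'|x y y'|c x y].
- by have := fl y 1 x x'; rewrite !scale1r.
- by have := fr x 1 y y'; rewrite !scale1r.
- by have := fl y c x 0; have := fr x c y 0; rewrite !addr0 f0l f0r !addr0 => -> ->.
Qed.

Lemma tlift_linear : linear (tlift f).
Proof.
move=> c t u; rewrite (tliftD bilinear_balanced); congr (_ + _).
elim/tensor_ind: t => [x y||t t' IH IH'].
- rewrite -pureZl !(tlift_pure bilinear_balanced).
  by have := linearZ_LR (linear_of (fl y)) c x.
- by rewrite scaler0 (tlift0 bilinear_balanced) scaler0.
- by rewrite scalerDr !(tliftD bilinear_balanced) IH IH' scalerDr.
Qed.

Lemma tensor_lift_exists : exists F : {linear tensor M N -> X},
  forall x y, F (pure x y) = f x y.
Proof.
by exists (linear_of tlift_linear) => x y; apply: (tlift_pure bilinear_balanced).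
Qed.

End TensorLinear.

Lemma tensor_linear_ext (R : comNzRingType) (M N X : lmodType R)
    (F G : {linear tensor M N -> X}) :
  (forall x y, F (pure x y) = G (pure x y)) -> F =1 G.
Proof. by apply: tensor_lift_ext; apply: raddfB. Qed.

Section CoTensor.
Variables (R : comNzRingType) (M N : lmodType R).
Variables (f : {linear M -> R^o}) (g : {linear N -> R^o}).

Fact cotensor_linearl y : linear (fun x => (f x : R) * (g y : R) : R^o).
Proof. by move=> c x x'; rewrite linearP mulrDl -mulrA. Qed.
Fact cotensor_linearr x : linear (fun y => (f x : R) * (g y : R) : R^o).
Proof. by move=> c y y'; rewrite linearP mulrDr mulrCA. Qed.

Definition cotensor : {linear tensor M N -> R^o} :=
  linear_of (tlift_linear cotensor_linearl cotensor_linearr).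

Lemma cotensor_pure x y : cotensor (pure x y) = (f x : R) * (g y : R).
Proof. exact: (tlift_pure (bilinear_balanced cotensor_linearl cotensor_linearr)). Qed.

End CoTensor.

Section TensorExpansion.
Variables (R : comNzRingType) (M N : lmodType R) (I J : eqType).
Variables (sigma : I -> M) (co : I -> {linear M -> R^o}).
Variables (tau : J -> N) (co' : J -> {linear N -> R^o}).
Variables (DM : M -> Prop) (DN : N -> Prop) (D : tensor M N -> Prop).
Hypotheses (D0 : D 0) (DD : forall t u, D t -> D u -> D (t + u)).
Hypothesis DMl : forall x y, DM x -> D (pure x y).
Hypothesis DNr : forall x y, DN y -> D (pure x y).
Hypothesis coP : forall x,
  for_large (fun s => DM (x - \sum_(a <- s) (co a x : R) *: sigma a)).
Hypothesis coP' : forall y,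
  for_large (fun s => DN (y - \sum_(b <- s) (co' b y : R) *: tau b)).

(** The error predicates are kept abstract because two of them occur: divisibility by a power of
    hbar, and membership in a term of the product filtration of U' (x) U'. *)
Lemma tensor_expand t : exists (s : seq I) (s' : seq J),
  D (t - \sum_(a <- s) \sum_(b <- s')
          (cotensor (co a) (co' b) t : R) *: pure (sigma a) (tau b)).
Proof.
(* Allowing all larger lists lets two summands be expanded along the same lists. *)
suff [s0 [s0' H]] : exists (s0 : seq I) (s0' : seq J), forall s s', uniq s -> uniq s' ->
    {subset s0 <= s} -> {subset s0' <= s'} ->
    D (t - \sum_(a <- s) \sum_(b <- s')
          (cotensor (co a) (co' b) t : R) *: pure (sigma a) (tau b)).
  exists (undup s0), (undup s0').
  by apply: H; rewrite ?undup_uniq // => a; rewrite mem_undup.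
elim/tensor_ind: t => [x y||t u [s0 [s0' IH]] [s1 [s1' IH']]].
- have [s0 H0] := coP x; have [s0' H0'] := coP' y.
  exists s0, s0' => s s' us us' sub sub'.
  set X := \sum_(a <- s) (co a x : R) *: sigma a.
  set Y := \sum_(b <- s') (co' b y : R) *: tau b.
  have -> : \sum_(a <- s) \sum_(b <- s') (cotensor (co a) (co' b) (pure x y) : R)
      *: pure (sigma a) (tau b) = pure X Y.
    rewrite pure_suml; apply: eq_bigr => a _.
    rewrite pure_sumr; apply: eq_bigr => b _.
    by rewrite cotensor_pure pureZl pureZr scalerA.
  have -> : pure x y - pure X Y = pure (x - X) y + pure X (y - Y).
    by rewrite pureBl pureBr addrA subrK.
  by apply: DD; [apply/DMl/H0|apply/DNr/H0'].
- exists [::], [::] => s s' _ _ _ _; rewrite sub0r big1 ?oppr0 // => a _.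
  by rewrite big1 // => b _; rewrite linear0 scale0r.
- exists (s0 ++ s1), (s0' ++ s1') => s s' us us' sub sub'.
  under eq_bigr do under eq_bigr do rewrite linearD scalerDl.
  under eq_bigr do rewrite big_split /=.
  rewrite big_split /= opprD addrACA.
  by apply: DD; [apply: IH|apply: IH'] => // a Ha; (apply: sub || apply: sub');
    rewrite mem_cat Ha ?orbT.
Qed.

End TensorExpansion.

Section TensorHbar.
Variable K : fieldType.
Local Notation R := (fps K).
Variables (M N : lmodType R).
Implicit Types t u : tensor M N.

Lemma hpow_purel n (x : M) (y : N) : hpow n x -> hpow n (pure x y).
Proof. by move=> [x' ->]; exists (pure x' y); rewrite pureZl. Qed.
Lemma hpow_purer n (x : M) (y : N) : hpow n y -> hpow n (pure x y).
Proof. by move=> [y' ->]; exists (pure x y'); rewrite pureZr. Qed.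

Lemma hbar_tensor_expand (I J : eqType) (sigma : I -> M)
    (co : I -> {linear M -> R^o}) (tau : J -> N) (co' : J -> {linear N -> R^o}) n t :
  is_coordinates sigma co -> is_coordinates tau co' ->
  exists (s : seq I) (s' : seq J),
  hpow n (t - \sum_(a <- s) \sum_(b <- s')
          (cotensor (co a) (co' b) t : R) *: pure (sigma a) (tau b)).
Proof.
move=> Hco Hco'; refine (@tensor_expand R M N I J sigma co tau co' (@hpow K M n) (@hpow K N n)
  (@hpow K (tensor M N) n) _ _ _ _ _ _ t).
- exact: hpow_0.
- by move=> *; apply: hpowD.
- by move=> *; apply: hpow_purel.
- by move=> *; apply: hpow_purer.
- by move=> x; apply: Hco.
- by move=> y; apply: Hco'.
Qed.

Lemma to_ctensor_linear : linear (to_invlim (hadic (tensor M N))).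
Proof.
move=> c t u; apply: invlim_eq => n /=.
by rewrite raddfD /= (clsZ (hpow_mod (tensor M N) n)).
Qed.
Definition to_ctensor : {linear tensor M N -> ctensor M N} :=
  linear_of to_ctensor_linear.

Lemma to_ctensorE t n : to_ctensor t n = cls _ t. Proof. by []. Qed.
Lemma to_ctensor_pure x y : to_ctensor (pure x y) = cpure x y. Proof. by []. Qed.

Lemma ctensor_proj_le (z : ctensor M N) m n t : (n <= m)%N ->
  z m = cls (hadic (tensor M N) m) t -> z n = cls (hadic (tensor M N) n) t.
Proof.
move=> /subnKC <-; elim: (m - n)%N => [|k IHk]; first by rewrite addn0.
rewrite addnS => zt; apply: IHk.
by rewrite -(@proj_compat _ (hadic (tensor M N))) zt (to_invlim_compat (hadic _)).
Qed.

Lemma hpow_ctensor_proj (z : ctensor M N) n : hpow n z -> z n = 0.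
Proof.
move=> [w ->]; rewrite projZ -(repK (w n)) -(clsZ (hpow_mod (tensor M N) n)).
by apply/cls0P; apply: hpow_hbarX.
Qed.

Hypotheses (freeM : topologically_free M) (freeN : topologically_free N).

(** Modulo hbar^n, t is a finite combination of basis tensors whose coefficients are linear in t;
    the division by hbar^m then takes place in K[[hbar]]. *)
Lemma tensor_hpow_div m n t : hpow (m + n) (hbar ^+ m *: t) -> hpow n t.
Proof.
have [I [sigma [co Hco]]] := hbar_coordinates freeM.
have [J [tau [co' Hco']]] := hbar_coordinates freeN.
move=> Ht; have [s [s' Hs]] := hbar_tensor_expand n t Hco Hco'.
rewrite -[t](subrK (\sum_(a <- s) \sum_(b <- s')
  (cotensor (co a) (co' b) t : R) *: pure (sigma a) (tau b))).
apply: hpowD => //; apply: hpow_sum => a _; apply: hpow_sum => b _.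
apply: hpow_scale; apply: (@hpow_div _ _ (hregular_regular K) m).
by rewrite -[X in @hpow _ _ _ X](linearZ_LR (cotensor (co a) (co' b))); apply: hpow_linear.
Qed.

(** The quotient has at level k the representative of z at level n + k divided by hbar^n;
    [tensor_hpow_div] makes these compatible. With [hpow_ctensor_proj], the limit topology is thus
    the hbar-adic one. *)
Lemma ctensor_proj_hpow (z : ctensor M N) n : z n = 0 -> hpow n z.
Proof.
move=> zn; have zE k : z k = cls (hadic _ k) (rep (z (n + k)%N)).
  by apply: (@ctensor_proj_le _ (n + k)); rewrite ?leq_addl // repK.
have /choice[u uE] k : exists u, rep (z (n + k)%N) = hbar ^+ n *: u.
  suff : hpow n (rep (z (n + k)%N)) by [].
  apply/(@cls0P _ (hadic (tensor M N) n)); rewrite -zn.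
  by apply/esym/(@ctensor_proj_le _ (n + k)); rewrite ?leq_addr // repK.
have wcompat k : cls (hadic (tensor M N) k) (rep (cls (hadic _ k.+1) (u k.+1))) =
    cls (hadic _ k) (u k).
  rewrite (to_invlim_compat (hadic _)); apply/cls_eq.
  apply: (@tensor_hpow_div n); rewrite scalerBr -!uE.
  apply/(@cls_eq _ (hadic (tensor M N) (n + k))); rewrite repK.
  by apply/esym/(@ctensor_proj_le _ (n + k.+1)); rewrite ?addnS ?leqnSn // repK.
exists (@InvLim _ (hadic (tensor M N)) (fun k => cls (hadic _ k) (u k)) wcompat).
by apply: invlim_eq => k; rewrite zE uE projZ /= (clsZ (hpow_mod (tensor M N) k)).
Qed.

Lemma ctensor_approx (z : ctensor M N) n : exists2 t,
  z n = cls (hadic (tensor M N) n) t & hpow n (z - to_ctensor t).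
Proof.
exists (rep (z n)); first by rewrite repK.
by apply: ctensor_proj_hpow; rewrite projB to_ctensorE repK subrr.
Qed.

Lemma hregular_ctensor : hregular (ctensor M N).
Proof.
split=> [z z0|z z0|u].
- apply: invlim_eq => n; apply: hpow_ctensor_proj.
  have [t zt _] := ctensor_approx z n.+1.
  have Ht : hpow n t.
    apply: (@tensor_hpow_div 1); rewrite expr1 add1n.
    apply/(@cls0P _ (hadic (tensor M N) n.+1)).
    have := congr1 (fun w : ctensor M N => w n.+1) z0.
    by rewrite projZ zt -(clsZ (hpow_mod (tensor M N) n.+1)).
  apply: ctensor_proj_hpow; rewrite (ctensor_proj_le (leqnSn n) zt).
  exact/cls0P.
- by apply: invlim_eq => n; apply: hpow_ctensor_proj.
- have lcompat n : cls (hadic (tensor M N) n)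
      (rep ((\sum_(k < n.+1) hbar ^+ k *: u k) n.+1)) =
      (\sum_(k < n) hbar ^+ k *: u k) n.
    rewrite (@proj_compat _ (hadic (tensor M N))) big_ord_recr projD.
    by rewrite [X in _ + X]hpow_ctensor_proj ?addr0 //; apply: hpow_hbarX.
  exists (@InvLim _ (hadic (tensor M N)) _ lcompat) => n.
  by apply: ctensor_proj_hpow; rewrite projB subrr.
Qed.

Lemma topologically_free_ctensor : topologically_free (ctensor M N).
Proof. exact: (hregular_topologically_free hregular_ctensor). Qed.

Variables (X : lmodType R).
Hypothesis regX : hregular X.

(** Sums of pure tensors are dense, linear maps preserve divisibility by hbar^n, and X is
    separated. *)
Lemma ctensor_linear_ext (F G : {linear ctensor M N -> X}) :
  (forall x y, F (cpure x y) = G (cpure x y)) -> F =1 G.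
Proof.
move=> FG z; apply/eqP; rewrite -subr_eq0; apply/eqP.
apply: (hbar_separated regX) => n; have [t _ Ht] := ctensor_approx z n.
have FGt : F (to_ctensor t) = G (to_ctensor t).
  elim/tensor_ind: t {Ht} => [x y||t u IH IH'].
  - by rewrite to_ctensor_pure.
  - by rewrite !linear0.
  - by rewrite !linearD IH IH'.
apply: (@hpow_trans _ _ _ (F (to_ctensor t))).
  by rewrite -linearB; apply: hpow_linear.
by rewrite FGt -linearB; apply: hpow_linear; apply: hpow_sym.
Qed.

Lemma ctensor_lift_exists (F : {linear tensor M N -> X}) :
  exists Fh : {linear ctensor M N -> X}, forall t, Fh (to_ctensor t) = F t.
Proof.
have /choice[g gP] (z : ctensor M N) : exists l, forall n, hpow n (l - F (rep (z n))).
  apply: (hbar_cauchy regX) => n; rewrite -linearB; apply: hpow_linear.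
  apply/(@cls_eq _ (hadic (tensor M N) n)).
  by rewrite (@proj_compat _ (hadic (tensor M N))) repK.
have gE (z : ctensor M N) n t : z n = cls (hadic (tensor M N) n) t -> hpow n (g z - F t).
  move=> zt; apply: hpow_trans (gP z n) _; rewrite -linearB; apply: hpow_linear.
  by apply/(@cls_eq _ (hadic (tensor M N) n)); rewrite repK.
have g_uniq (z : ctensor M N) y :
    (forall n, exists2 t, z n = cls (hadic _ n) t & hpow n (F t - y)) -> g z = y.
  move=> Hy; apply/eqP; rewrite -subr_eq0; apply/eqP.
  apply: (hbar_separated regX) => n; have [t /gE zt ty] := Hy n.
  exact: hpow_trans zt ty.
have g_lin : linear g.
  move=> c z w; apply: g_uniq => n; have [t zt _] := ctensor_approx z n.
  have [u wu _] := ctensor_approx w n; exists (c *: t + u).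
    by rewrite projD projZ zt wu raddfD /= (clsZ (hpow_mod (tensor M N) n)).
  rewrite linearP opprD addrACA -scalerBr.
  by apply: hpowD; [apply: hpowZ|]; apply: hpow_sym; apply: gE.
exists (linear_of g_lin) => t; apply: g_uniq => n; exists t => //.
by rewrite subrr; apply: hpow_0.
Qed.

Lemma ctensor_bilinear_lift (f : M -> N -> X) :
  (forall y, linear (f^~ y)) -> (forall x, linear (f x)) ->
  exists F : {linear ctensor M N -> X}, forall x y, F (cpure x y) = f x y.
Proof.
move=> fl fr; have [F HF] := tensor_lift_exists fl fr.
by have [Fh HFh] := ctensor_lift_exists F; exists Fh => x y; rewrite -HF -HFh.
Qed.

End TensorHbar.

Lemma ctensor_proj1 (K : fieldType) (A : algType (fps K)) n :
  (1 : ctensor A A) n = cls (hadic (tensor A A) n) (pure 1 1).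
Proof. by []. Qed.

(** * Tensor square of a dual set *)

Section DualTensor.
Variable K : fieldType.
Local Notation R := (fps K).
Variables (M : lmodType R) (I : Type) (N : I -> lmodType R).
Variables (f : forall i, {linear M -> N i}) (n : I -> nat).
Hypotheses (freeM : topologically_free M) (freeN : forall i, topologically_free (N i)).
Hypothesis f_sat : forall q x, (forall i, hpow (n i + q) (f i x)) -> hpow q x.

(** In the application i is a tree, [f i] its delta map and [n i] its number of leaves. The
    hypothesis [f_sat] is what allows an element with q excess powers of hbar in every condition to
    be divided by hbar^q within M. *)
Definition dual_set (x : M) : Prop := forall i, hpow (n i) (f i x).

Lemma dual_set_lin c x y : dual_set x -> dual_set y -> dual_set (c *: x + y).
Proof.
by move=> Sx Sy i; rewrite linearP; apply: hpowD; first apply: hpowZ.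
Qed.

Lemma dual_set0 : dual_set 0.
Proof. by move=> i; rewrite linear0; apply: hpow_0. Qed.

Lemma dual_set_div q x : (forall i, hpow (n i + q) (f i x)) ->
  exists2 y, dual_set y & x = hbar ^+ q *: y.
Proof.
move=> Hx; have [y Ey] := f_sat Hx; exists y => // i.
apply: (hpow_div (topologically_free_hregular (freeN i)) (m := q)).
by rewrite -linearZ_LR -Ey addnC.
Qed.

(* The slices of [z] along functionals of [N'] are divisible elements of the
   dual set, on which the coordinate [g] gains the extra valuation [m]. *)
Lemma dual_slice (N' : lmodType R) (z : ctensor M N') q (g : {linear M -> R^o}) m
    (Sg : {linear ctensor M N' -> N'}) :
  topologically_free N' ->
  (forall i, hpow (n i + q) (ctensor_map (f i) (idfun : {linear N' -> N'}) z)) ->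
  (forall x, dual_set x -> hpow m (g x)) ->
  (forall x y, Sg (cpure x y) = (g x : R) *: y) -> hpow (q + m) (Sg z).
Proof.
move=> freeN' Hz Hg SgE; have [J [tau [co Hco]]] := hbar_coordinates freeN'.
apply: (coordinates_hpow Hco) => b.
have lift_ex (X : lmodType R) : topologically_free X ->
    exists T : {linear ctensor X N' -> X}, forall x y, T (cpure x y) = (co b y : R) *: x.
  move=> freeX.
    apply: (ctensor_bilinear_lift freeX freeN' (topologically_free_hregular freeX)).
    by move=> y c x x'; rewrite scalerDr !scalerA mulrC.
  by move=> x c y y'; rewrite linearP scalerDl scalerA.
have [T TE] := lift_ex M freeM.
have [y Sy Ty] : exists2 y, dual_set y & T z = hbar ^+ q *: y.
  apply: dual_set_div => i; have [Ti TiE] := lift_ex (N i) (freeN i).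
  have -> : f i (T z) = Ti (ctensor_map (f i) (idfun : {linear N' -> N'}) z).
    apply: (ctensor_linear_ext freeM freeN' (topologically_free_hregular (freeN i))
      (F := f i \o T) (G := Ti \o ctensor_map (f i) idfun)) => x y /=.
    by rewrite ctensor_map_cpure TE TiE linearZ_LR.
  exact: hpow_linear.
(* Slicing in either order gives the same scalar: the first factor supplies the valuation m, the
   element of the dual set found above supplies q. *)
have -> : co b (Sg z) = g (T z).
  apply: (ctensor_linear_ext freeM freeN' (hregular_regular K)
    (F := co b \o Sg) (G := g \o T)) => x y' /=.
  by rewrite SgE TE !linearZ_LR; apply: mulrC.
by rewrite Ty linearZ_LR; apply: hpow_mul; apply: Hg.
Qed.

(** A coordinate of z along sigma_a (x) sigma_b is divisible by the product of hbar^(d a) and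
    hbar^(d b); distributing these powers over the two factors puts both in the dual set. *)
Lemma dual_tensor (z : ctensor M M) :
  (forall i j, hpow (n i + n j) (ctensor_map (f i) (f j) z)) ->
  forall m, exists2 s, forall p, p \in s -> dual_set p.1 /\ dual_set p.2 &
    z m = cls (hadic (tensor M M) m) (tcls s).
Proof.
move=> Hz m.
have [I0 [sigma [co [d [Hco Hd Hsigma]]]]] :=
  adapted_hbar_coordinates freeM dual_set0 dual_set_lin.
pose e a k := forall x, dual_set x -> hpow k (co a x).
have regM := topologically_free_hregular freeM.
have slice a : exists S : {linear ctensor M M -> M},
    forall x y, S (cpure x y) = (co a x : R) *: y.
  apply: (ctensor_bilinear_lift freeM freeM regM).
    by move=> y c x x'; rewrite linearP scalerDl scalerA.
  by move=> x c y y'; rewrite scalerDr !scalerA mulrC.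
(* Slicing by [co a] in the first factor already gives hbar^k times an element of the dual set, by
   [dual_slice] for each [f j] on the second factor; applying [co b] then gains l. *)
have slice_hpow a b k l (S : {linear ctensor M M -> M}) :
    (forall x y, S (cpure x y) = (co a x : R) *: y) -> e a k -> e b l ->
    hpow (k + l) (co b (S z)).
  move=> SE ea eb.
  have [j|y Sy ->] := @dual_set_div k (S z); last first.
    by rewrite linearZ_LR; apply: hpow_mul; apply: eb.
  have [Sj SjE] : exists Sj : {linear ctensor M (N j) -> N j},
      forall x y, Sj (cpure x y) = (co a x : R) *: y.
    apply: (ctensor_bilinear_lift freeM (freeN j) (topologically_free_hregular (freeN j))).
      by move=> y c x x'; rewrite linearP scalerDl scalerA.
    by move=> x c y y'; rewrite scalerDr !scalerA mulrC.
  have -> : f j (S z) = Sj (ctensor_map (idfun : {linear M -> M}) (f j) z).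
    apply: (ctensor_linear_ext freeM freeM (topologically_free_hregular (freeN j))
      (F := f j \o S) (G := Sj \o ctensor_map idfun (f j))) => x y /=.
    by rewrite ctensor_map_cpure SE SjE linearZ_LR.
  apply: (dual_slice (freeN j) _ ea SjE) => i.
  have -> : ctensor_map (f i) (idfun : {linear N j -> N j})
      (ctensor_map (idfun : {linear M -> M}) (f j) z) = ctensor_map (f i) (f j) z.
    apply: (ctensor_linear_ext freeM freeM (hregular_ctensor (freeN i) (freeN j))
      (F := ctensor_map (f i) idfun \o ctensor_map idfun (f j))
      (G := ctensor_map (f i) (f j))) => x y /=.
    by rewrite !ctensor_map_cpure.
  exact: Hz.
have [t zt Ht] := ctensor_approx freeM freeM z m.
have slice_t a b (S : {linear ctensor M M -> M}) :
    (forall x y, S (cpure x y) = (co a x : R) *: y) ->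
    hpow m (cotensor (co a) (co b) t - co b (S z) : R^o).
  move=> SE; have -> : cotensor (co a) (co b) t = co b (S (to_ctensor M M t)).
    apply: (tensor_linear_ext (F := cotensor (co a) (co b))
      (G := co b \o S \o to_ctensor M M)) => x y.
    rewrite -[RHS]/(co b (S (cpure x y))) SE linearZ_LR; exact: cotensor_pure.
  by rewrite -!linearB; apply/hpow_linear/hpow_linear/hpow_sym.
pose Q (u : tensor M M) := exists2 s, forall p, p \in s -> dual_set p.1 /\ dual_set p.2 &
  hpow m (u - tcls s).
have Q0 u : hpow m u -> Q u by exists [::] => //; rewrite [tcls _](_ : _ = 0) ?subr0.
have QD u v : Q u -> Q v -> Q (u + v).
  move=> [s Ss us] [s' Ss' vs']; exists (s ++ s').
    by move=> p; rewrite mem_cat => /orP[/Ss|/Ss'].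
  by rewrite tcls_cat opprD addrACA; apply: hpowD.
suff [s Ss ts] : Q t.
  by exists s => //; rewrite zt; apply/cls_eq.
have [s [s' Hs]] := hbar_tensor_expand m t Hco Hco.
rewrite -[t](subrK (\sum_(a <- s) \sum_(b <- s')
  (cotensor (co a) (co b) t : R) *: pure (sigma a) (sigma b))).
apply: (QD); first exact: Q0.
have Q00 : Q 0 by apply: Q0; apply: hpow_0.
apply: (big_ind Q Q00 QD) => a _; apply: (big_ind Q Q00 QD) => b _.
have [S SE] := slice a; have := slice_t a b S SE; have := slice_hpow a b _ _ S SE.
have ea0 c : e c 0%N by move=> x _; apply: hpow_all.
(* A coordinate of depth [None] vanishes on the dual set, so any exponent is allowed; m makes the
   corresponding term disappear modulo hbar^m. *)
have eNone c : d c = None -> e c m.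
  by move=> dc x /(Hd _ c); rewrite dc => ->; apply: hpow_0.
have eSome c k : d c = Some k -> e c k by move=> dc x /(Hd _ c); rewrite dc.
set c0 := co b (S z) => Hk Ht'.
have Qm : hpow m c0 -> Q ((cotensor (co a) (co b) t : R) *: pure (sigma a) (sigma b)).
  move=> Hc; apply/Q0/hpow_scale; rewrite -[X in hpow _ X](subrK c0).
  exact: hpowD.
case da: (d a) => [k|]; last by apply: Qm; rewrite -[m]addn0; apply: Hk => //; apply: eNone.
case db: (d b) => [l|]; last by apply: Qm; rewrite -[m]add0n; apply: Hk => //; apply: eNone.
have [c Ec] := Hk k l (eSome _ _ da) (eSome _ _ db).
exists [:: ((c : R) *: (hbar ^+ k *: sigma a), hbar ^+ l *: sigma b)].
  move=> p; rewrite inE => /eqP -> /=; split; last exact: Hsigma.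
  by rewrite -[_ *: _]addr0; apply: dual_set_lin; [exact: Hsigma|exact: dual_set0].
rewrite [tcls _](_ : _ = (c0 : R) *: pure (sigma a) (sigma b)); last first.
  rewrite -[LHS]/(pure _ _) pureZl pureZl pureZr !scalerA Ec; congr (_ *: _).
  by rewrite -mulrA -exprD mulrC.
by rewrite -scalerBl; apply: hpow_scale.
Qed.

End DualTensor.

(** * Products and commutators in the quantum dual *)

Section QuantumDualProduct.
Variables (K : fieldType) (U : algType (fps K)).
Local Notation R := (fps K).
Hypothesis freeU : topologically_free U.
Variables (Delta : {lrmorphism U -> ctensor U U}) (eps : {lrmorphism U -> R^o}).
Hypothesis heps : counital Delta eps.
Local Notation delta := (delta Delta eps).
Local Notation qd := (quantum_dual Delta eps).

Lemma quantum_dualP x : reflect (forall P, hpow (leaves P) (delta P x)) (x \in qd).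
Proof.
by apply: (iffP (asboolP _)) => [[]|] // Hx; split => //; apply: hpow_all.
Qed.

Lemma topologically_free_tensor_power P : topologically_free (tensor_power U P).
Proof. by elim: P => //= P freeP Q freeQ; apply: topologically_free_ctensor. Qed.

Lemma eps1 : eps 1 = 1 :> R.
Proof. exact: rmorph1. Qed.

Lemma delta_1 P : delta P 1 = 0.
Proof.
case: P => [|P Q] /=; first by rewrite /delta1 eps1 scale1r subrr.
rewrite /delta2 rmorph1 eps1 scale1r.
have -> : (1 : ctensor U U) = cpure 1 1 by apply: invlim_eq.
by rewrite subrr sub0r addNr linear0.
Qed.

Lemma cpure0l (M N : lmodType R) (y : N) : cpure (0 : M) y = 0.
Proof. by apply: invlim_eq => n; rewrite /= pure0l raddf0. Qed.
Lemma cpure0r (M N : lmodType R) (x : M) : cpure x (0 : N) = 0.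
Proof. by apply: invlim_eq => n; rewrite /= pure0r raddf0. Qed.

(** The correction terms of [delta2] have a factor 1, which [delta P] or [delta Q] kills. *)
Lemma delta_Node P Q x :
  delta (Node P Q) x = ctensor_map (delta P) (delta Q) (Delta x).
Proof.
rewrite /= /delta2 linearD !linearB linearZ_LR /= !ctensor_map_cpure !delta_1.
by rewrite cpure0r !cpure0l scaler0 !subr0 addr0.
Qed.

(* [None] is the tree without leaves, whose delta is the counit. *)
Let index := option ptree.
Let target (i : index) : lmodType R := if i is Some P then tensor_power U P else R^o.
Let family (i : index) : {linear U -> target i} :=
  match i return {linear U -> target i} with Some P => delta P | None => eps end.
Let size (i : index) : nat := if i is Some P then leaves P else 0%N.

Let free_target i : topologically_free (target i).
Proof.
case: i => [P|]; first exact: topologically_free_tensor_power.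
exact/hregular_topologically_free/hregular_regular.
Qed.

(** The leaf and the counit suffice, since x is the sum of [delta1 eps x] and the scalar [eps x]. *)
Let family_sat q x : (forall i, hpow (size i + q) (family i x)) -> hpow q x.
Proof.
move=> Hx; have /= Hx0 := Hx None; have /= Hx1 := Hx (Some Leaf).
rewrite -(subrK ((eps x : R) *: 1) x); apply: hpowD; last exact: hpow_scale.
exact: hpow_le (leq_addl 1 q) Hx1.
Qed.

Let quantum_dual_set x : x \in qd <-> dual_set family size x.
Proof.
split=> [/quantum_dualP Hx [P|] /=|Hx]; [exact: Hx|exact: hpow_all|].
by apply/quantum_dualP => P; apply: (Hx (Some P)).
Qed.

Lemma quantum_dual_div q x : hpow q (eps x) ->
  (forall P, hpow (leaves P + q) (delta P x)) ->
  exists2 y, y \in qd & x = hbar ^+ q *: y.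
Proof.
move=> Heps Hdelta; have [|y Sy ->] := @dual_set_div _ _ _ _ _ _ free_target family_sat q x.
  by case.
by exists y => //; apply/quantum_dual_set.
Qed.

Lemma quantum_dual_Delta x : x \in qd -> forall m,
  exists2 s, forall p, p \in s -> p.1 \in qd /\ p.2 \in qd &
    Delta x m = cls (hadic (tensor U U) m) (tcls s).
Proof.
move=> /quantum_dualP Hx m.
have [|s Ss ->] := @dual_tensor _ _ _ _ _ _ freeU free_target family_sat (Delta x) _ m.
  have freeR := free_target None; have regR := hregular_fps K^o.
  case=> [P|] [Q|] /=.
  - by rewrite -delta_Node; exact: (Hx (Node P Q)).
  - have -> : ctensor_map (delta P) eps (Delta x) =
        ctensor_map (delta P) (idfun : {linear R^o -> R^o})
          (ctensor_map (idfun : {linear U -> U}) eps (Delta x)).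
      apply: (ctensor_linear_ext freeU freeU
        (hregular_ctensor (topologically_free_tensor_power P) freeR)
        (F := ctensor_map (delta P) eps)
        (G := ctensor_map (delta P) idfun \o ctensor_map idfun eps)) => y z /=.
      by rewrite !ctensor_map_cpure.
    rewrite (heps x).2 ctensor_map_cpure /= addn0.
    by rewrite -to_ctensor_pure; apply/hpow_linear/hpow_purel/Hx.
  - have -> : ctensor_map eps (delta Q) (Delta x) =
        ctensor_map (idfun : {linear R^o -> R^o}) (delta Q)
          (ctensor_map eps (idfun : {linear U -> U}) (Delta x)).
      apply: (ctensor_linear_ext freeU freeU
        (hregular_ctensor freeR (topologically_free_tensor_power Q))
        (F := ctensor_map eps (delta Q))
        (G := ctensor_map idfun (delta Q) \o ctensor_map eps idfun)) => y z /=.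
      by rewrite !ctensor_map_cpure.
    rewrite (heps x).1 ctensor_map_cpure /= add0n.
    by rewrite -to_ctensor_pure; apply/hpow_linear/hpow_purer/Hx.
  - exact: hpow_all.
by exists s => // p /Ss[/quantum_dual_set Sp1 /quantum_dual_set Sp2].
Qed.

Lemma tcls_mul (s r : seq (U * U)) :
  tcls s * tcls r = \sum_(p <- s) \sum_(q <- r) pure (p.1 * q.1) (p.2 * q.2).
Proof.
rewrite !tclsE big_distrl /=; apply: eq_bigr => p _.
by rewrite big_distrr /=; apply: eq_bigr => q _; rewrite pureM.
Qed.

Lemma hpow_delta_Node P Q x m t :
  Delta x m = cls (hadic (tensor U U) m) t ->
  hpow m (tensor_map (delta P) (delta Q) t) -> hpow m (delta (Node P Q) x).
Proof.
move=> xt Ht; rewrite delta_Node.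
have freeP := topologically_free_tensor_power.
apply: (ctensor_proj_hpow (freeP P) (freeP Q)).
by rewrite [LHS](invlim_mapE _ xt); apply/cls0P.
Qed.

Lemma hpow_pure (M N : lmodType R) i j (x : M) (y : N) :
  hpow i x -> hpow j y -> hpow (i + j) (pure x y).
Proof.
by move=> [x' ->] [y' ->]; exists (pure x' y'); rewrite pureZl pureZr scalerA exprD.
Qed.

Lemma delta_LeafK x : delta Leaf x + (eps x : R) *: 1 = x.
Proof. by rewrite /= /delta1 subrK. Qed.

Lemma epsM x y : eps (x * y) = (eps x : R) * (eps y : R).
Proof. exact: rmorphM. Qed.

(** The induction on P is for all x and y at once, because at a node it is applied to the tensor
    factors of [Delta x] and [Delta y]. *)
Lemma quantum_dualM x y : x \in qd -> y \in qd -> x * y \in qd.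
Proof.
move=> Sx Sy; apply/quantum_dualP => P.
elim: P x y Sx Sy => [|P IHP Q IHQ] x y Sx Sy.
  have /quantum_dualP/(_ Leaf)/= Hx := Sx; have /quantum_dualP/(_ Leaf)/= Hy := Sy.
  have -> : delta Leaf (x * y) = delta1 eps x * y + (eps x : R) *: delta1 eps y.
    rewrite /= /delta1 epsM -scalerA mulrBl scalerBr -scalerAl mul1r addrA subrK.
    by [].
  apply: hpowD; last exact: hpowZ.
  by have [u ->] := Hx; exists (u * y); rewrite -scalerAl.
set m := leaves (Node P Q).
have [s Ss xs] := quantum_dual_Delta Sx m; have [r Sr yr] := quantum_dual_Delta Sy m.
apply: (@hpow_delta_Node _ _ _ _ (tcls s * tcls r)).
  by rewrite rmorphM; apply: ctensor_projM.
rewrite tcls_mul big_seq linear_sum; apply: hpow_sum => p /Ss[Sp1 Sp2].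
rewrite big_seq linear_sum; apply: hpow_sum => q /Sr[Sq1 Sq2].
by rewrite /= tensor_map_pure; apply: hpow_pure; [apply: IHP|apply: IHQ].
Qed.

Lemma quantum_dual_commutator x y : x \in qd -> y \in qd ->
  exists2 z, z \in qd & x * y - y * x = hbar *: z.
Proof.
move=> Sx Sy; rewrite -[hbar]expr1; apply: quantum_dual_div.
  by rewrite raddfB /= !epsM mulrC subrr; apply: hpow_0.
move=> P; elim: P x y Sx Sy => [|P IHP Q IHQ] x y Sx Sy.
  (* Scalars are central, so x and y may be replaced by their images under [delta1], both divisible
     by hbar. *)
  have shift (u w : U) (a : R) : (u + a *: 1) * w - w * (u + a *: 1) = u * w - w * u.
    rewrite mulrDl mulrDr -scalerAl -scalerAr mul1r mulr1 opprD addrACA.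
    by rewrite subrr addr0.
  have /quantum_dualP/(_ Leaf)[u Eu] := Sx; have /quantum_dualP/(_ Leaf)[v Ev] := Sy.
  suff -> : x * y - y * x = hbar ^+ 2 *: (u * v - v * u).
    exact/hpow_linear/hpow_hbarX.
  rewrite -{1 2}(delta_LeafK x) -{1 2}(delta_LeafK y) shift -opprB shift opprB Eu Ev.
  by rewrite -!scalerAl -!scalerAr !scalerA -scalerBr -exprD.
(* One level more than for products, since an additional power of hbar is claimed. *)
set m := (leaves (Node P Q) + 1)%N.
have [s Ss xs] := quantum_dual_Delta Sx m; have [r Sr yr] := quantum_dual_Delta Sy m.
apply: (@hpow_delta_Node _ _ _ _ (tcls s * tcls r - tcls r * tcls s)).
  transitivity ((Delta x * Delta y) m - (Delta y * Delta x) m).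
    by rewrite rmorphB !rmorphM.
  by rewrite raddfB; congr (_ - _); apply: ctensor_projM.
rewrite !tcls_mul [X in _ - X]exchange_big -sumrB big_seq linear_sum.
apply: hpow_sum => p /Ss[Sp1 Sp2].
rewrite -sumrB big_seq linear_sum; apply: hpow_sum => q /Sr[Sq1 Sq2].
(* In each term one factor is a commutator and gains a power of hbar, the other is a product in U'
   and loses nothing. *)
have -> : pure (p.1 * q.1) (p.2 * q.2) - pure (q.1 * p.1) (q.2 * p.2) =
    pure (p.1 * q.1 - q.1 * p.1) (p.2 * q.2) +
    pure (q.1 * p.1) (p.2 * q.2 - q.2 * p.2).
  by rewrite pureBl pureBr addrA subrK.
rewrite linearD /= !tensor_map_pure; apply: hpowD.
  rewrite /m /= addnAC; apply: hpow_pure.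
    by apply: IHP.
  by apply/quantum_dualP/quantum_dualM.
rewrite /m /= -addnA; apply: hpow_pure; last exact: IHQ.
by apply/quantum_dualP/quantum_dualM.
Qed.

End QuantumDualProduct.

(** * The completed tensor square of a subalgebra *)

Section RMorphismOf.
Variables (A B : pzRingType) (f : A -> B).

Definition rmorphism_of of zmod_morphism f & monoid_morphism f : A -> B := f.
HB.instance Definition _ (fa : zmod_morphism f) (fm : monoid_morphism f) :=
  GRing.isZmodMorphism.Build A B (rmorphism_of fa fm) fa.
HB.instance Definition _ (fa : zmod_morphism f) (fm : monoid_morphism f) :=
  GRing.isMonoidMorphism.Build A B (rmorphism_of fa fm) fm.

End RMorphismOf.

Lemma linear_hbar_div (K : fieldType) (M : lmodType (fps K)) k
    (g : {linear M -> (fps K)^o}) : (forall x, hpow k (g x)) ->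
  exists h : {linear M -> (fps K)^o}, forall x, g x = hbar ^+ k *: h x.
Proof.
move=> /choice[h hE].
have h_lin : linear h.
  move=> c x y; apply: (hbarX_inj (hregular_regular K) (n := k)).
  by rewrite -hE linearP !hE scalerDr !scalerA mulrC.
by exists (linear_of h_lin).
Qed.

(** The product comes from the limit along [ctensor_filt_ring] while classes are taken along
    [ctensor_filt_mod]; both filtrations have the same subgroups. *)
Lemma bar_ctensor_projM (K : fieldType) (A : algType (fps K)) (F : alg_filtration A)
    (z w : bar_ctensor F) n z' w' :
  z n = cls (ctensor_filt_mod F n) z' -> w n = cls (ctensor_filt_mod F n) w' ->
  (z * w) n = cls (ctensor_filt_mod F n) (z' * w').
Proof.
have H (x y : invlim (ctensor_filt_ring F)) :
    x n = cls (ctensor_filt_ring F n) z' -> y n = cls (ctensor_filt_ring F n) w' ->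
    (x * y) n = cls (ctensor_filt_ring F n) (z' * w').
  by move=> xE yE; rewrite rmorphM projM xE yE.
exact: H.
Qed.

Section SubalgebraTensor.
Variables (K : fieldType) (U : algType (fps K)) (S : {pred U}).
Local Notation R := (fps K).
Hypotheses (freeU : topologically_free U) (hS : GRing.subalg_closed S).
Local Notation U' := (subalg hS).
Local Notation F := (subalg_filt hS).
Local Notation iota := (\val : {linear U' -> U}).

Lemma subalg_filt_hbar n (x : U') k : F k x -> F (n + k) (hbar ^+ n *: x).
Proof. by move=> Fx; rewrite /= /subalg_filt_set linearZ_LR /=; apply: hpow_mul. Qed.

(** The vectors u_a = hbar^(d a) sigma_a form a topological basis of U' for the filtration, with
    coordinates those of U divided by hbar^(d a). Depth [None] contributes zero data. *)
Lemma filtered_coordinates : exists (I : eqType) (sigma : I -> U)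
    (co : I -> {linear U -> R^o}) (u : I -> U') (e : I -> nat)
    (co' : I -> {linear U' -> R^o}),
  [/\ forall a, F (e a) (u a), forall a x, co a (val x) = hbar ^+ e a *: co' a x &
      forall x n, for_large (fun s => F n (x - \sum_(a <- s) (co' a x : R) *: u a))].
Proof.
have [||I [sigma [co [d [Hco Hd Hsigma]]]]] :=
    @adapted_hbar_coordinates _ _ (fun x => x \in subalg_pred hS) freeU.
- exact: rpred0.
- by move=> c x y Sx Sy; apply: rpredD => //; apply: rpredZ.
have /choice[w Hw] a : exists w : U' * nat * {linear U' -> R^o},
    [/\ F w.1.2 w.1.1, forall x, co a (val x) = hbar ^+ w.1.2 *: w.2 x &
        forall x, (co a (val x) : R) *: sigma a = (w.2 x : R) *: val w.1.1].
  case da: (d a) => [k|].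
    have Sk : hbar ^+ k *: sigma a \in subalg_pred hS by apply: Hsigma.
    have [|h hE] := @linear_hbar_div K U' k (co a \o iota).
      by move=> x; have := Hd _ a (valP x); rewrite da.
    exists (Sub (hbar ^+ k *: sigma a) Sk, k, h); split=> /= [|x|x].
    - exact: hpow_hbarX.
    - exact: hE.
    - by have /= -> := hE x; rewrite scalerA mulrC.
  have co0 x : co a (val (x : U')) = 0 by have := Hd _ a (valP x); rewrite da.
  exists (0, 0%N, \0 : {linear U' -> R^o}); split=> /= [|x|x].
  - by exists (val (0 : U')); rewrite expr0 scale1r.
  - by rewrite co0 scaler0.
  - by rewrite co0 !scale0r.
exists I, sigma, co, (fun a => (w a).1.1), (fun a => (w a).1.2), (fun a => (w a).2).
split=> [a|a x|x n].
- by have [] := Hw a.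
- by have [_ ->] := Hw a.
- apply: for_large_imp (Hco (val x) n) => s Hs.
  have FE y : hpow n (iota y) -> F n y by [].
  apply: FE; rewrite linearB linear_sum; move: Hs.
  congr hpow; congr (_ - _); apply: eq_bigr => a _.
  by rewrite linearZ_LR; have [_ _ ->] := Hw a.
Qed.

Lemma tensor_filt_le (A : algType R) (G : alg_filtration A) m n t :
  (m <= n)%N -> tensor_filt G n t -> tensor_filt G m t.
Proof.
move=> /subnKC <-; elim: (n - m)%N => [|k IHk]; first by rewrite addn0.
rewrite addnS => /(tensor_filt_decr (fun i x => @alg_filtrationS _ G i x)).
exact: IHk.
Qed.

(* The natural map [gr U' (x) gr U' -> gr (U (x) U)] is injective. *)
Lemma tensor_filt_val n (t : tensor U' U') :
  hpow n (tensor_map iota iota t) -> tensor_filt F n t.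
Proof.
move=> Ht; have [I [sigma [co [u [e [co' [Fu coE Hco']]]]]]] := filtered_coordinates.
have FD v w : tensor_filt F n v -> tensor_filt F n w -> tensor_filt F n (v + w).
  exact: tensor_filtD.
have F0 := tensor_filt0 F n.
have [||s [s' Hs]] := @tensor_expand R U' U' I I u co' u co' (F n) (F n)
    (tensor_filt F n) F0 FD _ _ (Hco'^~ n) (Hco'^~ n) t.
- move=> x y Fx; rewrite -[n]addn0; apply: tensor_filt_pure => //.
  exact: alg_filtration0.
- move=> x y Fy; rewrite -[n]add0n; apply: tensor_filt_pure => //.
  exact: alg_filtration0.
rewrite -[t](subrK (\sum_(a <- s) \sum_(b <- s')
  (cotensor (co' a) (co' b) t : R) *: pure (u a) (u b))).
apply: (FD) => //; apply: (big_ind (tensor_filt F n) F0 FD) => a _.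
apply: (big_ind (tensor_filt F n) F0 FD) => b _.
have FZ (c : R) m v : tensor_filt F m v -> tensor_filt F m (c *: v).
  by apply: tensor_filtZ => i x; apply: alg_filtrationZ.
have Fab : tensor_filt F (e a + e b) (pure (u a) (u b)) by apply: tensor_filt_pure.
case: (leqP n (e a + e b)) => [le_n|/ltnW le_e].
  by apply: FZ; apply: tensor_filt_le Fab.
(* The pure tensor has degree e a + e b only; the missing degree comes from the coefficient, whose
   product with hbar^(e a + e b) is a coordinate in U (x) U and hence divisible by hbar^n. *)
have [c ->] : hpow (n - (e a + e b)) (cotensor (co' a) (co' b) t).
  apply: (hpow_div (hregular_regular K) (m := e a + e b)); rewrite subnKC //.
  have -> v : hbar ^+ (e a + e b) *: cotensor (co' a) (co' b) v =
      cotensor (co a) (co b) (tensor_map iota iota v).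
    elim/tensor_ind: v => [x y||v w IH IH'].
    - rewrite tensor_map_pure !cotensor_pure /= !coE exprD.
      exact: mulrACA.
    - by rewrite !linear0.
    - by rewrite (linearD (cotensor (co' a) (co' b))) scalerDr IH IH' -!linearD.
  exact: hpow_linear.
rewrite -scalerA scalerA mulrC -scalerA; apply: FZ.
rewrite -pureZl -[X in tensor_filt F X](subnK le_e) addnA.
apply: tensor_filt_pure => //; exact: subalg_filt_hbar.
Qed.

Lemma bar_ctensor_valE (z : bar_ctensor F) n w :
  z n = cls (ctensor_filt_mod F n) w ->
  bar_ctensor_val z n = ctensor_map iota iota w n.
Proof.
move=> zw; rewrite -[LHS]/(ctensor_map iota iota (rep (z n)) n).
apply/eqP; rewrite -subr_eq0 -projB -linearB; apply/eqP.
apply: ctensor_val_filt.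
by apply/(@cls_eq _ (ctensor_filt_mod F n)); rewrite repK.
Qed.

Lemma bar_ctensor_val_proj0 (z : bar_ctensor F) n :
  bar_ctensor_val z n = 0 -> z n = 0.
Proof.
move=> zn; rewrite -(repK (z n)); apply/cls0P => k.
(* The filtration asks for a representative at every hbar-adic level k, whereas [tensor_filt_val]
   has information only on one valid at level n; level m serves both. *)
set w := rep (z n); set m := maxn k n.
have {}zn : ctensor_map iota iota w n = 0 by [].
have wm : w m = cls (hadic (tensor U' U') m) (rep (w m)) by rewrite repK.
exists (rep (w m)); last by apply: ctensor_proj_le wm; apply: leq_maxl.
have wn := ctensor_proj_le (leq_maxr k n) wm.
apply: tensor_filt_val; apply/(@cls0P _ (hadic (tensor U U) n)); rewrite -[RHS]zn.
by rewrite [RHS](invlim_mapE _ wn).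
Qed.

Lemma bar_ctensor_val_linear : linear (@bar_ctensor_val _ _ _ hS).
Proof.
move=> c z w; apply: invlim_eq => n.
rewrite (@bar_ctensor_valE _ _ (c *: rep (z n) + rep (w n))) ?linearP //.
by rewrite projD projZ raddfD /= (clsZ (ctensor_filt_mod F n)) !repK.
Qed.

(** Through this, linearity and multiplicativity of the lifted coproduct are inherited from
    [Delta]. *)
Lemma bar_ctensor_val_inj : injective (@bar_ctensor_val _ _ _ hS).
Proof.
move=> z w zw; apply/eqP; rewrite -subr_eq0; apply/eqP.
apply: invlim_eq => n; apply: bar_ctensor_val_proj0.
by rewrite (zmod_morphism_linear bar_ctensor_val_linear) zw subrr.
Qed.

Lemma tensor_map_valM (t u : tensor U' U') :
  tensor_map iota iota (t * u) = tensor_map iota iota t * tensor_map iota iota u.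
Proof.
elim/tensor_ind: t => [x y||t t' IH IH']; last 2 first.
- by rewrite mul0r linear0 mul0r.
- by rewrite mulrDl !linearD /= IH IH' mulrDl.
elim/tensor_ind: u => [x' y'||u u' IH IH']; last 2 first.
- by rewrite mulr0 linear0 mulr0.
- by rewrite mulrDr !linearD /= IH IH' mulrDr.
by rewrite pureM !tensor_map_pure pureM.
Qed.

Lemma bar_ctensor_val1 : bar_ctensor_val (1 : bar_ctensor F) = 1.
Proof.
apply: invlim_eq => n; rewrite (@bar_ctensor_valE _ _ 1) //.
by rewrite [LHS](invlim_mapE _ (ctensor_proj1 U' n)) [X in cls _ X]tensor_map_pure.
Qed.

Lemma bar_ctensor_valM (z w : bar_ctensor F) :
  bar_ctensor_val (z * w) = bar_ctensor_val z * bar_ctensor_val w.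
Proof.
apply: invlim_eq => n; set z' := rep (z n); set w' := rep (w n).
have zwE : (z * w) n = cls (ctensor_filt_mod F n) (z' * w').
  by apply: bar_ctensor_projM; rewrite repK.
rewrite (bar_ctensor_valE zwE).
have zt : z' n = cls (hadic (tensor U' U') n) (rep (z' n)) by rewrite repK.
have wt : w' n = cls (hadic (tensor U' U') n) (rep (w' n)) by rewrite repK.
have map_proj (v : ctensor U' U') t : v n = cls (hadic (tensor U' U') n) t ->
    ctensor_map iota iota v n = cls (hadic (tensor U U) n) (tensor_map iota iota t).
  by move=> vt; rewrite [LHS](invlim_mapE _ vt).
rewrite (map_proj _ _ (ctensor_projM zt wt)) tensor_map_valM.
by apply/esym/ctensor_projM; apply: map_proj.
Qed.

(** The lifts at successive levels are chosen independently; they are compatible because a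
    difference mapped into hbar^n lies in the n-th term of the filtration. *)
Lemma bar_ctensor_val_surj (z : ctensor U U) :
  (forall n, exists t, z n = cls (hadic (tensor U U) n) (tensor_map iota iota t)) ->
  exists w : bar_ctensor F, bar_ctensor_val w = z.
Proof.
move=> /choice[t zt].
have wcompat n : cls (ctensor_filt_mod F n)
    (rep (cls (ctensor_filt_mod F n.+1) (to_ctensor U' U' (t n.+1)))) =
    cls (ctensor_filt_mod F n) (to_ctensor U' U' (t n)).
  rewrite (to_invlim_compat (ctensor_filt_mod F)); apply/cls_eq; rewrite -linearB => k.
  exists (t n.+1 - t n) => //; apply: tensor_filt_val; rewrite linearB.
  apply/(@cls_eq _ (hadic (tensor U U) n)); rewrite -zt.
  by apply/esym; apply: ctensor_proj_le (zt n.+1).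
exists (@InvLim _ (ctensor_filt_mod F) _ wcompat); apply: invlim_eq => n.
rewrite (@bar_ctensor_valE _ _ (to_ctensor U' U' (t n))) // zt.
by rewrite [LHS](invlim_mapE _ (to_ctensorE (t n) n)).
Qed.

End SubalgebraTensor.

(** * Reduction modulo hbar *)

Section ReductionMorphism.
Variables (K : fieldType) (A : algType (fps K)) (F : alg_filtration A).

Lemma red_tensor_pureM (x x' y y' : red A) :
  (pure x y : red_tensor A) * pure x' y' = pure (x * x') (y * y').
Proof. exact: (tensor_mul_pure (red_is_alg_mul A) (red_is_alg_mul A)). Qed.

Lemma tensor_redM (t u : tensor A A) : tensor_red (t * u) = tensor_red t * tensor_red u.
Proof.
elim/tensor_ind: t => [x y||t t' IH IH']; last 2 first.
- by rewrite mul0r raddf0 mul0r.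
- by rewrite mulrDl !raddfD /= IH IH' mulrDl.
elim/tensor_ind: u => [x' y'||u u' IH IH']; last 2 first.
- by rewrite mulr0 raddf0 mulr0.
- by rewrite mulrDr !raddfD /= IH IH' mulrDr.
by rewrite pureM !tensor_red_pure red_tensor_pureM !rmorphM.
Qed.

Lemma ctensor_redM (z w : ctensor A A) : ctensor_red (z * w) = ctensor_red z * ctensor_red w.
Proof.
have zt : z 1%N = cls (hadic (tensor A A) 1) (rep (z 1%N)) by rewrite repK.
have wt : w 1%N = cls (hadic (tensor A A) 1) (rep (w 1%N)) by rewrite repK.
by rewrite (ctensor_redE (ctensor_projM zt wt)) tensor_redM.
Qed.

Lemma ctensor_red1 : ctensor_red (1 : ctensor A A) = 1.
Proof.
by rewrite (ctensor_redE (ctensor_proj1 A 1)) tensor_red_pure rmorph1.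
Qed.

Lemma ctensor_red_hbar (z : ctensor A A) : ctensor_red (hbar *: z) = 0.
Proof.
have E : (hbar *: z) 1%N = cls (hadic (tensor A A) 1) (hbar *: rep (z 1%N)).
  by rewrite projZ (clsZ (hpow_mod (tensor A A) 1)) repK.
by rewrite (ctensor_redE E); apply: tensor_red_hbar; exists (rep (z 1%N)).
Qed.

Lemma bar_ctensor_redE (z : bar_ctensor F) n w :
  z n = cls (ctensor_filt_mod F n) w ->
  bar_ctensor_red z n = cls (red_tensor_filt (red_filt F) n) (ctensor_red w).
Proof. by move=> zw; rewrite [LHS](invlim_mapE _ zw). Qed.

Lemma bar_ctensor_redB : zmod_morphism (@bar_ctensor_red _ _ F).
Proof. exact: invlim_map_is_zmod_morphism. Qed.

Lemma bar_ctensor_redM (z w : bar_ctensor F) :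
  bar_ctensor_red (z * w) = bar_ctensor_red z * bar_ctensor_red w.
Proof.
apply: invlim_eq => n.
have zE : z n = cls (ctensor_filt_mod F n) (rep (z n)) by rewrite repK.
have wE : w n = cls (ctensor_filt_mod F n) (rep (w n)) by rewrite repK.
rewrite (bar_ctensor_redE (bar_ctensor_projM zE wE)) ctensor_redM.
by rewrite rmorphM [RHS]projM (bar_ctensor_redE zE) (bar_ctensor_redE wE).
Qed.

Lemma bar_ctensor_red1 : bar_ctensor_red (1 : bar_ctensor F) = 1.
Proof.
apply: invlim_eq => n; rewrite (@bar_ctensor_redE _ _ 1) // ctensor_red1.
exact: rmorph1.
Qed.

Lemma bar_ctensor_red_hbar (z : bar_ctensor F) : bar_ctensor_red (hbar *: z) = 0.
Proof.
apply: invlim_eq => n; rewrite (@bar_ctensor_redE _ _ (hbar *: rep (z n))).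
  by rewrite ctensor_red_hbar raddf0.
by rewrite projZ (clsZ (ctensor_filt_mod F n)) repK.
Qed.

End ReductionMorphism.

Section BarMorphism.
Variables (K : fieldType) (A : algType (fps K)) (F : alg_filtration A).
Variable f : A -> bar_ctensor F.

Definition lrmorphism_of of linear f & monoid_morphism f : A -> bar_ctensor F := f.
HB.instance Definition _ (fl : linear f) (fm : monoid_morphism f) :=
  GRing.isLinear.Build (fps K) A (bar_ctensor F) *:%R (lrmorphism_of fl fm) fl.
HB.instance Definition _ (fl : linear f) (fm : monoid_morphism f) :=
  GRing.isMonoidMorphism.Build A (bar_ctensor F) (lrmorphism_of fl fm) fm.

End BarMorphism.

Lemma complete_filtration_seq (A : zmodType) (F : nat -> subgroup A) :
  (forall x, (forall n, F n x) -> x = 0) ->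
  (forall u : nat -> A, (forall n, F n (u n.+1 - u n)) ->
    exists l, forall n, F n (l - u n)) ->
  complete_filtration F.
Proof.
move=> F_sep F_compl; split=> // u /choice[N HN].
(* Partial sums turn the moduli into a nondecreasing sequence, so consecutive terms of the
   subsequence are close. *)
pose m n := (\sum_(k < n.+1) N k)%N.
have Nm n : (N n <= m n)%N by rewrite /m big_ord_recr leq_addl.
have mS n : (m n <= m n.+1)%N by rewrite {2}/m big_ord_recr leq_addr.
have [n|l Hl] := F_compl (fun n => u (m n)).
  by apply: HN => //; apply: leq_trans (mS n).
exists l => n; exists (m n) => p mp; rewrite -(subrKA (u (m n))).
apply: subD; last by apply: Defs.subC; apply: Hl.
by apply: HN => //; apply: leq_trans mp.
Qed.

(** * The filtered algebra and its coproduct *)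

Section QuantumDual.
Variables (K : fieldType) (U : algType (fps K)).
Local Notation R := (fps K).
Hypothesis freeU : topologically_free U.
Variables (Delta : {lrmorphism U -> ctensor U U}) (eps : {lrmorphism U -> R^o}).
Hypothesis heps : counital Delta eps.
Local Notation delta := (delta Delta eps).
Local Notation qd := (quantum_dual Delta eps).

Lemma quantum_dual_subalg : GRing.subalg_closed qd.
Proof.
split=> [|c x y /quantum_dualP Sx /quantum_dualP Sy|x y Sx Sy].
- by apply/quantum_dualP => P; rewrite delta_1; apply: hpow_0.
- by apply/quantum_dualP => P; rewrite linearP; apply: hpowD; first apply: hpowZ.
- exact: quantum_dualM.
Qed.

Variable hS : GRing.subalg_closed qd.
Local Notation U' := (subalg hS).
Local Notation F := (subalg_filt hS).
Local Notation iota := (\val : {linear U' -> U}).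

Lemma quantum_dual_sub y : y \in qd -> exists x : U', val x = y.
Proof. by move=> Sy; exists (Sub y (Sy : y \in subalg_pred hS)). Qed.

Lemma quantum_dual_valP (x : U') P : hpow (leaves P) (delta P (val x)).
Proof. by apply/quantum_dualP; apply: (valP x). Qed.

(** U' is hbar-adically closed in U: the condition for P sees only the class modulo hbar^|P|. *)
Lemma quantum_dual_limit (u : nat -> U') l :
  (forall n, hpow n (l - val (u n))) -> l \in qd.
Proof.
move=> Hl; apply/quantum_dualP => P; rewrite -[l](subrK (val (u (leaves P)))).
by rewrite linearD; apply: hpowD; [apply: hpow_linear|apply: quantum_dual_valP].
Qed.

Lemma quantum_dual_filt_seq (u : nat -> U') : (forall n, F n (u n.+1 - u n)) ->
  exists l, forall n, F n (l - u n).
Proof.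
move=> Fu; have [|l Hl] := hbar_cauchy (topologically_free_hregular freeU) (u := iota \o u).
  move=> n; have Fn : hpow n (iota (u n.+1 - u n)) by apply: Fu.
  by rewrite linearB in Fn.
have [l' l'E] := quantum_dual_sub (quantum_dual_limit Hl); exists l' => n.
suff : hpow n (iota (l' - u n)) by [].
by rewrite linearB /= l'E; apply: Hl.
Qed.

Lemma quantum_dual_filt_separated (x : U') : (forall n, F n x) -> x = 0.
Proof.
move=> Fx; apply: val_inj; rewrite raddf0.
by apply: (hbar_separated (topologically_free_hregular freeU)) => n; apply: Fx.
Qed.

Lemma quantum_dual_complete : complete_filtration F.
Proof.
apply: complete_filtration_seq; [exact: quantum_dual_filt_separated|].
exact: quantum_dual_filt_seq.
Qed.

Lemma hpow_sub_filt (x : U') n : hpow n x -> F n x.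
Proof. by move=> Hx; suff : hpow n (iota x) by []; apply: hpow_linear. Qed.

Lemma hregular_quantum_dual : hregular U'.
Proof.
split=> [x x0|x x0|u].
- apply: val_inj; rewrite raddf0; apply: (hbar_tf (topologically_free_hregular freeU)).
  by rewrite -(linearZ_LR iota) x0 raddf0.
- by apply: quantum_dual_filt_separated => n; apply: hpow_sub_filt.
- have [n|l Hl] := @quantum_dual_filt_seq (fun n => \sum_(k < n) hbar ^+ k *: u k).
    by apply: hpow_sub_filt; rewrite big_ord_recr addrC addKr; apply: hpow_hbarX.
  (* The limit l is controlled modulo hbar^n U, but hbar^n U' is required. The tail of the series
     divided by hbar^n is therefore summed separately in U', and its sum m is the quotient. *)
  exists l => n; have [m|m Hm] := @quantum_dual_filt_seq
      (fun m => \sum_(k < m) hbar ^+ k *: u (n + k)%N).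
    by apply: hpow_sub_filt; rewrite big_ord_recr addrC addKr; apply: hpow_hbarX.
  exists m; apply/eqP; rewrite -subr_eq0; apply/eqP.
  apply: quantum_dual_filt_separated => k.
  have Fnk : F k (l - \sum_(i < n + k) hbar ^+ i *: u i).
    by apply: hpow_le (Hl (n + k)%N); apply: leq_addl.
  have Fk : F k (hbar ^+ n *: (m - \sum_(i < k) hbar ^+ i *: u (n + i)%N)).
    by apply: alg_filtrationZ; apply: Hm.
  rewrite (_ : _ - _ = l - \sum_(i < n + k) hbar ^+ i *: u i -
      hbar ^+ n *: (m - \sum_(i < k) hbar ^+ i *: u (n + i)%N)); first exact: subB.
  rewrite big_split_ord /= scalerBr scaler_sumr.
  under [X in _ - (_ - X)]eq_bigr do rewrite scalerA -exprD.
  by rewrite opprB addrA opprD addrA subrK.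
Qed.

(** * Commutativity, locality and completeness of the reduction *)

Lemma quantum_dual_red_comm (q r : red U') : q * r = r * q.
Proof.
rewrite -(red_repK q) -(red_repK r) -!rmorphM /=; apply/cls_eq.
have [z Sz] := quantum_dual_commutator freeU heps (valP (rep q)) (valP (rep r)).
have [z' <-] := quantum_dual_sub Sz => E.
by exists z'; apply: val_inj; rewrite expr1.
Qed.

(** The character of U'/hbar U' induced by the counit; its kernel is the maximal ideal. *)
Definition residue_eps (q : red U') : K := (eps (val (rep q)) : R) 0%N.

Lemma residue_epsE (x : U') : residue_eps (red_cls x) = (eps (val x) : R) 0%N.
Proof.
have [y Ey] := rep_cls (hideal U' 1) x.
rewrite /residue_eps (_ : rep _ = hbar *: y + x); last by rewrite -[hbar]expr1 -Ey subrK.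
rewrite (linearD iota) linearD (linearZ_LR iota) linearZ_LR fpsDE.
by rewrite [X in X + _]hbar_mulE add0r.
Qed.

Lemma residue_epsM q r : residue_eps (q * r) = residue_eps q * residue_eps r.
Proof.
rewrite -(red_repK q) -(red_repK r) -rmorphM !residue_epsE.
rewrite -[LHS]/((eps (val (rep q) * val (rep r)) : R) 0%N) epsM fpsME.
by rewrite big_ord1.
Qed.

Lemma residue_epsB q r : residue_eps (q - r) = residue_eps q - residue_eps r.
Proof.
by rewrite -(red_repK q) -(red_repK r) -raddfB !residue_epsE (linearB iota) linearB.
Qed.

Lemma residue_eps1 : residue_eps 1 = 1.
Proof.
rewrite -[1](rmorph1 (@red_cls K U')) residue_epsE.
by rewrite -[LHS]/((eps 1 : R) 0%N) eps1.
Qed.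

Lemma residue_eps_unit q : residue_eps q != 0 -> exists r, q * r = 1.
Proof.
rewrite -(red_repK q) residue_epsE; set x := rep q; set a := _ 0%N => a0.
(* Both [delta1 eps y] and [eps y] are divisible by hbar, so y is in the first term of the
   filtration and the geometric series inverts 1 - y, which is x divided by a. *)
pose y := 1 - fpsC a^-1 *: x.
have Fy : F 1 y.
  suff : hpow 1 (iota y) by [].
  rewrite -(delta_LeafK Delta eps (iota y)); apply: hpowD.
    exact: (quantum_dual_valP y Leaf).
  apply: hpow_scale; apply/hpow_regP => -[|//] _.
  have -> : eps (iota y) = (eps 1 : R) - fpsC a^-1 * (eps (val x) : R) :> R.
    by rewrite (linearB iota) linearB (linearZ_LR iota) linearZ_LR.
  by rewrite eps1 fpsDE fpsNE fpsME big_ord1 /= -/a mulVf // fps1E subrr.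
have FX n : F n (y ^+ n).
  elim: n => [|n IHn]; first exact: alg_filtration0.
  by rewrite exprS -add1n; apply: alg_filtrationM.
have [n|l Hl] := @quantum_dual_filt_seq (fun n => \sum_(k < n) y ^+ k).
  by rewrite big_ord_recr addrC addKr; apply: FX.
have yl : (1 - y) * l = 1.
  apply/eqP; rewrite -subr_eq0; apply/eqP; apply: quantum_dual_filt_separated => n.
  have -> : (1 - y) * l - 1 = (1 - y) * (l - \sum_(k < n) y ^+ k) - y ^+ n.
    have geo : (1 - y) * \sum_(k < n) y ^+ k = 1 - y ^+ n.
      by rewrite -(opprB y 1) mulNr -subrX1 opprB.
    have sub_add (c d : U') : c - (1 - d) - d = c - 1.
      by rewrite opprB addrA addrAC addrK.
    by rewrite mulrBr geo sub_add.
  by apply: subB => //; apply: alg_filtration_idealMl.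
exists (red_cls (fpsC a^-1 *: l)); rewrite -rmorphM -scalerAr scalerAl.
by rewrite -(_ : 1 - y = fpsC a^-1 *: x) ?yl ?rmorph1 // /y opprB addrC subrK.
Qed.

(** Elements outside the kernel of [residue_eps] are invertible, so every proper ideal lies in that
    kernel. *)
Lemma quantum_dual_local : commutative_local_ring (red U').
Proof.
split; first exact: quantum_dual_red_comm.
have I_sub : residue_eps 0 = 0 /\ forall q r, residue_eps q = 0 -> residue_eps r = 0 ->
    residue_eps (q - r) = 0.
  split=> [|q r q0 r0]; last by rewrite residue_epsB q0 r0 subrr.
  by rewrite -(subrr 0) residue_epsB subrr.
have I_ideal a q b : residue_eps q = 0 -> residue_eps (a * q * b) = 0.
  by move=> q0; rewrite !residue_epsM q0 mulr0 mul0r.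
pose I := @Ideal (red U') (@Subgroup (red U') (fun q => residue_eps q = 0) I_sub) I_ideal.
have I1 : ~ I 1 by rewrite /= residue_eps1; apply/eqP/oner_neq0.
have sub_I (J : ideal (red U')) q : ~ J 1 -> J q -> I q.
  move=> J1 Jq; apply/eqP; apply: contra_notT J1 => /residue_eps_unit[r <-].
  exact: Defs.idealMr.
exists I; split; first by split=> // J _ J1 q; apply: sub_I.
move=> J [J1 Jmax] q; split=> [|Iq]; first exact: sub_I.
by apply: (Jmax I) => // r; apply: sub_I.
Qed.

Lemma quantum_dual_red_complete : complete_filtration (red_filt F).
Proof.
apply: complete_filtration_seq.
- move=> q Fq; have [x qx] : exists x, q = red_cls x by exists (rep q); rewrite red_repK.
  (* Separation amounts to hbar U' being closed in U' for the filtration. Only finitely much of x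
     matters for each condition: n = 1 serves for the counit, n = |P| + 1 for [delta P]. *)
  have Hx n : exists f w, F n f /\ x = f + hbar *: w :> U'.
    have [f Ff] := Fq n; rewrite qx => /cls_eq[w Ew]; exists f, w; split=> //.
    by rewrite -[hbar]expr1 -Ew addrC subrK.
  have [|P|y Sy yE] := @quantum_dual_div _ _ freeU Delta eps 1 (val x).
  - have [f [w [Ff ->]]] := Hx 1%N; apply: hpow_linear.
    rewrite (linearD iota); apply: hpowD; first exact: Ff.
    by rewrite (linearZ_LR iota) -[hbar]expr1; apply: hpow_hbarX.
  - have [f [w [Ff ->]]] := Hx (leaves P + 1)%N.
    rewrite (linearD iota) linearD; apply: hpowD; first by apply: hpow_linear; apply: Ff.
    rewrite (linearZ_LR iota) linearZ_LR addnC -[hbar]expr1; apply: hpow_mul.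
    exact: quantum_dual_valP.
  have [y' y'E] := quantum_dual_sub Sy; rewrite qx; apply/cls0P; exists y'.
  by apply: val_inj; rewrite yE -y'E.
- move=> u Fu; have /choice[f Hf] n : exists f, F n f /\ u n.+1 - u n = red_cls f.
    by have [f Ff fE] := Fu n; exists f.
  (* Arbitrary representatives of the u n need not be Cauchy in U'; lifting the successive
     differences inside the filtration gives ones that are. *)
  pose s n : U' := rep (u 0%N) + \sum_(k < n) f k.
  have sS n : s n.+1 = s n + f n by rewrite /s big_ord_recr addrA.
  have su n : red_cls (s n) = u n.
    elim: n => [|n IHn]; first by rewrite /s big_ord0 addr0 red_repK.
    by rewrite sS raddfD /= IHn -(Hf n).2 addrC subrK.
  have [n|l Hl] := @quantum_dual_filt_seq s.
    by rewrite sS addrC addKr; exact: (Hf n).1.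
  exists (red_cls l) => n; exists (l - s n); first exact: Hl.
  by rewrite raddfB /= su.
Qed.

(** * The coproduct of U' and its reduction *)

Lemma tensor_seq_lift (s : seq (U * U)) :
  (forall p, p \in s -> p.1 \in qd /\ p.2 \in qd) ->
  exists t, tensor_map iota iota t = tcls s.
Proof.
elim: s => [|[x y] s IHs] Ss; first by exists 0; rewrite (linear0 (tensor_map iota iota)).
have [|t tE] := IHs; first by move=> p ps; apply: Ss; rewrite inE ps orbT.
have [/= /quantum_dual_sub[x' <-] /quantum_dual_sub[y' <-]] := Ss _ (mem_head _ _).
exists (pure x' y' + t); rewrite (linearD (tensor_map iota iota)) -cat1s tcls_cat.
by congr (_ + _); [apply: (tensor_map_pure iota iota)|apply: tE].
Qed.

Lemma quantum_dual_coproduct : exists Delta_U' : {lrmorphism U' -> bar_ctensor F},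
  forall x, bar_ctensor_val (Delta_U' x) = Delta (val x).
Proof.
have /choice[D DE] (x : U') : exists w : bar_ctensor F, bar_ctensor_val w = Delta (val x).
  apply: (bar_ctensor_val_surj freeU) => n.
  have [s /tensor_seq_lift[t <-] ->] := quantum_dual_Delta freeU heps (valP x) n.
  by exists t.
have inj := @bar_ctensor_val_inj _ _ _ freeU hS.
have D_lin : linear D.
  move=> c x y; apply: inj; rewrite bar_ctensor_val_linear !DE.
  by rewrite (linearP iota) linearP.
have D_mon : monoid_morphism D.
  split=> [|x y]; apply: inj; first by rewrite DE bar_ctensor_val1 -[LHS]/(Delta 1) rmorph1.
  by rewrite DE bar_ctensor_valM !DE -rmorphM.
by exists (lrmorphism_of D_lin D_mon).
Qed.

Variable Delta_U' : {lrmorphism U' -> bar_ctensor F}.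
Hypothesis Delta_U'E : forall x, bar_ctensor_val (Delta_U' x) = Delta (val x).

(** By linearity [Delta] carries hbar^n U into multiples of hbar^n, and vanishing at level n can be
    tested in U (x)^ U. *)
Lemma coproduct_filt n x : F n x -> Delta_U' x n = 0.
Proof.
move=> Fx; apply: (bar_ctensor_val_proj0 freeU); rewrite Delta_U'E.
by apply: hpow_ctensor_proj; apply: hpow_linear.
Qed.

Lemma coproduct_continuous :
  filtered_continuous F (@proj_ker _ (ctensor_filt_mod F)) Delta_U'.
Proof.
move=> x n; exists n => y Fyx.
by rewrite -[_ - _](raddfB Delta_U'); apply: coproduct_filt.
Qed.

Lemma red_coproduct :
  exists Delta_O : {rmorphism red U' -> bar_red_tensor (red_filt F)},
  [/\ forall x, Delta_O (red_cls x) = bar_ctensor_red (Delta_U' x) &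
      filtered_continuous (red_filt F) (@proj_ker _ (red_tensor_filt (red_filt F))) Delta_O].
Proof.
pose g (q : red U') := bar_ctensor_red (Delta_U' (rep q)).
have redB := @bar_ctensor_redB _ _ F.
(* Independence of the representative: changing x by hbar y changes [Delta_U' x] by a multiple of
   hbar, which the reduction kills. *)
have gE (x : U') : g (red_cls x) = bar_ctensor_red (Delta_U' x).
  have [y Ey] := rep_cls (hideal U' 1) x.
  have DE : Delta_U' (rep (red_cls x)) - Delta_U' x = hbar *: Delta_U' y.
    by rewrite -raddfB -linearZ_LR -[hbar]expr1; congr (Delta_U' _).
  by apply/eqP; rewrite -subr_eq0 -redB DE bar_ctensor_red_hbar.
have g_add : zmod_morphism g.
  move=> q r; rewrite -(red_repK q) -(red_repK r) -raddfB !gE -redB.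
  by congr bar_ctensor_red; apply: raddfB.
have g_mon : monoid_morphism g.
  split=> [|q r].
    by rewrite -[1](rmorph1 (@red_cls K U')) gE rmorph1 bar_ctensor_red1.
  rewrite -(red_repK q) -(red_repK r) -rmorphM !gE -bar_ctensor_redM.
  by congr bar_ctensor_red; apply: rmorphM.
exists (rmorphism_of g_add g_mon); split; first exact: gE.
move=> q n; exists n => r [x Fx rqx].
rewrite -[_ - _](g_add r q) rqx gE.
suff : bar_ctensor_red (Delta_U' x) n = 0 by [].
have DE : Delta_U' x n = cls (ctensor_filt_mod F n) 0.
  by rewrite coproduct_filt // raddf0.
by rewrite (bar_ctensor_redE DE) !raddf0.
Qed.

End QuantumDual.

Unset Implicit Arguments.
Set Strict Implicit.
Set Printing Implicit Defensive.

Theorem theorem1p1 (K : fieldType) (hK : [pchar K] =i pred0)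
    (U : algType (fps K)) (hU : topologically_free U)
    (Delta : {lrmorphism U -> ctensor U U})
    (eps : {lrmorphism U -> (fps K)^o})
    (heps : counital Delta eps)
    (hred : reduces_to_enveloping Delta) :
  exists hU' : GRing.subalg_closed (quantum_dual Delta eps),
    let U' : algType (fps K) := subalg hU' in
    let F : alg_filtration U' := subalg_filt hU' in
    let O : pzRingType := red U' in
    let FO : alg_filtration O := red_filt F in
    [/\ topologically_free U',
        complete_filtration F,
        commutative_local_ring O,
        complete_filtration FO &
        exists (Delta_U' : {lrmorphism U' -> bar_ctensor F})
               (Delta_O : {rmorphism O -> bar_red_tensor FO}),
          [/\ forall x : U', bar_ctensor_val (Delta_U' x) = Delta (val x),
              filtered_continuous F (@proj_ker _ (ctensor_filt_mod F)) Delta_U',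
              forall x : U',
                Delta_O (red_cls x) = bar_ctensor_red (Delta_U' x) &
              filtered_continuous FO (@proj_ker _ (red_tensor_filt FO)) Delta_O]].
Proof.
have hS := quantum_dual_subalg hU heps; exists hS => U' F O FO.
have [Delta_U' Delta_U'E] := quantum_dual_coproduct hU heps hS.
have [Delta_O [Delta_OE Delta_O_cont]] := red_coproduct hU Delta_U'E.
split.
- exact/hregular_topologically_free/hregular_quantum_dual.
- exact: quantum_dual_complete.
- exact: quantum_dual_local.
- exact: quantum_dual_red_complete.
- exists Delta_U', Delta_O; split=> //; exact: coproduct_continuous.
Qed.
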